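(* Let $n\geq1$ and $f(t)\in\mathbb{Z}[t]$, and let $$\mathcal{C}_{3,n}(f)=\{\mathcal{A}=(H_1,\dots,H_n)\in(\mathbb{P}^{2*})^n\mid H_i\neq H_j\ (i\neq j),\ \chi(\mathcal{A},t)=f(t)\}.$$ Then $\mathcal{C}_{3,n}(f)^{\mathrm{free}}=\{\mathcal{A}\in\mathcal{C}_{3,n}(f)\mid\mathcal{A}\text{ is free}\}$ is a Zariski open subset of $\mathcal{C}_{3,n}(f)$.
   Context: A point of $(\mathbb{P}^{2*})^n$ with distinct entries is identified with a central arrangement of $n$ distinct planes $H_i$ through the origin in $\mathbb{C}^3$ with defining linear forms $\alpha_i$. $L(\mathcal{A})$ is the set of nonempty intersections of the $H_i$ (including $\mathbb{C}^3$), ordered by reverse inclusion, with Möbius function $\mu(\mathbb{C}^3)=1$, $\mu(X)=-\sum_{Y<X}\mu(Y)$; $\chi(\mathcal{A},t)=\sum_{X\in L(\mathcal{A})}\mu(X)t^{\dim X}$. $\mathcal{A}$ is free if $D(\mathcal{A})=\{\delta\in\bigoplus_iS\partial_{x_i}\mid\delta\alpha_j\in(\alpha_j)\ \forall j\}$, $S=\mathbb{C}[x_1,x_2,x_3]$, is a free $S$-module. $\mathcal{C}_{3,n}(f)$ carries the Zariski topology induced from $(\mathbb{P}^{2*})^n$. *)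

(* Defs.v *)
From HB Require Import structures.
From mathcomp Require Import all_boot all_order all_algebra.
From mathcomp Require Import mpoly.
From mathcomp Require Import reals.
From mathcomp Require Import complex.

Set Implicit Arguments.
Unset Strict Implicit.
Unset Printing Implicit Defensive.

Import GRing.Theory Num.Theory.
Local Open Scope ring_scope.

(* The complex numbers are R[i] for a realType R (any realType is the real field).
   A point of (P^2* )^n is represented by an n x 3 matrix A over R[i] whose i-th
   row (nonzero) is the coefficient vector of the linear form alpha_i defining
   H_i = ker alpha_i.  All notions below are invariant under rescaling rows. *)

Section Arrangements.
Variable R : realType.
Variable n : nat.
Local Notation C := (R[i]).
Local Notation Pt := 'M[C]_(n, 3).

Definition nonzero_rows (A : Pt) : Prop := forall i : 'I_n, row i A != 0.

Definition distinct_planes (A : Pt) : Prop :=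
  forall i j : 'I_n, i != j -> ~ (exists c : C, row i A = c *: row j A).

Definition restr_rows (A : Pt) (S : {set 'I_n}) : Pt :=
  \matrix_(i, j) (if i \in S then A i j else 0).

(* X_S = \bigcap_{i in S} H_i as a subspace of C^3 (row vectors x with
   alpha_i(x) = 0 for i in S), canonically represented via <<_>>%MS.
   X_set0 = C^3. *)
Definition inter_space (A : Pt) (S : {set 'I_n}) : 'M[C]_3 :=
  <<kermx (restr_rows A S)^T>>%MS.

Definition int_lattice (A : Pt) : seq 'M[C]_3 :=
  undup [seq inter_space A T | T : {set 'I_n}].

(* Moebius function on L(A) (order = reverse inclusion):
   mu(C^3) = 1, mu(X) = - sum_{Y in L, Y < X} mu(Y), where Y < X means X is a
   proper subspace of Y.  Strict chains in L have length <= 3, so the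
   recursion depth 4 is enough; [fuel] just makes the recursion structural. *)
Fixpoint moebius_rec (A : Pt) (fuel : nat) (X : 'M[C]_3) : int :=
  match fuel with
  | 0 => 0
  | k.+1 =>
      if (X == 1%:M)%MS then 1
      else - \sum_(Y <- int_lattice A | (X < Y)%MS) moebius_rec A k Y
  end.

Definition moebius (A : Pt) (X : 'M[C]_3) : int := moebius_rec A 4 X.

Definition char_poly_arr (A : Pt) : {poly int} :=
  \sum_(X <- int_lattice A) moebius A X *: 'X^(\rank X).

Local Notation Spol := {mpoly C[3]}.

Definition alpha (A : Pt) (i : 'I_n) : Spol := \sum_(k < 3) A i k *: 'X_k.

Definition der_apply (delta : 'rV[Spol]_3) (p : Spol) : Spol :=
  \sum_(k < 3) delta 0 k * mderiv k p.

Definition in_DA (A : Pt) (delta : 'rV[Spol]_3) : Prop :=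
  forall j : 'I_n, exists q : Spol, der_apply delta (alpha A j) = q * alpha A j.

Definition arr_free (A : Pt) : Prop :=
  exists (k : nat) (b : 'I_k -> 'rV[Spol]_3),
    [/\ forall i, in_DA A (b i),
        forall c : 'I_k -> Spol, \sum_(i < k) c i *: b i = 0 -> forall i, c i = 0
      & forall delta, in_DA A delta ->
          exists c : 'I_k -> Spol, delta = \sum_(i < k) c i *: b i].

Definition in_C3n (f : {poly int}) (A : Pt) : Prop :=
  [/\ nonzero_rows A, distinct_planes A & char_poly_arr A = f].

(* Zariski topology on (P^2* )^n: closed sets are common zero loci of
   multihomogeneous polynomials in the 3n homogeneous coordinates
   (variable mxvec_index i j <-> j-th coordinate of the i-th factor). *)
Definition multihomog (p : {mpoly C[n * 3]}) : Prop :=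
  exists d : 'I_n -> nat, forall m, m \in msupp p ->
    forall i : 'I_n, (\sum_(j < 3) m (mxvec_index i j))%N = d i.

Definition eval_pt (p : {mpoly C[n * 3]}) (A : Pt) : C :=
  p.@[fun k => mxvec A 0 k].

Definition zariski_open_in (Y W : Pt -> Prop) : Prop :=
  exists P : {mpoly C[n * 3]} -> Prop,
    (forall p, P p -> multihomog p) /\
    forall A : Pt, nonzero_rows A -> Y A ->
      (W A <-> exists p, P p /\ eval_pt p A != 0).

End Arrangements.

(* Main.v *)
(* Fix a plane ker alpha_0, let D_0 be the module of derivations of D(A) killing alpha_0,
   so that D(A) is the sum of D_0 and of the multiples of the Euler derivation, and let
   Q_0 be the product of the other n - 1 forms.  Let theta in D_0 be nonzero of minimal
   degree d.  For delta in D_0 the determinant of theta and delta is divisible by Q_0, and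
   the quotients form an ideal I.  It is saturated, and A is free iff I is the unit ideal.
   Adding the planes one at a time shows that in degrees k >= n - 1 the dimension of D_0 is
   determined by n and by the coefficient of t in the characteristic polynomial.  Hence, if
   some B with the same polynomial is free with exponents 1, d_1 <= d_2, the colength of I
   in high degrees is (d - d_1)(d - d_2), where d_1 + d_2 = n - 1.  Saturation propagates
   the bound on the codimension to all degrees, and A is free iff D_0 vanishes below
   degree d_1.  This says that a matrix whose entries are linear in the coefficients of A
   has full rank, and its maximal minors are multihomogeneous. *)

Require Import Defs.
From HB Require Import structures.
From mathcomp Require Import reals complex perm.
From mathcomp Require Import all_boot all_order all_algebra.
From mathcomp Require Import mpoly boolp ring zify.

Set Implicit Arguments.
Unset Strict Implicit.
Unset Printing Implicit Defensive.

Import GRing.Theory Num.Theory.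
Local Open Scope ring_scope.

(** * Prime factorizations *)

(** In terms of sheaves, theta is a section of a twist of a rank 2 bundle on the plane, I is the
    ideal of its zero scheme and $(d-d_1)(d-d_2)$ is a second Chern number. Here cohomology is
    replaced by dimension counts. Minimality of $d$ and unique factorization show that the
    derivations of D_0 proportional to theta are its polynomial multiples, so each graded piece of
    D_0 splits into a piece of $S$ and a piece of I. Saturation of I comes from the Koszul relations
    among the variables. An upper bound on the codimension settles $d \ge d_1$. If $d \le d_2$ the
    product is at most 0, so I is everything. If $d > d_2$, then I vanishes in degree $2d-n$, where
    the forms already have dimension larger than $(d-d_1)(d-d_2)$, a contradiction. For $d < d_1$
    the colength is positive, so I is not the unit ideal. A basis of the first plane does not depend
    polynomially on A. The final linear system therefore uses standard coordinates, with the
    quotients that witness tangency as additional unknowns. *)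

Definition divs (R : comNzRingType) (a b : R) : Prop := exists c, b = c * a.

Definition prime_elt (R : idomainType) (p : R) : Prop :=
  [/\ p != 0, p \isn't a GRing.unit
    & forall a b, divs p (a * b) -> divs p a \/ divs p b].

(** Only existence is demanded: the factors are prime and not merely irreducible, which already
    forces uniqueness. *)
Definition ufd (R : idomainType) : Prop := forall a : R, a != 0 ->
  exists (u : R) (s : seq R),
    [/\ u \is a GRing.unit, {in s, forall p, prime_elt p} & a = u * \prod_(p <- s) p].

Section Divs.
Variable R : comNzRingType.
Implicit Types a b c : R.

Lemma divs_refl a : divs a a.
Proof. by exists 1; rewrite mul1r. Qed.

Lemma divs0 a : divs a 0.
Proof. by exists 0; rewrite mul0r. Qed.

Lemma divsMl a b c : divs a b -> divs a (c * b).
Proof. by case=> d ->; exists (c * d); rewrite mulrA. Qed.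

Lemma divsMr a b c : divs a b -> divs a (b * c).
Proof. by rewrite mulrC; apply: divsMl. Qed.

Lemma divsD a b c : divs a b -> divs a c -> divs a (b + c).
Proof. by move=> [d ->] [e ->]; exists (d + e); rewrite mulrDl. Qed.

Lemma divsN a b : divs a b -> divs a (- b).
Proof. by move=> [d ->]; exists (- d); rewrite mulNr. Qed.

Lemma divsB a b c : divs a b -> divs a c -> divs a (b - c).
Proof. by move=> ab ac; apply: divsD => //; apply: divsN. Qed.

Lemma divs_sum (I : Type) (r : seq I) (P : pred I) (F : I -> R) a :
  (forall i, P i -> divs a (F i)) -> divs a (\sum_(i <- r | P i) F i).
Proof. by move=> h; apply: big_ind => //; [exact: divs0 | exact: divsD]. Qed.

Lemma divs_prod_mem (I : eqType) (l : seq I) (G : I -> R) i :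
  i \in l -> divs (G i) (\prod_(j <- l) G j).
Proof. by move=> il; rewrite (big_rem i) //; apply/divsMr/divs_refl. Qed.

End Divs.

Section Ufd.
Variable R : idomainType.
Implicit Types a b c p q r s : R.

Lemma prime_divs_prod (I : Type) (l : seq I) (P : pred I) (F : I -> R) p :
  prime_elt p -> divs p (\prod_(i <- l | P i) F i) -> exists2 i, P i & divs p (F i).
Proof.
move=> [p0 pnu pp]; elim: l => [|i l IH].
  by rewrite big_nil => -[c c1]; case/negP: pnu; apply/unitrP; exists c; rewrite (mulrC p) -c1.
rewrite big_cons; case: ifP => // Pi /pp[|/IH //] h; by exists i.
Qed.

(* In a domain with prime factorizations any two proportional pairs are multiples
   of a common pair: a substitute for greatest common divisors. *)
Lemma ufd_proportional : ufd R -> forall p q r s, p * s = q * r ->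
  exists c e p0 q0, [/\ p = c * p0, q = c * q0, r = e * p0 & s = e * q0].
Proof.
move=> U p q r s e.
have [p0|pn0] := eqVneq p 0.
  move: e; rewrite p0 mul0r => /esym/eqP; rewrite mulf_eq0 => /orP[]/eqP->.
    by exists 0, 1, r, s; rewrite !mul0r !mul1r.
  by exists q, s, 0, 1; rewrite !mulr0 !mulr1.
have [u [l [uu lp pE]]] := U _ pn0; rewrite {pn0}pE in e *.
elim: l lp q r s e => [|x l IH] lp q r s.
  rewrite big_nil mulr1 => e.
  exists u, r, 1, (u^-1 * q); split; rewrite ?mulr1 // ?mulVKr //.
  by apply: (mulrI uu); rewrite e mulrCA mulVKr // mulrC.
have [x0 _ xp] := lp x (mem_head _ _).
have {}lp : {in l, forall p, prime_elt p} by move=> y yl; apply: lp; rewrite inE yl orbT.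
rewrite big_cons mulrCA => e.
have : divs x (q * r) by exists ((u * \prod_(j <- l) j) * s); rewrite -e; ring.
case/xp => -[y yE].
  have [|c [f [p1 [q1 [h1 h2 h3 h4]]]]] := IH lp y r s.
    by apply: (mulfI x0); rewrite mulrA e yE; ring.
  by exists (x * c), f, p1, q1; split; rewrite ?h1 ?yE ?h2 //; ring.
have [|c [f [p1 [q1 [h1 h2 h3 h4]]]]] := IH lp q y s.
  by apply: (mulfI x0); rewrite mulrA e yE; ring.
exists c, f, (x * p1), q1; split => //.
  by rewrite h1 mulrCA.
by rewrite yE h3; ring.
Qed.

(** Each prime of the product divides [x] or [y] and is cancelled there. The number of factors is
    recorded because it enters the induction measure of [ufd_poly]. *)
Lemma ufd_split (s : seq R) u x y : u \is a GRing.unit ->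
  {in s, forall p, prime_elt p} -> x * y = u * \prod_(p <- s) p ->
  exists (u1 : R) (s1 : seq R) (u2 : R) (s2 : seq R), [/\ u1 \is a GRing.unit, {in s1, forall p, prime_elt p},
     u2 \is a GRing.unit, {in s2, forall p, prime_elt p} &
     [/\ x = u1 * \prod_(p <- s1) p, y = u2 * \prod_(p <- s2) p
       & (size s1 + size s2 = size s)%N]].
Proof.
move=> uu; elim: s x y => [|p s IH] x y sp.
  rewrite big_nil mulr1 => e.
  have : x * y \is a GRing.unit by rewrite e.
  rewrite unitrM => /andP[ux uy].
  by exists x, [::], y, [::]; rewrite !big_nil !mulr1; split.
have [p0 pn pp] := sp p (mem_head _ _).
have {}sp : {in s, forall p, prime_elt p} by move=> z zs; apply: sp; rewrite inE zs orbT.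
have cat (t : seq R) : {in t, forall p, prime_elt p} -> {in p :: t, forall p, prime_elt p}.
  by move=> h z; rewrite inE => /orP[/eqP->//|/h].
rewrite big_cons mulrCA => e.
have : divs p (x * y) by rewrite e; exists (u * \prod_(j <- s) j); rewrite mulrC.
case/pp => -[z zE].
  have [|u1 [s1 [u2 [s2 [h1 h2 h3 h4 [h5 h6 h7]]]]]] := IH z y sp.
    by apply: (mulfI p0); rewrite -e zE mulrA (mulrC p).
  exists u1, (p :: s1), u2, s2; split=> //; first exact: cat.
  by split=> //; [rewrite big_cons zE h5; ring | rewrite /= -h7 addSn].
have [|u1 [s1 [u2 [s2 [h1 h2 h3 h4 [h5 h6 h7]]]]]] := IH x z sp.
  by apply: (mulfI p0); rewrite -e zE mulrA (mulrC p) -mulrA (mulrC p).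
exists u1, s1, u2, (p :: s2); split=> //; first exact: cat.
by split=> //; [rewrite big_cons zE h6; ring | rewrite /= -h7 addnS].
Qed.

End Ufd.

(** * Unique factorization in polynomial rings *)

Section UfdPoly.
Variable R : idomainType.
Implicit Types p q r s : {poly R}.

(** Gauss's lemma. If [x] divides [a * b], it divides one of the two leading coefficients; deleting
    that leading term keeps the divisibility and lowers the total size. *)
Lemma prime_polyC (x : R) : prime_elt x -> prime_elt x%:P.
Proof.
move=> [x0 xn xp]; split; first by rewrite polyC_eq0.
  by rewrite poly_unitE size_polyC x0 coefC.
move=> a b; have [k] := ubnP (size a + size b); elim: k a b => // k IH a b le_k ab.
have [->|a0] := eqVneq a 0; first by left; apply: divs0.
have [->|b0] := eqVneq b 0; first by right; apply: divs0.
have trunc (f : {poly R}) : f != 0 -> divs x (lead_coef f) ->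
    exists g : {poly R}, (size g < size f)%N /\ divs x%:P (f - g).
  move=> f0 [y yE]; exists (f - lead_coef f *: 'X^((size f).-1)); split.
    have sf : (0 < size f)%N by rewrite size_poly_gt0.
    rewrite -(prednK sf) ltnS; apply/leq_sizeP => j.
    rewrite leq_eqVlt => /orP[/eqP<-|lt_j].
      by rewrite coefB coefZ coefXn eqxx mulr1 subrr.
    rewrite coefB coefZ coefXn gtn_eqF // mulr0 subr0 nth_default //.
    by rewrite -(prednK sf).
  by rewrite subKr yE; exists (y *: 'X^((size f).-1)); rewrite -!mul_polyC polyCM; ring.
have : divs x (lead_coef a * lead_coef b).
  by rewrite -lead_coefM; case: ab => c ->; exists (lead_coef c); rewrite lead_coefM lead_coefC.
case/xp => [/(trunc _ a0)|/(trunc _ b0)] [g [sg dg]].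
  have : divs x%:P (g * b).
    by rewrite -[g](subKr a) mulrBl; apply: divsB => //; apply: divsMr.
  case/IH => [|dg'|]; [|left|by right].
    by rewrite -ltnS; apply: leq_trans le_k; rewrite ltnS ltn_add2r.
  by rewrite -(subrK g a); apply: divsD.
have : divs x%:P (a * g).
  by rewrite -[g](subKr b) mulrBr; apply: divsB => //; apply: divsMl.
case/IH => [||dg']; [|by left|right].
  by rewrite -ltnS; apply: leq_trans le_k; rewrite ltnS ltn_add2l.
by rewrite -(subrK g b); apply: divsD.
Qed.

(** The constant [g] is cancelled one prime at a time. A prime that misses [c] or misses [e] divides
    both [v1] and [v2]; otherwise it divides both [c] and [e]. Either way it can be removed from all
    four equations at once. *)
Lemma proportional_cancel (g : R) (c e v1 v2 p q r s : {poly R}) : ufd R -> g != 0 ->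
  g%:P * p = c * v1 -> g%:P * q = c * v2 -> g%:P * r = e * v1 -> g%:P * s = e * v2 ->
  exists c' e' p0 q0, [/\ p = c' * p0, q = c' * q0, r = e' * p0 & s = e' * q0].
Proof.
move=> U g0; have [u [l [uu lp ->]]] := U _ g0.
elim: l lp c e v1 v2 => [|x l IH] lp c e v1 v2.
  rewrite big_nil mulr1 => h1 h2 h3 h4.
  have uV (f h w : {poly R}) : u%:P * f = h * w -> f = (u^-1)%:P * h * w.
    by move=> E; rewrite -mulrA -E mulrA -polyCM mulVr // mul1r.
  by exists (u^-1%:P * c), (u^-1%:P * e), v1, v2; split; apply: uV.
have [x0 _ xp] := prime_polyC (lp x (mem_head _ _)).
have {}lp : {in l, forall p : R, prime_elt p} by move=> y yl; apply: lp; rewrite inE yl orbT.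
rewrite big_cons mulrCA polyCM -!mulrA => h1 h2 h3 h4.
have dx a b h : x%:P * h = a * b -> divs x%:P (a * b) by move=> <-; exists h; rewrite mulrC.
have canx a b h y : x%:P * h = a * b -> b = y * x%:P -> h = a * y.
  by move=> E bE; apply: (mulfI x0); rewrite E bE mulrA mulrC.
have canx' a b h y : x%:P * h = a * b -> a = y * x%:P -> h = y * b.
  by move=> E aE; apply: (mulfI x0); rewrite E aE mulrA (mulrC y).
have case2 : divs x%:P v1 -> divs x%:P v2 ->
    exists c' e' p0 q0, [/\ p = c' * p0, q = c' * q0, r = e' * p0 & s = e' * q0].
  move=> [w1 e1] [w2 e2].
  by apply: (IH lp c e w1 w2); [apply: canx h1 e1 | apply: canx h2 e2
    | apply: canx h3 e1 | apply: canx h4 e2].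
have [[c' ec]|nc] := EM (divs x%:P c); last first.
  by apply: case2; [case/xp: (dx _ _ _ h1) | case/xp: (dx _ _ _ h2)].
have [[e' ee]|ne] := EM (divs x%:P e); last first.
  by apply: case2; [case/xp: (dx _ _ _ h3) | case/xp: (dx _ _ _ h4)].
by apply: (IH lp c' e' v1 v2); [apply: canx' h1 ec | apply: canx' h2 ec
    | apply: canx' h3 ee | apply: canx' h4 ee].
Qed.

(** Euclid's algorithm with pseudo-division: replacing [q], [s] by [g * q - t * p], [g * s - t * r]
    keeps the proportion and lowers the degree. The factor [g] brought in is the leading coefficient
    of [p] and is removed by [proportional_cancel]. *)
Lemma poly_proportional : ufd R -> forall p q r s, p * s = q * r ->
  exists c e p0 q0, [/\ p = c * p0, q = c * q0, r = e * p0 & s = e * q0].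
Proof.
move=> U p q r s; have [k] := ubnP (size p + size q).
elim: k p q r s => // k IH p q r s.
wlog le_pq : p q r s / (size p <= size q)%N.
  move=> W; have [le_pq|/ltnW le_qp] := leqP (size p) (size q); first exact: W.
  rewrite addnC => lt_k /esym E.
  have [c [e [p0 [q0 [h1 h2 h3 h4]]]]] := W _ _ _ _ le_qp lt_k E.
  by exists c, e, q0, p0.
move=> lt_k e.
have [p0|pn0] := eqVneq p 0.
  move: e; rewrite p0 mul0r => /esym/eqP; rewrite mulf_eq0 => /orP[]/eqP->.
    by exists 0, 1, r, s; rewrite !mul0r !mul1r.
  by exists q, s, 0, 1; rewrite !mulr0 !mulr1.
have sp : (0 < size p)%N by rewrite size_poly_gt0.
have qn0 : (0 < size q)%N by apply: leq_trans le_pq.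
pose t : {poly R} := lead_coef q *: 'X^(size q - size p).
pose g := (lead_coef p)%:P.
have g0 : lead_coef p != 0 by rewrite lead_coef_eq0.
have lt_q1 : (size (g * q - t * p)%R < size q)%N.
  rewrite -(prednK qn0) ltnS; apply/leq_sizeP => j le_j.
  rewrite coefB coefCM -scalerAl coefZ coefXnM ltnNge.
  have -> /= : (size q - size p <= j)%N by lia.
  move: le_j; rewrite leq_eqVlt => /orP[/eqP <-|lt_j].
    have -> : ((size q).-1 - (size q - size p) = (size p).-1)%N by lia.
    by rewrite -!lead_coefE mulrC subrr.
  by rewrite !nth_default ?mulr0 ?subrr //; move: le_pq sp qn0 lt_j; move: (size p) (size q) => ? ?; lia.
have [||c [f [p0 [q0 [h1 h2 h3 h4]]]]] := IH p (g * q - t * p) r (g * s - t * r).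
- by rewrite -ltnS; apply: leq_trans lt_k; rewrite ltnS ltn_add2l.
- by rewrite mulrBr mulrCA e mulrBl !mulrA (mulrC p).
apply: (@proportional_cancel (lead_coef p) c f (g * p0) (q0 + t * p0)) => //.
- by rewrite mulrCA -h1.
- by rewrite mulrDr -h2 mulrCA -h1 subrK.
- by rewrite mulrCA -h3.
- by rewrite mulrDr -h4 mulrCA -h3 subrK.
Qed.

(** The measure is the size plus the number of primes in the leading coefficient. It is at least 2
    on nonunits, and the measures of two factors add up to one more than that of their product, so
    both factors of a proper factorization have smaller measure. *)
Lemma ufd_poly : ufd R -> ufd {poly R}.
Proof.
move=> U.
suff main k (a : {poly R}) (u : R) (l : seq R) : a != 0 -> u \is a GRing.unit ->
    {in l, forall p : R, prime_elt p} -> lead_coef a = u * \prod_(p <- l) p ->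
    (size a + size l < k)%N ->
    exists (u' : {poly R}) (s : seq {poly R}), [/\ u' \is a GRing.unit,
       {in s, forall p, prime_elt p} & a = u' * \prod_(p <- s) p].
  move=> a a0; have la0 : lead_coef a != 0 by rewrite lead_coef_eq0.
  have [u [l [uu lp E]]] := U _ la0.
  exact: (main _ a u l a0 uu lp E (ltnSn _)).
elim: k a u l => // k IH a u l a0 uu lp aE lt_k.
have [ua|nua] := boolP (a \is a GRing.unit).
  by exists a, [::]; rewrite big_nil mulr1.
have [irr|] := EM (forall b c, a = b * c -> b \is a GRing.unit \/ c \is a GRing.unit).
  exists 1, [:: a]; rewrite unitr1 big_seq1 mul1r; split=> // z; rewrite inE => /eqP-> {z}.
  split=> // b c [t tE].
  (* Irreducible elements are prime: here [a = x * p0]. If [x] is a unit then [a] is associated to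
     [p0], which divides [c]; if [p0] is a unit then [a] is associated to [x], which divides [b]. *)
  have [x [y [p0 [q0 [h1 h2 h3 h4]]]]] := poly_proportional U (esym (etrans tE (mulrC _ _))).
  case: (irr _ _ h1) => [ux|up].
    right; rewrite h3; exists (y * x^-1).
    by rewrite h1 mulrA mulrVK.
  by left; rewrite h2; exists (q0 * p0^-1); rewrite h1 mulrCA mulrVK.
move=> /existsNP[b /existsNP[c /not_implyP[abc /not_orP[/negP nub /negP nuc]]]].
have b0 : b != 0 by apply: contraNneq a0 => b0; rewrite abc b0 mul0r.
have c0 : c != 0 by apply: contraNneq a0 => c0; rewrite abc c0 mulr0.
have lE : lead_coef b * lead_coef c = u * \prod_(p <- l) p by rewrite -lead_coefM -abc.
have [u1 [s1 [u2 [s2 [h1 h2 h3 h4 [h5 h6 h7]]]]]] := ufd_split uu lp lE.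
have sE : (size a = (size b + size c).-1)%N by rewrite abc size_mul.
have pos (f : {poly R}) v (t : seq R) : f != 0 -> f \isn't a GRing.unit ->
    v \is a GRing.unit -> lead_coef f = v * \prod_(p <- t) p -> (1 < size f + size t)%N.
  move=> f0 nuf uv E; case: t E => [|? ?] E; last first.
    by rewrite /= addnS ltnS addn_gt0 size_poly_gt0 f0.
  rewrite addn0 ltnNge; apply: contra nuf => sf.
  have s1f : size f = 1%N by apply/eqP; rewrite eqn_leq sf size_poly_gt0.
  have f0E : lead_coef f = f`_0 by rewrite lead_coefE s1f.
  by rewrite poly_unitE s1f eqxx /= -f0E E big_nil mulr1.
have pb := pos b _ _ b0 nub h1 h5; have pc := pos c _ _ c0 nuc h3 h6.
have sb : (0 < size b)%N by rewrite size_poly_gt0.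
have tot : (size b + size s1 + (size c + size s2) = (size a + size l).+1)%N.
  by rewrite -h7 sE -addSn prednK ?addn_gt0 ?sb // addnACA.
have [lt_b lt_c] : (size b + size s1 < k)%N /\ (size c + size s2 < k)%N.
  move: pb pc tot lt_k; move: (size b + size s1)%N (size c + size s2)%N => x y; lia.
have [v1 [t1 [k1 k2 k3]]] := IH b u1 s1 b0 h1 h2 h5 lt_b.
have [v2 [t2 [m1 m2 m3]]] := IH c u2 s2 c0 h3 h4 h6 lt_c.
exists (v1 * v2), (t1 ++ t2); split.
- by rewrite unitrM k1.
- by move=> z; rewrite mem_cat => /orP[/k2|/m2].
- by rewrite abc k3 m3 big_cat mulrACA.
Qed.

End UfdPoly.

Lemma ufd_transfer (R S : idomainType) (f : {rmorphism R -> S}) (g : {rmorphism S -> R}) :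
  cancel f g -> cancel g f -> ufd R -> ufd S.
Proof.
move=> fK gK U a a0.
have ga0 : g a != 0 by apply: contraNneq a0 => ga0; rewrite -(gK a) ga0 rmorph0.
have [u [s [uu sp E]]] := U _ ga0.
exists (f u), (map f s); split; first exact: rmorph_unit.
  move=> _ /mapP[p ps ->]; have [p0 pn pp] := sp _ ps; split.
  - by apply: contraNneq p0 => p0; rewrite -(fK p) p0 rmorph0.
  - by apply: contra pn => /(rmorph_unit g); rewrite fK.
  - move=> b c [d dE]; have /pp[] : divs p (g b * g c).
      by exists (g d); rewrite -rmorphM dE rmorphM fK.
    - by case=> t tE; left; exists (f t); rewrite -rmorphM -tE gK.
    - by case=> t tE; right; exists (f t); rewrite -rmorphM -tE gK.
by rewrite big_map -rmorph_prod -rmorphM -E gK.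
Qed.

Lemma mpoly_rmorph_ext n (R : comNzRingType) (S : comNzRingType)
    (f g : {rmorphism {mpoly R[n]} -> S}) :
  (forall c, f c%:MP = g c%:MP) -> (forall i, f 'X_i = g 'X_i) -> f =1 g.
Proof.
move=> fgC fgX p; rewrite (mpolyE p) !rmorph_sum; apply: eq_bigr => m _.
rewrite -mul_mpolyC !rmorphM fgC; congr (_ * _).
rewrite mpolyXE_id !rmorph_prod; apply: eq_bigr => i _.
by rewrite !rmorphXn fgX.
Qed.

(** * Multivariate polynomials as univariate polynomials in the last variable *)

Section MuniIso.
Variables (n : nat) (R : idomainType).

Definition muni_inv : {rmorphism {poly {mpoly R[n]}} -> {mpoly R[n.+1]}} :=
  horner_morph (fun x => mulrC 'X_(@ord_max n) (mwiden (x : {mpoly R[n]}))).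

Lemma muni_invC c : muni_inv c%:P = mwiden c.
Proof. exact: horner_morphC. Qed.

Lemma muni_invX : muni_inv 'X = 'X_ord_max.
Proof. exact: horner_morphX. Qed.

Lemma muni_widen (i : 'I_n) : muni ('X_(widen_ord (leqnSn n) i) : {mpoly R[n.+1]}) = ('X_i)%:P.
Proof.
rewrite /muni mmapX mmap1U; case: splitP => [j /= E|j /= E].
  by congr ('X__)%:P; apply: val_inj.
by have := ltn_ord i; rewrite E ltnNge leq_addr.
Qed.

Lemma muni_max : muni ('X_ord_max : {mpoly R[n.+1]}) = 'X.
Proof.
rewrite /muni mmapX mmap1U; case: splitP => [j /= E|j _ //].
by have := ltn_ord j; rewrite -E ltnn.
Qed.

Lemma mwiden_X (i : 'I_n) : mwiden ('X_i : {mpoly R[n]}) = 'X_(widen_ord (leqnSn n) i).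
Proof. by rewrite mwidenX mnmwiden1. Qed.

Lemma muniK : cancel (@muni n R) muni_inv.
Proof.
have E : muni_inv \o @muni n R =1 idfun.
  apply: (@mpoly_rmorph_ext _ _ _ (muni_inv \o @muni n R) idfun) => [c|i] /=.
    by rewrite muniC muni_invC mwidenC.
  have [->|lt_i] := eqVneq i ord_max; first by rewrite muni_max muni_invX.
  have lt_in : (i < n)%N by rewrite ltn_neqAle -ltnS ltn_ord andbT.
  have -> : i = widen_ord (leqnSn n) (Ordinal lt_in) by apply: val_inj.
  by rewrite muni_widen muni_invC mwiden_X.
by move=> p; apply: E.
Qed.

Lemma muni_mwiden (c : {mpoly R[n]}) : muni (mwiden c) = c%:P.
Proof.
apply: (@mpoly_rmorph_ext _ _ _ (@muni n R \o @mwiden n R) polyC) => [d|i] /=.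
  by rewrite mwidenC muniC.
by rewrite mwiden_X muni_widen.
Qed.

Lemma muni_invK : cancel muni_inv (@muni n R).
Proof.
move=> p; rewrite -[p]coefK poly_def !rmorph_sum; apply: eq_bigr => i _ /=.
rewrite -mul_polyC !rmorphM !rmorphXn muni_invC muni_invX.
by congr (_ * _ ^+ _); [exact: muni_mwiden | exact: muni_max].
Qed.

End MuniIso.

Lemma ufd_mpoly (F : fieldType) n : ufd {mpoly F[n]}.
Proof.
elim: n => [a a0|n IH].
  exists a, [::]; split; rewrite ?big_nil ?mulr1 //.
  have aE : a = (a@_0%MM)%:MP.
    apply/mpolyP => m; rewrite mcoeffC.
    have -> : m = 0%MM by apply/mnmP => -[].
    by rewrite eqxx mulr1.
  by rewrite aE; apply: rmorph_unit; rewrite unitfE; apply: contraNneq a0 => a0;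
     rewrite aE a0.
exact: (ufd_transfer (@muni_invK n F) (@muniK n F) (ufd_poly IH)).
Qed.

Lemma mpoly_proportional (F : fieldType) n (p q r s : {mpoly F[n]}) : p * s = q * r ->
  exists c e p0 q0, [/\ p = c * p0, q = c * q0, r = e * p0 & s = e * q0].
Proof. exact: ufd_proportional (@ufd_mpoly F n) p q r s. Qed.

(** * Dimensions of spaces of forms *)

Section HasDim.
Variable F : fieldType.

Definition indep (V : lmodType F) d (b : 'I_d -> V) : Prop :=
  forall c : 'I_d -> F, \sum_i c i *: b i = 0 -> forall i, c i = 0.

(* [V] may be infinite-dimensional, so [vectType] and [{vspace V}] do not apply. *)
Definition hasdim (V : lmodType F) (P : V -> Prop) (d : nat) : Prop :=
  exists b : 'I_d -> V, [/\ forall i, P (b i), indep b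
    & forall x, P x -> exists c : 'I_d -> F, x = \sum_i c i *: b i].

Definition subspace (V : lmodType F) (P : V -> Prop) : Prop :=
  P 0 /\ forall a x y, P x -> P y -> P (a *: x + y).

Section One.
Variable V : lmodType F.
Implicit Types (P Q : V -> Prop).

Lemma subspaceZ P a x : subspace P -> P x -> P (a *: x).
Proof. by move=> [P0 PL] Px; rewrite -[a *: x]addr0; apply: PL. Qed.

Lemma subspaceD P x y : subspace P -> P x -> P y -> P (x + y).
Proof. by move=> [P0 PL] Px Py; rewrite -[x]scale1r; apply: PL. Qed.

Lemma subspaceB P x y : subspace P -> P x -> P y -> P (x - y).
Proof. by move=> sP Px Py; rewrite -scaleN1r; apply: subspaceD => //; apply: subspaceZ. Qed.

Lemma subspace_sum P (I : Type) (r : seq I) (D : pred I) (f : I -> V) :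
  subspace P -> (forall i, D i -> P (f i)) -> P (\sum_(i <- r | D i) f i).
Proof. by move=> sP h; apply: big_ind => //; [case: sP | move=> *; apply: subspaceD]. Qed.

Lemma subspace_comb P d (c : 'I_d -> F) (b : 'I_d -> V) :
  subspace P -> (forall i, P (b i)) -> P (\sum_i c i *: b i).
Proof. by move=> sP h; apply: subspace_sum => // i _; apply: subspaceZ. Qed.

Lemma hasdim_dep P d e (x : 'I_e -> V) : hasdim P d -> (forall i, P (x i)) -> (d < e)%N ->
  exists c : 'I_e -> F, (exists i, c i != 0) /\ \sum_i c i *: x i = 0.
Proof.
move=> [b [_ _ gen]] Px lt_de.
have /choice[M ME] i := gen _ (Px i).
pose A : 'M_(e, d) := \matrix_(i, j) M i j.
have : kermx A != 0.
  by rewrite -mxrank_eq0 mxrank_ker -lt0n subn_gt0 (leq_ltn_trans (rank_leq_col A)).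
case/rowV0Pn => y /sub_kermxP yA y0.
exists (fun i => y 0 i); split.
  by case/rV0Pn: y0 => i yi; exists i.
transitivity (\sum_j (y *m A) 0 j *: b j).
  under eq_bigr => i _ do rewrite ME scaler_sumr.
  rewrite exchange_big; apply: eq_bigr => j _.
  rewrite mxE scaler_suml; apply: eq_bigr => i _.
  by rewrite scalerA mxE.
by rewrite yA big1 // => j _; rewrite mxE scale0r.
Qed.

Lemma indep_le P d e (x : 'I_e -> V) : hasdim P d -> (forall i, P (x i)) -> indep x ->
  (e <= d)%N.
Proof.
move=> hP Px ix; rewrite leqNgt; apply/negP => lt_de.
have [c [[i ci] cE]] := hasdim_dep hP Px lt_de.
by move: ci; rewrite (ix _ cE) eqxx.
Qed.

Lemma hasdim_le P Q d e : (forall x, P x -> Q x) -> hasdim P d -> hasdim Q e -> (d <= e)%N.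
Proof. by move=> PQ [b [Pb ib _]] hQ; apply: (indep_le hQ _ ib) => i; apply: PQ. Qed.

Lemma hasdim_uniq P d e : hasdim P d -> hasdim P e -> d = e.
Proof. by move=> h1 h2; apply/eqP; rewrite eqn_leq !(@hasdim_le P P). Qed.

Lemma hasdim_eq P Q d : (forall x, P x <-> Q x) -> hasdim P d -> hasdim Q d.
Proof.
move=> PQ [b [Pb ib gb]]; exists b; split=> // [i|x /PQ]; [exact/PQ | exact: gb].
Qed.

Lemma indep_extend d (b : 'I_d -> V) (x : V) : indep b ->
  ~ (exists c : 'I_d -> F, x = \sum_i c i *: b i) ->
  indep (fun i : 'I_(d + 1) => match split i with inl j => b j | inr _ => x end).
Proof.
move=> ib nx c; rewrite big_split_ord /= big_ord1.
have El j : split (lshift 1 j) = inl j :> 'I_d + 'I_1 by exact: (unsplitK (inl j)).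
have Er j : split (rshift d j) = inr j :> 'I_d + 'I_1 by exact: (unsplitK (inr j)).
under eq_bigr => j _ do rewrite El.
rewrite Er => E.
have c0 : c (rshift d ord0) = 0.
  apply/eqP/negP => /negP c0; apply: nx.
  exists (fun i => - (c (rshift d ord0))^-1 * c (lshift 1 i)).
  move/eqP: E; rewrite addrC addr_eq0 => /eqP E.
  rewrite -[LHS]scale1r -(mulVf c0) -scalerA E scalerN scaler_sumr -sumrN.
  by apply: eq_bigr => i _; rewrite scalerA mulNr scaleNr.
move: E; rewrite c0 scale0r addr0 => /ib ci i.
by case: (split_ordP i) => j ->; rewrite ?ord1 ?ci ?c0.
Qed.

Lemma indep_widen d e (b : 'I_d -> V) (le : (e <= d)%N) :
  indep b -> indep (fun i => b (widen_ord le i)).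
Proof.
move=> ib c E i; pose c' (j : 'I_d) : F := if insub (val j) is Some j' then c j' else 0.
have c'E (j : 'I_e) : c' (widen_ord le j) = c j by rewrite /c' /= valK.
rewrite -c'E; apply: ib; rewrite -[RHS]E.
under [RHS]eq_bigr => j _ do rewrite -c'E.
rewrite -(big_ord_narrow le (F := fun j => c' j *: b j)) [RHS]big_mkcond.
apply: eq_bigr => j _; case: ifP => // je.
by rewrite /c' insubF // scale0r.
Qed.

(** Independent families in [P] have at most [e] members, so adding missing vectors must stop; [k]
    bounds the number of extensions left. *)
Lemma hasdim_sub P Q e : (forall x, P x -> Q x) -> hasdim Q e ->
  exists d, hasdim P d.
Proof.
move=> PQ hQ.
suff main k d (b : 'I_d -> V) : (forall i, P (b i)) -> indep b -> (e - d < k)%N ->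
    exists d, hasdim P d.
  by apply: (main _ 0%N (fun _ => 0)); [case | move=> ? ? [] | exact: ltnSn].
elim: k d b => // k IH d b Pb ib lt_k.
have [gen|] := EM (forall x, P x -> exists c : 'I_d -> F, x = \sum_i c i *: b i).
  by exists d, b.
move=> /existsNP[x /not_implyP[Px nx]].
have ib' := indep_extend ib nx.
have Pb' (i : 'I_(d + 1)) : P (match split i with inl j => b j | inr _ => x end).
  by case: (split i).
apply: (IH _ _ Pb' ib').
have := indep_le hQ (fun i => PQ _ (Pb' i)) ib'.
lia.
Qed.

End One.

Section Map.
Variables (V W : lmodType F) (f : V -> W).
Hypothesis lf : linear f.

Let f0 : f 0 = 0.
Proof. by have := lf (-1) 0 0; rewrite scaler0 addr0 scaleN1r addNr. Qed.

Let fD x y : f (x + y) = f x + f y.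
Proof. by have := lf 1 x y; rewrite !scale1r. Qed.

Let fZ a x : f (a *: x) = a *: f x.
Proof. by have := lf a x 0; rewrite f0 !addr0. Qed.

Let fsum d (c : 'I_d -> F) (b : 'I_d -> V) :
  f (\sum_i c i *: b i) = \sum_i c i *: f (b i).
Proof.
rewrite (big_morph f fD f0); apply: eq_bigr => i _; exact: fZ.
Qed.

(** Rank-nullity read from kernel and image to the domain, so that finite dimension of the domain is
    a conclusion. *)
Lemma hasdim_ker_im P a b : subspace P -> hasdim (fun x => P x /\ f x = 0) a ->
  hasdim (fun y => exists2 x, P x & f x = y) b -> hasdim P (a + b).
Proof.
move=> sP [k [Pk ik gk]] [m [Pm im gm]].
have /choice[y yE] i : exists x, P x /\ f x = m i.
  by case: (Pm i) => x Px E; exists x.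
have El j : split (lshift b j) = inl j :> 'I_a + 'I_b by exact: (unsplitK (inl j)).
have Er j : split (rshift a j) = inr j :> 'I_a + 'I_b by exact: (unsplitK (inr j)).
exists (fun i => match split i with inl j => k j | inr j => y j end); split.
- by move=> i; case: (split i) => j; [case: (Pk j) | case: (yE j)].
- move=> c; rewrite big_split_ord /=.
  under eq_bigr => j _ do rewrite El.
  under [X in _ + X]eq_bigr => j _ do rewrite Er.
  move=> E.
  have cr : forall j, c (rshift a j) = 0.
    apply: im; have := congr1 f E; rewrite fD !fsum f0.
    rewrite big1 ?add0r => [E'|j _]; last by case: (Pk j) => _ ->; rewrite scaler0.
    by rewrite -[RHS]E'; apply: eq_bigr => j _; case: (yE j) => _ ->.
  have cl : forall j, c (lshift b j) = 0.
    apply: ik; move: E; rewrite [X in _ + X]big1 ?addr0 // => j _.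
    by rewrite cr scale0r.
  by move=> i; case: (split_ordP i) => j ->.
- move=> x Px; have [|d dE] := gm (f x); first by exists x.
  have [|c cE] := gk (x - \sum_i d i *: y i).
    split; first by apply: subspaceB => //; apply: subspace_comb => // i; case: (yE i).
    rewrite -scaleN1r fD fZ fsum dE scaleN1r -sumrB big1 // => i _.
    by case: (yE i) => _ ->; rewrite subrr.
  exists (fun i => match split i with inl j => c j | inr j => d j end).
  rewrite big_split_ord /=.
  under eq_bigr => j _ do rewrite El.
  under [X in _ + X]eq_bigr => j _ do rewrite Er.
  by rewrite -cE subrK.
Qed.

Lemma hasdim_rank_nullity P d b : subspace P -> hasdim P d ->
  hasdim (fun y => exists2 x, P x & f x = y) b ->
  exists2 a, hasdim (fun x => P x /\ f x = 0) a & d = (a + b)%N.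
Proof.
move=> sP hP hb.
have [a ha] := @hasdim_sub _ (fun x => P x /\ f x = 0) P d (fun x => @proj1 _ _) hP.
by exists a => //; apply: hasdim_uniq hP (hasdim_ker_im sP ha hb).
Qed.

Lemma hasdim_inj P d : (forall x, P x -> f x = 0 -> x = 0) -> subspace P -> hasdim P d ->
  hasdim (fun y => exists2 x, P x & f x = y) d.
Proof.
move=> inj sP [b [Pb ib gb]]; exists (f \o b); split.
- by move=> i; exists (b i).
- move=> c; rewrite -fsum => E; apply: ib; apply: inj => //.
  exact: subspace_comb.
- by move=> _ [x /gb[c ->] <-]; exists c; rewrite fsum.
Qed.

End Map.

Lemma hasdim_pair (V W : lmodType F) (P : V -> Prop) (Q : W -> Prop) a b :
  subspace P -> subspace Q -> hasdim P a -> hasdim Q b ->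
  hasdim (fun x : V * W => P x.1 /\ Q x.2) (b + a).
Proof.
move=> [P0 PL] [Q0 QL] hP hQ.
have l1 : linear (fun x : V * W => x.1) by [].
apply: (hasdim_ker_im l1); first by split=> // c x y [? ?] [? ?]; split; [apply: PL|apply: QL].
  have l2 : linear (fun y : W => (0, y) : V * W).
    by move=> c x y; congr (_, _); rewrite /= scaler0 addr0.
  apply: (@hasdim_eq _ (fun z => exists2 y, Q y & (0, y) = z)).
    move=> [x y] /=; split; first by case=> y' Qy [<- <-].
    by case=> -[_ Qy] ->; exists y.
  by apply: (hasdim_inj l2) => // x _ [].
apply: hasdim_eq hP => x; split; first by move=> Px; exists (x, 0).
by case=> -[y z] [Py _] <-.
Qed.

Lemma hasdim_poly k : hasdim (fun p : {poly F} => (size p <= k)%N) k.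
Proof.
exists (fun i : 'I_k => 'X^i); split.
- by move=> i; rewrite size_polyXn.
- move=> c E i; have := congr1 (fun p : {poly F} => p`_i) E; rewrite coef0 coef_sum.
  rewrite (bigD1 i) //= coefZ coefXn eqxx mulr1 big1 ?addr0 // => j ji.
  by rewrite coefZ coefXn eq_sym (inj_eq val_inj) (negbTE ji) mulr0.
- move=> p sp; exists (fun i => p`_i).
  rewrite -[LHS](@coefK _ p) poly_def (big_ord_widen k (fun i => p`_i *: 'X^i)) //.
  rewrite big_mkcond; apply: eq_bigr => i _; case: ltnP => // h.
  by rewrite nth_default // scale0r.
Qed.

Lemma subspace_homog n k : subspace (fun p : {mpoly F[n]} => p \is k.-homog).
Proof. by split=> [|a p q hp hq]; [exact: dhomog0 | rewrite rpredD ?rpredZ]. Qed.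

Lemma hasdim_homog n k :
  hasdim (fun p : {mpoly F[n.+1]} => p \is k.-homog) 'C(k + n, k).
Proof.
have dimE : \dim {:dhomog n.+1 F k} = 'C(k + n, k) by rewrite dimvf.
rewrite -dimE; pose b := vbasis {:dhomog n.+1 F k}.
exists (fun i => val b`_i); split.
- by move=> i; exact: valP.
- move=> c E; have /freeP := basis_free (vbasisP {:dhomog n.+1 F k}); apply.
  apply: val_inj => /=; rewrite -[RHS]E raddf_sum /=; apply: eq_bigr => i _.
  by [].
- move=> x hx; exists (fun i => coord b i (DHomog hx)).
  have := coord_vbasis (memvf (DHomog hx)).
  move/(congr1 val) => /= E; rewrite [LHS]E raddf_sum /=; apply: eq_bigr => i _.
  by [].
Qed.

End HasDim.

(** * Linear forms and coordinate frames *)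

(** In characteristic 0 the elements 0, 1, 2, ... are distinct and outnumber the roots. All generic
    choices below rest on this. *)
Lemma poly_nonroot (F : numFieldType) (p : {poly F}) : p != 0 -> exists c, p.[c] != 0.
Proof.
move=> p0; have [//|/forallNP h] := EM (exists c, p.[c] != 0).
have roots : all (root p) [seq i%:R | i <- iota 0 (size p)].
  by apply/allP => _ /mapP[i _ ->]; apply/rootP/eqP/negP => /negP; apply: h.
have := max_poly_roots p0 roots; rewrite size_map size_iota ltnn map_inj_uniq.
  by rewrite iota_uniq => /(_ isT).
by move=> i j /eqP; rewrite eqr_nat => /eqP.
Qed.

Section LinearForms.
Variable F : numFieldType.
Local Notation S := {mpoly F[3]}.
Implicit Types (a b P N Q : 'rV[F]_3) (p q : S).

Definition lin a : S := \sum_(k < 3) a 0 k *: 'X_k.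
Definition dot a P : F := \sum_(k < 3) a 0 k * P 0 k.

Lemma linD a b : lin (a + b) = lin a + lin b.
Proof. by rewrite -big_split; apply: eq_bigr => k _; rewrite mxE scalerDl. Qed.

Lemma linZ c a : lin (c *: a) = c *: lin a.
Proof. by rewrite scaler_sumr; apply: eq_bigr => k _; rewrite mxE scalerA. Qed.

Lemma dotDl a b P : dot (a + b) P = dot a P + dot b P.
Proof. by rewrite -big_split; apply: eq_bigr => k _; rewrite mxE mulrDl. Qed.

Lemma dotZl c a P : dot (c *: a) P = c * dot a P.
Proof. by rewrite mulr_sumr; apply: eq_bigr => k _; rewrite mxE mulrA. Qed.

Lemma dotDr a P Q : dot a (P + Q) = dot a P + dot a Q.
Proof. by rewrite -big_split; apply: eq_bigr => k _; rewrite mxE mulrDr. Qed.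

Lemma dotZr c a P : dot a (c *: P) = c * dot a P.
Proof. by rewrite mulr_sumr; apply: eq_bigr => k _; rewrite mxE mulrCA. Qed.

Lemma lin_homog a : lin a \is 1.-homog.
Proof. by rewrite rpred_sum // => k _; rewrite rpredZ // dhomogX /= mdeg1. Qed.

Lemma mcoeff_lin a k : (lin a)@_(U_(k)) = a 0 k.
Proof.
rewrite /lin raddf_sum (bigD1 k) //= mcoeffZ mcoeffX eqxx mulr1 big1 ?addr0 // => j jk.
rewrite mcoeffZ mcoeffX (_ : _ == _ = false) ?mulr0 //.
apply/negbTE; apply: contraNneq jk => E; apply/eqP.
by have := congr1 (fun m : 'X_{1..3} => m k) E; rewrite !mnm1E eqxx; case: eqP.
Qed.

Lemma lin_inj : injective lin.
Proof. by move=> a b E; apply/rowP => k; rewrite -!mcoeff_lin E. Qed.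

Lemma lin0 : lin 0 = 0.
Proof. by rewrite /lin big1 // => k _; rewrite mxE scale0r. Qed.

Lemma lin_eq0 a : (lin a == 0) = (a == 0).
Proof. by rewrite -lin0 (inj_eq lin_inj). Qed.

Lemma mmap_homog (R : comNzRingType) (f : {rmorphism F -> R}) (h : 'I_3 -> R) (s : R) k p :
  p \is k.-homog -> mmap f (fun i => s * h i) p = s ^+ k * mmap f h p.
Proof.
move=> /dhomogP hp; rewrite /mmap mulr_sumr big_seq [RHS]big_seq.
apply: eq_bigr => m /hp mk; rewrite mulrCA; congr (_ * _).
rewrite /mmap1; under eq_bigr => i _ do rewrite exprMn.
by rewrite big_split /= prodrXr -mdegE mk.
Qed.

Section Subst.
Variables (a Q : 'rV[F]_3).
Hypothesis aQ : dot a Q = 1.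

(** Pullback along the projection of space to the plane [ker a] in the direction [Q]: restriction to
    the plane without coordinates on it. *)
Definition proj_subst : S -> S := comp_mpoly [tuple 'X_i - Q 0 i *: lin a | i < 3].

Lemma proj_subst_lin : proj_subst (lin a) = 0.
Proof.
rewrite /proj_subst {2}/lin raddf_sum /=.
under eq_bigr => k _ do rewrite linearZ /= comp_mpolyXU -tnth_nth tnth_mktuple.
under eq_bigr => k _ do rewrite scalerBr scalerA.
by rewrite sumrB -scaler_suml -/(dot a Q) aQ scale1r subrr.
Qed.

Lemma divs_sub_subst p : divs (lin a) (p - proj_subst p).
Proof.
have prodP (p1 p2 : S) : divs (lin a) (p1 - proj_subst p1) ->
    divs (lin a) (p2 - proj_subst p2) -> divs (lin a) (p1 * p2 - proj_subst (p1 * p2)).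
  move=> h1 h2; rewrite /proj_subst rmorphM /= -/(proj_subst _) -/(proj_subst _).
  have -> : p1 * p2 - proj_subst p1 * proj_subst p2 =
    p1 * (p2 - proj_subst p2) + (p1 - proj_subst p1) * proj_subst p2 by ring.
  by apply: divsD; [apply: divsMl | apply: divsMr].
have one : divs (lin a) (1 - proj_subst 1) by rewrite /proj_subst rmorph1 subrr; apply: divs0.
have -> : p - proj_subst p = \sum_(m <- msupp p) (p@_m)%:MP * ('X_[m] - proj_subst 'X_[m]).
  rewrite {1 2}(mpolyE p) {1}/proj_subst [X in _ - X]linear_sum -sumrB.
  by apply: eq_bigr => m _; rewrite linearZ /= -scalerBr mul_mpolyC.
apply: divs_sum => m _; apply: divsMl; rewrite mpolyXE_id.
apply: (big_ind (fun p => divs (lin a) (p - proj_subst p))); [exact: one|exact: prodP|move=> i _].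
elim: (m i) => [|e IH]; first by rewrite expr0; exact: one.
rewrite exprS; apply: prodP; last exact: IH.
rewrite /proj_subst comp_mpolyXU -tnth_nth tnth_mktuple subKr -mul_mpolyC.
exact/divsMl/divs_refl.
Qed.

Lemma divs_linP p : divs (lin a) p <-> proj_subst p = 0.
Proof.
split=> [[q ->]|E]; first by rewrite /proj_subst rmorphM /= -/(proj_subst _) -/(proj_subst _)
  proj_subst_lin mulr0.
by rewrite -[p]subr0 -E; apply: divs_sub_subst.
Qed.

End Subst.

Lemma exists_dual a : a != 0 -> exists Q, dot a Q = 1.
Proof.
case/rV0Pn => k ak; exists ((a 0 k)^-1 *: delta_mx 0 k).
rewrite dotZr /dot (bigD1 k) //= mxE !eqxx mulr1 big1 ?addr0 ?mulVf // => j jk.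
by rewrite mxE (negbTE jk) mulr0.
Qed.

(** The endomorphism [proj_subst] has the multiples of [lin a] as kernel and takes values in a
    domain. *)
Lemma prime_lin a : a != 0 -> prime_elt (lin a).
Proof.
move=> a0; have [Q aQ] := exists_dual a0; split.
- by rewrite lin_eq0.
- apply/negP => /unitrP[b [_ E]].
  have := congr1 (meval (fun _ => 0)) E.
  rewrite rmorphM rmorph1 /= [X in X * _]raddf_sum /= big1 ?mul0r => [/eqP|k _].
    by rewrite eq_sym oner_eq0.
  by rewrite mevalZ mevalXU mulr0.
- move=> p q /(divs_linP aQ); rewrite /proj_subst rmorphM => /eqP.
  by rewrite mulf_eq0 => /orP[]/eqP E; [left|right]; apply/(divs_linP aQ).
Qed.

Lemma divs_lin_lin a b : a != 0 -> divs (lin a) (lin b) -> exists c, b = c *: a.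
Proof.
move=> a0 [q E]; have [b0|bn0] := eqVneq b 0; first by exists 0; rewrite scale0r.
have q0 : q != 0 by apply: contraNneq bn0 => q0; rewrite -lin_eq0 E q0 mul0r.
have sl x : x != 0 -> msize (lin x) = 2.
  move=> x0; have l0 : lin x != 0 by rewrite lin_eq0.
  have := dhomog_uniq l0 (lin_homog x) (dhomog_msize (lin_homog x)).
  by rewrite (mpolySpred _ l0) /= => <-.
have sq : msize q = 1%N.
  have := congr1 (fun p => msize p) E; rewrite msizeM ?lin_eq0 // !sl //.
  by rewrite addnS /= addn1 => -[<-].
have qE : q = (q@_0%MM)%:MP by apply: msize1_polyC; rewrite sq.
by exists q@_0%MM; apply: lin_inj; rewrite linZ E {1}qE mul_mpolyC.
Qed.

End LinearForms.

(** * Coordinates on a plane and restriction of forms to it *)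

Section Frames.
Variable F : numFieldType.
Local Notation S := {mpoly F[3]}.
Implicit Types (a b : 'rV[F]_3) (p q : S).

(* [fP], [fN] span the plane [a = 0], and ([fs], [ft], [a]) is the basis dual to
   ([fP], [fN], [fR]). *)
Record frame a := Frame {
  fP : 'rV[F]_3; fN : 'rV[F]_3; fR : 'rV[F]_3; fs : 'rV[F]_3; ft : 'rV[F]_3;
  fsP : dot fs fP = 1; fsN : dot fs fN = 0;
  ftP : dot ft fP = 0; ftN : dot ft fN = 1;
  faP : dot a fP = 0; faN : dot a fN = 0; faR : dot a fR = 1;
  fres : forall i j, fP 0 i * fs 0 j + fN 0 i * ft 0 j + fR 0 i * a 0 j = (i == j)%:R }.

Lemma sum3_delta (G : 'I_3 -> F) i : \sum_j G j * (i == j)%:R = G i.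
Proof.
rewrite (bigD1 i) //= eqxx mulr1 big1 ?addr0 // => j ji.
by rewrite eq_sym (negbTE ji) mulr0.
Qed.

Lemma frame_covec a (f : frame a) b :
  b = dot b (fP f) *: fs f + dot b (fN f) *: ft f + dot b (fR f) *: a.
Proof.
apply/rowP => j; rewrite !mxE /dot !mulr_suml -!big_split /=.
rewrite -[LHS](sum3_delta (fun i => b 0 i)); apply: eq_bigr => i _.
by rewrite eq_sym -(fres f); ring.
Qed.

Lemma frame_span a (f : frame a) b : dot b (fP f) = 0 -> dot b (fN f) = 0 ->
  b = dot b (fR f) *: a.
Proof. by move=> h1 h2; rewrite {1}(frame_covec f b) h1 h2 !scale0r !add0r. Qed.

Lemma frame_exists a : a != 0 -> exists f : frame a, True.
Proof.
move=> a0.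
(* The first row of this invertible matrix spans the line of [a]. Its rows and the columns of its
   inverse are dual bases, up to the scalar [c]. *)
pose G0 := row_ebase a; have uG0 : G0 \in unitmx := row_ebase_unit a.
have [c [c0 aE]] : exists c, c != 0 /\ a = c *: row 0 G0.
  have rk : \rank a = 1%N by rewrite rank_rV a0.
  have aE : a = col_ebase a 0 0 *: row 0 G0.
    rewrite -{1}(mulmx_ebase a) rk -mulmxA [X in X *m _]mx11_scalar mul_scalar_mx.
    congr (_ *: _).
    by apply/rowP => j; rewrite !mxE (bigD1 ord0) //= big1 ?addr0 => [|[[|i] ?] // _];
       rewrite !mxE /= ?mul1r ?mul0r.
  exists (col_ebase a 0 0); split => //.
  by apply: contraNneq a0 => c0; rewrite aE c0 scale0r.
have col_dot i j : dot (row i G0) (row j (invmx G0)^T) = (i == j)%:R.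
  rewrite /dot; have := congr1 (fun M : 'M_3 => M i j) (mulmxV uG0).
  rewrite !mxE => <-; apply: eq_bigr => k _; rewrite !mxE //.
have res i j : \sum_k invmx G0 i k * G0 k j = (i == j)%:R.
  by have := congr1 (fun M : 'M_3 => M i j) (mulVmx uG0); rewrite !mxE.
pose o1 : 'I_3 := lift ord0 ord0; pose o2 : 'I_3 := lift ord0 (lift ord0 ord0).
unshelve eexists; last by [].
apply: (@Frame a (row o1 (invmx G0)^T) (row o2 (invmx G0)^T) (c^-1 *: row 0 (invmx G0)^T)
  (row o1 G0) (row o2 G0)); rewrite ?col_dot ?aE ?dotZl ?dotZr ?col_dot ?mulr0 //.
  by rewrite mulr1 mulfV.
move=> i j; rewrite -res !big_ord_recl big_ord0 !mxE addr0.
by rewrite mulrACA mulVf // mul1r addrC.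
Qed.

(** Moving [fN] to [fN + tau *: fP] is compensated by [fs - tau *: ft]. A form not proportional to
    [a] is nonzero on the plane, so finitely many [tau] are bad. Afterwards each form of [bs] has
    exactly one root on the affine line [fP + y * fN]. *)
Lemma frame_generic a (bs : seq 'rV[F]_3) : a != 0 ->
  (forall b, b \in bs -> ~ exists c, b = c *: a) ->
  exists f : frame a, forall b, b \in bs -> dot b (fN f) != 0.
Proof.
move=> a0 nb; have [f _] := frame_exists a0.
pose g : {poly F} := \prod_(b <- bs) ((dot b (fN f))%:P + dot b (fP f) *: 'X).
have lin0 (x y : F) : (x%:P + y *: 'X == 0) -> x = 0 /\ y = 0.
  move=> /eqP E; split.
    by have := congr1 (fun p : {poly F} => p`_0) E; rewrite coefD coefC coefZ coefX mulr0 addr0 coef0.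
  by have := congr1 (fun p : {poly F} => p`_1) E; rewrite coefD coefC coefZ coefX mulr1 add0r coef0.
have g0 : g != 0.
  rewrite prodf_seq_neq0; apply/allP => b /nb nba; apply/implyP => _.
  apply/negP => /lin0[h1 h2]; apply: nba.
  by exists (dot b (fR f)); apply: frame_span.
have [tau gt] := poly_nonroot g0.
unshelve eexists.
  apply: (@Frame a (fP f) (fN f + tau *: fP f) (fR f) (fs f - tau *: ft f) (ft f)).
  - by rewrite dotDl -scaleNr dotZl fsP ftP mulr0 addr0.
  - by rewrite dotDl -scaleNr dotZl !dotDr !dotZr fsP fsN ftP ftN; ring.
  - by rewrite ftP.
  - by rewrite dotDr dotZr ftP ftN mulr0 addr0.
  - by rewrite faP.
  - by rewrite dotDr dotZr faP faN mulr0 addr0.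
  - by rewrite faR.
  - by move=> i j; rewrite -(fres f) !mxE; ring.
move=> b bb /=; rewrite dotDr dotZr.
move: gt; rewrite /g horner_prod prodf_seq_neq0 => /allP/(_ _ bb) /=.
by rewrite hornerD hornerC hornerZ hornerX mulrC.
Qed.

(** Restriction to the line [P + y * N]. For a frame this is dehomogenized restriction to the plane,
    which loses no information on forms of a fixed degree. *)
Definition along (P N : 'rV[F]_3) : {rmorphism S -> {poly F}} :=
  mmap polyC (fun i => (P 0 i)%:P + N 0 i *: 'X).

Lemma alongC P N c : along P N c%:MP = c%:P.
Proof. by rewrite /along /= mmapC. Qed.

Lemma alongZ P N c p : along P N (c *: p) = c *: along P N p.
Proof. by rewrite -mul_mpolyC rmorphM alongC mul_polyC. Qed.

Lemma along_lin P N b : along P N (lin b) = (dot b P)%:P + dot b N *: 'X.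
Proof.
rewrite [LHS]raddf_sum /dot rmorph_sum scaler_suml -big_split /=.
apply: eq_bigr => k _; rewrite alongZ /along /= mmapX mmap1U.
by rewrite scalerDr -mul_polyC -polyCM scalerA.
Qed.

Lemma size_along P N k p : p \is k.-homog -> (size (along P N p) <= k.+1)%N.
Proof.
move=> /dhomogP hp; rewrite /along /= /mmap big_seq.
apply: (leq_trans (size_sum _ _ _)); apply/bigmax_leqP_seq => m mp _.
rewrite mul_polyC; apply: leq_trans (size_scale_leq _ _) _.
rewrite -(hp _ mp) /= mdegE /mmap1.
have main (r : seq 'I_3) : (size (\prod_(i <- r) ((P 0 i)%:P + N 0 i *: 'X) ^+ m i)%R
    <= (\sum_(i <- r) m i).+1)%N.
  elim: r => [|i r IH]; first by rewrite !big_nil size_poly1.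
  rewrite !big_cons; apply: leq_trans (size_polyMleq _ _) _.
  suff : (size (((P 0 i)%:P + N 0 i *: 'X) ^+ m i)%R <= (m i).+1)%N.
    by move: IH; move: (size _) (size _) (\sum_(j <- r) m j)%N => *; lia.
  elim: (m i) => [|e IHe]; first by rewrite expr0 size_poly1.
  rewrite exprS; apply: leq_trans (size_polyMleq _ _) _.
  have : (size ((P 0 i)%:P + N 0 i *: 'X)%R <= 2)%N.
    apply: leq_trans (size_polyD _ _) _; rewrite geq_max size_polyC.
    rewrite (leq_trans (size_scale_leq _ _)) ?size_polyX // andbT.
    by case: (_ != 0).
  by move: IHe; move: (size _) (size _) => *; lia.
exact: main.
Qed.

(** Homogenization: [fs] restricts to 1 and [ft] to the variable. *)
Lemma along_lift a (f : frame a) m (g : {poly F}) : (size g <= m.+1)%N ->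
  exists2 q : S, q \is m.-homog & along (fP f) (fN f) q = g.
Proof.
move=> sg; exists (\sum_(i < m.+1) g`_i *: (lin (fs f) ^+ (m - i) * lin (ft f) ^+ i)).
  apply: rpred_sum => i _; apply: rpredZ.
  have := dhomogM (dhomogMn (m - i) (lin_homog (fs f))) (dhomogMn i (lin_homog (ft f))).
  by rewrite !mul1n subnK // -ltnS.
rewrite rmorph_sum /= -[RHS]coefK poly_def (big_ord_widen m.+1 (fun i => g`_i *: 'X^i)) //.
rewrite [RHS]big_mkcond; apply: eq_bigr => i _.
rewrite -/(along _ _ _) alongZ rmorphM !rmorphXn !along_lin fsP fsN ftP ftN.
rewrite scale0r addr0 scale1r polyC0 add0r expr1n mul1r.
by case: ltnP => // h; rewrite nth_default // scale0r.
Qed.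

(** By [fres], projection along [fR] sends the [i]-th variable to [fP 0 i *: s + fN 0 i *: t]. Over
    the fraction field homogeneity extracts [s ^+ k], and what remains is the restriction of [p]
    evaluated at [t / s]. *)
Lemma along_eq0 a (f : frame a) k p : p \is k.-homog -> along (fP f) (fN f) p = 0 ->
  divs (lin a) p.
Proof.
move=> hp E; apply/(divs_linP (faR f)).
pose s := tofrac (lin (fs f)); pose t := tofrac (lin (ft f)).
have s0 : s != 0.
  rewrite tofrac_eq0 lin_eq0; apply/eqP => s0; have := fsP f.
  by rewrite s0 -(scale0r (fs f)) dotZl mul0r => /eqP; rewrite eq_sym oner_eq0.
pose c : {rmorphism F -> {fraction S}} := (@tofrac S) \o (@mpolyC 3 F).
pose psi : {rmorphism {poly F} -> {fraction S}} :=
  horner_morph (fun x : F => mulrC (t / s) (c x)).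
apply/eqP; rewrite -tofrac_eq0; apply/eqP.
pose h i := c (fP f 0 i) + c (fN f 0 i) * (t / s).
transitivity (mmap c (fun i => s * h i) p).
  apply: (@mpoly_rmorph_ext _ _ _ (@tofrac S \o comp_mpoly [tuple 'X_i - fR f 0 i *: lin a | i < 3])
    (mmap c (fun i => s * h i))).
    by move=> d /=; rewrite comp_mpolyC mmapC.
  move=> i /=; rewrite comp_mpolyXU -tnth_nth tnth_mktuple mmapX mmap1U.
  have -> : 'X_i - fR f 0 i *: lin a =
     fP f 0 i *: lin (fs f) + fN f 0 i *: lin (ft f).
    apply/eqP; rewrite subr_eq; apply/eqP; rewrite /lin !scaler_sumr -!big_split /=.
    rewrite (bigD1 i) //= big1 ?addr0 => [|j ji]; rewrite !scalerA -!scalerDl fres.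
      by rewrite eqxx scale1r.
    by rewrite eq_sym (negbTE ji) scale0r.
  rewrite -!mul_mpolyC rmorphD !rmorphM /= /h mulrDr /c /=.
  by rewrite mulrC; congr (_ + _); rewrite mulrCA [s * _]mulrCA mulfV // mulr1.
rewrite (mmap_homog _ _ _ hp).
have -> : mmap c h p = psi (along (fP f) (fN f) p).
  apply: (@mpoly_rmorph_ext _ _ _ (mmap c h) (psi \o along (fP f) (fN f))).
    by move=> d /=; rewrite !mmapC /psi /= horner_morphC.
  move=> i /=; rewrite !mmapX !mmap1U /h rmorphD -mul_polyC rmorphM.
  by rewrite /psi /= !horner_morphC horner_morphX.
by rewrite E rmorph0 mulr0.
Qed.

End Frames.

(** A root that occurs [c] times is to receive exponent [c - 1], so one copy of each value is taken
    away. *)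
Fixpoint dups (T : eqType) (s : seq T) : seq T :=
  if s is x :: s' then (if x \in s' then x :: dups s' else dups s') else [::].

Lemma perm_dups (T : eqType) (s : seq T) : perm_eq s (dups s ++ undup s).
Proof.
elim: s => //= x s IH; case: ifP => xs; first by rewrite perm_cons.
by rewrite -[x :: s]cat1s perm_sym -[x :: undup s]cat1s perm_catCA perm_cat2l perm_sym.
Qed.

Lemma count_dups (T : eqType) (s : seq T) x : count_mem x (dups s) = (count_mem x s).-1.
Proof.
have /permP/(_ (pred1 x)) -> := perm_dups s.
rewrite count_cat (count_uniq_mem _ (undup_uniq s)) mem_undup.
case: (boolP (x \in s)) => [_|xs]; first by rewrite addn1.
rewrite addn0; have sub : {subset dups s <= s}.
  by move=> y; rewrite (perm_mem (perm_dups s)) mem_cat => ->.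
by rewrite (count_memPn _) //; apply: contra xs => /sub.
Qed.

Lemma size_dups (T : eqType) (s : seq T) : (size (dups s) + size (undup s) = size s)%N.
Proof. by rewrite -size_cat -(perm_size (perm_dups s)). Qed.

(** * Products of linear factors and Lagrange interpolation *)

Section PolyRoots.
Variable F : fieldType.
Implicit Types (s : seq F) (w g : {poly F}).

Lemma prod_XsubC_dvdp s w : (forall x, x \in s -> ('X - x%:P) ^+ count_mem x s %| w) ->
  \prod_(x <- s) ('X - x%:P) %| w.
Proof.
move=> h; have -> : \prod_(x <- s) ('X - x%:P) =
    \prod_(x <- undup s) ('X - x%:P) ^+ count_mem x s.
  by rewrite prodr_undup_exp_count.
have {h} : {in undup s, forall x, ('X - x%:P) ^+ count_mem x s %| w}.
  by move=> x; rewrite mem_undup => /h.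
elim: (undup s) (undup_uniq s) => [|x r IH] /=; first by rewrite big_nil dvd1p.
case/andP=> xr ur h; rewrite big_cons Gauss_dvdp.
  by rewrite h ?mem_head //= IH // => y yr; apply: h; rewrite inE yr orbT.
apply: coprimep_expl; rewrite coprimep_sym big_seq.
apply: (big_ind (fun p => coprimep p ('X - x%:P))); first by rewrite coprime1p.
  by move=> p q hp hq; rewrite coprimepMl hp hq.
move=> y yr; apply: coprimep_expl; rewrite coprimep_XsubC root_XsubC.
by apply: contraNneq xr => ->.
Qed.

(** The value of [g] at a node fixes a constant multiple of the product over the other nodes; the
    difference is divisible by the factor of that node and is expanded over the rest. The excess
    degree [e] ends up at the last node. *)
Lemma lagrange_span (ts : seq F) e g : uniq ts -> ts != [::] -> (size g <= size ts + e)%N ->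
  exists c : F -> {poly F}, (forall x, (size (c x) <= e.+1)%N) /\
    g = \sum_(x <- ts) c x * \prod_(y <- ts | y != x) ('X - y%:P).
Proof.
elim: ts g => // x ts IH g /= /andP[xts uts] _ sg.
have [ts0|tsn0] := eqVneq ts [::].
  exists (fun _ => g); rewrite ts0 in sg *; split=> //.
  by rewrite big_seq1 big_cons eqxx /= big_nil mulr1.
pose w : {poly F} := \prod_(y <- ts) ('X - y%:P); pose d := g.[x] / w.[x].
have wx : w.[x] != 0.
  rewrite /w horner_prod prodf_seq_neq0; apply/allP => y yts; rewrite hornerXsubC /= subr_eq0.
  by apply: contraNneq xts => ->.
have : ('X - x%:P) %| (g - d *: w).
  by rewrite dvdp_XsubCl; apply/rootP; rewrite hornerD hornerN hornerZ /d divfK // subrr.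
case/dvdpP => g1 g1E.
have sw : size w = (size ts).+1 by rewrite /w size_prod_XsubC.
have sg1 : (size g1 <= size ts + e)%N.
  have : (size (g - d *: w)%R <= (size ts + e).+1)%N.
    apply: leq_trans (size_polyD _ _) _; rewrite geq_max size_polyN.
    rewrite -addSn sg (leq_trans (size_scale_leq _ _)) // sw.
    exact: leq_addr.
  have [->|g10] := eqVneq g1 0; first by rewrite size_poly0.
  by rewrite g1E size_Mmonic ?monicXsubC // size_XsubC addn2.
have [c [sc gE]] := IH g1 uts tsn0 sg1.
exists (fun y => if y == x then d%:P else c y); split.
  by move=> y; case: ifP => // _; rewrite size_polyC; case: (d != 0).
rewrite big_cons eqxx -[LHS](subrK (d *: w)) addrC; congr (_ + _).
  rewrite big_cons eqxx /= mul_polyC; congr (_ *: _).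
  rewrite /w big_seq [RHS]big_seq_cond; apply: eq_bigl => y.
  by case: (boolP (y \in ts)) => //= yts; apply/esym; apply: contraNneq xts => <-.
rewrite g1E gE mulr_suml !big_seq; apply: eq_bigr => y yts.
have yx : y != x by apply: contraNneq xts => <-.
by rewrite (negbTE yx) big_cons eq_sym yx -mulrA; congr (_ * _); rewrite mulrC.
Qed.

End PolyRoots.

Lemma prime_prod_divs (R : idomainType) (I : eqType) (s : seq I) (G : I -> R) w : uniq s ->
  (forall i, i \in s -> prime_elt (G i)) ->
  (forall i j, i \in s -> j \in s -> i != j -> ~ divs (G i) (G j)) ->
  (forall i, i \in s -> divs (G i) w) -> divs (\prod_(i <- s) G i) w.
Proof.
elim: s w => [|i s IH] w; first by move=> *; rewrite big_nil; exists w; rewrite mulr1.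
case/andP=> is_ us pG nd dw.
have sub j : j \in s -> j \in i :: s by rewrite inE => ->; rewrite orbT.
have [|||q wE] := IH w us; [by move=> j /sub/pG|by move=> j k /sub js /sub; apply: nd
  |by move=> j /sub/dw|].
have [_ _ pi] := pG i (mem_head _ _).
have := dw i (mem_head _ _); rewrite wE => /pi[[q' ->]|].
  by exists q'; rewrite big_cons mulrA.
move=> dp; exfalso.
have : exists2 j, j \in s & divs (G i) (G j).
  by move: dp; rewrite big_seq => /(prime_divs_prod (pG i (mem_head _ _))).
case=> j js; apply: nd; rewrite ?mem_head ?sub //.
by apply: contraNneq is_ => ->.
Qed.

(** * Restriction of derivations to a plane *)

Lemma dotBZ (F : numFieldType) (a b P : 'rV[F]_3) c :
  dot (a - c *: b) P = dot a P - c * dot b P.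
Proof. by rewrite -scaleNr dotDl dotZl mulNr. Qed.

Section PairModule.
Variable F : numFieldType.
Local Notation S := {mpoly F[3]}.
Variables (m : nat) (A : 'M[F]_(m.+1, 3)).
Local Notation al j := (row j A).
Hypothesis nz : forall i, al i != 0.
Hypothesis dist : forall i j, i != j -> ~ exists c, al i = c *: al j.
Variable f0 : frame (al ord0).

Definition uA j : F := dot (al j) (fP f0).
Definition vA j : F := dot (al j) (fN f0).
(** The value of a derivation on the [j]-th defining form: [uA j] and [vA j] are the derivatives of
    this form in the directions [fP] and [fN]. *)
Definition form j (x : S * S) : S := uA j *: x.1 + vA j *: x.2.

(* The pair [x] stands for the derivation [x.1 * d_P + x.2 * d_N], which kills the
   first form. *)
Definition DD (h : nat) (x : S * S) : Prop :=
  forall j : 'I_m.+1, (0 < j < h)%N -> divs (lin (al j)) (form j x).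

Definition homog2 k (x : S * S) : Prop := x.1 \is k.-homog /\ x.2 \is k.-homog.

Lemma form_linear j : linear (form j).
Proof. by move=> a x y; rewrite /form /= !scalerDr !scalerA (mulrC _ a) (mulrC _ a) addrACA. Qed.

Lemma formM j (p : S) x : form j (p * x.1, p * x.2) = p * form j x.
Proof. by rewrite /form /= mulrDr !scalerAr. Qed.

Lemma form_homog j k x : homog2 k x -> form j x \is k.-homog.
Proof. by move=> [h1 h2]; rewrite rpredD ?rpredZ. Qed.

Lemma homog2_subspace k : subspace (homog2 k).
Proof.
split; first by split; apply: dhomog0.
by move=> a x y [? ?] [? ?]; split; rewrite rpredD ?rpredZ.
Qed.

Lemma DD_subspace h : subspace (DD h).
Proof.
split=> [j _|a x y hx hy j jh]; first by rewrite /form !scaler0 addr0; apply: divs0.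
rewrite form_linear -mul_mpolyC; apply: divsD; last exact: hy.
by apply: divsMl; apply: hx.
Qed.

Lemma DDM h p x : DD h x -> DD h (p * x.1, p * x.2).
Proof. by move=> hx j jh; rewrite formM; apply/divsMl/hx. Qed.

Definition DDh h k x := DD h x /\ homog2 k x.

Lemma DDh_subspace h k : subspace (DDh h k).
Proof.
have [d0 dL] := DD_subspace h; have [h0 hL] := homog2_subspace k.
by split=> // a x y [? ?] [? ?]; split; [apply: dL|apply: hL].
Qed.

Lemma uv_neq0 j : j != ord0 -> uA j != 0 \/ vA j != 0.
Proof.
move=> j0; have [u0|] := eqVneq (uA j) 0; last by left.
have [v0|] := eqVneq (vA j) 0; last by right.
by case: (dist j0); exists (dot (al j) (fR f0)); apply: frame_span.
Qed.

Lemma divsZ (a p : S) c : c != 0 -> divs a (c *: p) -> divs a p.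
Proof.
move=> c0 /(divsMl (c^-1)%:MP); rewrite mul_mpolyC scalerA mulVf // scale1r; exact.
Qed.

(** * Adding one plane: restriction to the plane of index [h] *)

Section Step.
Variables (h : 'I_m.+1) (f : frame (al h)).
Hypothesis h0 : (0 < h)%N.
Hypothesis generic : forall j, j != h -> dot (al j) (fN f) != 0.
Local Notation rho := (along (fP f) (fN f)).

(** The parameter, on the line [fP + y * fN], of the point where plane [j] meets plane [h]. *)
Definition rt j : F := - dot (al j) (fP f) / dot (al j) (fN f).

Lemma along_al j : j != h -> rho (lin (al j)) = dot (al j) (fN f) *: ('X - (rt j)%:P).
Proof.
move=> /generic n0; rewrite along_lin scalerBr addrC; congr (_ + _).
by rewrite -mul_polyC -polyCM -polyCN; congr _%:P; rewrite /rt; field.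
Qed.

Lemma rt_eq i j : i != h -> j != h -> rt i = rt j ->
  exists l c, al j = l *: al i + c *: al h.
Proof.
move=> ih jh E; have ni := generic ih; have nj := generic jh.
pose l := dot (al j) (fN f) / dot (al i) (fN f).
have bE : al j - l *: al i = dot (al j - l *: al i) (fR f) *: al h.
  apply: frame_span; rewrite dotBZ; last by rewrite /l divfK // subrr.
  apply/eqP; rewrite subr_eq0; apply/eqP.
  have : dot (al i) (fP f) / dot (al i) (fN f) = dot (al j) (fP f) / dot (al j) (fN f).
    by apply: oppr_inj; rewrite -!mulNr.
  by rewrite /l mulrAC => E2; rewrite -mulrA E2 mulrC divfK.
by exists l, (dot (al j - l *: al i) (fR f)); rewrite -bE addrC subrK.
Qed.

(** If the determinant vanished, some [al i - c *: al h] would vanish on the plane of [al ord0], so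
    [i] and [ord0] would meet plane [h] in the same point. *)
Lemma rt_inj_uv i : i != h -> i != ord0 -> rt i != rt ord0 ->
  uA i * vA h - vA i * uA h != 0.
Proof.
move=> ih i0 nr; apply: contraNneq nr => E.
have h0' : h != ord0 by rewrite -val_eqE /= -lt0n.
have [c [cu cv]] : exists c, uA i = c * uA h /\ vA i = c * vA h.
  move/eqP: E; rewrite subr_eq0 => /eqP E.
  case: (uv_neq0 h0') => n.
    by exists (uA i / uA h); rewrite divfK //; split=> //; rewrite mulrAC E mulfK.
  by exists (vA i / vA h); rewrite divfK //; split=> //; rewrite mulrAC -E mulfK.
have alE : al i - c *: al h = dot (al i - c *: al h) (fR f0) *: al ord0.
  by apply: frame_span; rewrite dotBZ -/(uA _) -/(uA _) -/(vA _) -/(vA _) ?cu ?cv subrr.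
move: alE; set d := dot _ _ => alE.
have iE : al i = d *: al ord0 + c *: al h by rewrite -alE subrK.
have d0 : d != 0.
  by apply/eqP => d0; apply: (dist ih); exists c; rewrite iE d0 scale0r add0r.
apply/eqP; rewrite /rt iE !dotDl !dotZl faP faN !mulr0 !addr0.
have n0 : dot (al ord0) (fN f) != 0 by apply: generic; rewrite eq_sym.
by field; rewrite d0 n0.
Qed.

Definition earlier : seq 'I_m.+1 := [seq j : 'I_m.+1 <- enum 'I_m.+1 | (0 < j < h)%N].

Lemma mem_earlier j : (j \in earlier) = (0 < j < h)%N.
Proof. by rewrite mem_filter mem_enum andbT. Qed.

Lemma uniq_earlier : uniq earlier. Proof. exact/filter_uniq/enum_uniq. Qed.

Lemma earlier_neq j : j \in earlier -> j != h /\ j != ord0.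
Proof. by rewrite mem_earlier -!val_eqE /= => /andP[j0 jh]; rewrite ltn_eqF // -lt0n. Qed.

Lemma size_earlier : size earlier = h.-1.
Proof.
rewrite -(size_map val) /earlier -(filter_map val (fun j => 0 < j < h)%N) val_enum_ord.
have iotaE (H M : nat) : (0 < H <= M)%N ->
    iota 0 M = 0%N :: iota 1 H.-1 ++ iota H (M - H).
  case: H => // H /= leHM; have {1}-> : M = (1 + (H + (M - H.+1)))%N by lia.
  by rewrite !iotaD.
rewrite (iotaE h) ?h0 1?ltnW //.
rewrite /= filter_cat size_cat.
have -> : [seq j <- iota 1 h.-1 | (0 < j < h)%N] = iota 1 h.-1.
  by apply/all_filterP/allP => j; rewrite mem_iota; lia.
have -> : [seq j <- iota h (m.+1 - h) | (0 < j < h)%N] = [::].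
  by rewrite -(filter_pred0 (iota h (m.+1 - h))); apply: eq_in_filter => j; rewrite mem_iota /=; lia.
by rewrite size_iota addn0.
Qed.

(** The point on plane [ord0] is treated apart because that plane is not among [earlier]. With
    [dups] applied only to the other points, every point gets as exponent the number of planes
    before [h] through it, [ord0] included, minus 1. This is the restriction to plane [h] of Terao's
    polynomial of degree $|A'| - |A''|$. *)
Definition roots1 := [seq rt j | j <- earlier & rt j != rt ord0].
Definition roots0 := [seq rt j | j <- earlier & rt j == rt ord0].
(* Degree by degree, [x => rho (form h x)] maps [DD h] onto the multiples of this
   polynomial with kernel [DD h.+1]. *)
Definition restr_divisor : {poly F} := \prod_(y <- dups roots1 ++ roots0) ('X - y%:P).
Definition new_roots := size (undup roots1).

Lemma size_s01 : (size roots1 + size roots0 = h.-1)%N.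
Proof. by rewrite !size_map !size_filter addnC count_predC size_earlier. Qed.

Lemma size_restr_divisor : (size restr_divisor + new_roots = h)%N.
Proof.
rewrite size_prod_XsubC size_cat addSn addnAC size_dups size_s01; lia.
Qed.

Lemma rho_prod_dvdp (R : seq 'I_m.+1) y w : uniq R ->
  (forall j, j \in R -> [/\ j != h, rt j = y & divs (lin (al j)) w]) ->
  ('X - y%:P) ^+ size R %| rho w.
Proof.
move=> uR hR.
have [q ->] : divs (\prod_(j <- R) lin (al j)) w.
  apply: prime_prod_divs => // [i _|i j iR jR ij|i /hR[]//]; first exact/prime_lin/nz.
  by move/(divs_lin_lin (nz i)); apply: dist; rewrite eq_sym.
rewrite rmorphM; apply: dvdp_mull; rewrite rmorph_prod /=.
have {}hR j : j \in R -> j != h /\ rt j = y by case/hR.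
elim: R uR hR => [|j R IH] /=; first by rewrite dvd1p.
case/andP=> _ uR hR; rewrite big_cons exprS.
have [jh jy] := hR j (mem_head _ _).
apply: dvdp_mul; last by apply: IH => // i iR; apply: hR; rewrite inE iR orbT.
by rewrite -/(along _ _ _) along_al // jy dvdpZr // generic.
Qed.

(** At the point of plane [ord0], a relation [al j = l *: al ord0 + c *: al h] gives
    [form j x = c *: form h x], since [al ord0] is killed. At any other point one plane [i] serves
    as reference: [form h x - g * lin (al h)] has the same restriction and is divisible by the
    remaining forms through that point. *)
Lemma restr_divisor_dvdp x : DD h x -> restr_divisor %| rho (form h x).
Proof.
move=> hx; apply: prod_XsubC_dvdp => y _; rewrite count_cat count_dups.
have cnt (P : pred 'I_m.+1) z : count_mem z [seq rt j | j <- earlier & P j] =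
    size [seq j <- earlier | (rt j == z) && P j].
  by rewrite count_map -size_filter -filter_predI.
rewrite !cnt.
have [->|yn] := eqVneq y (rt ord0).
  rewrite (_ : [seq j <- earlier | _ & rt j != _] = [::]) ?add0n; last first.
    by rewrite -(filter_pred0 earlier); apply: eq_filter => j /=; case: eqP.
  apply: rho_prod_dvdp; first exact/filter_uniq/uniq_earlier.
  move=> j; rewrite mem_filter => /andP[/andP[/eqP rj _] jT].
  have [jh j0] := earlier_neq jT; split=> //.
  have h0' : ord0 != h by rewrite -val_eqE /= eq_sym -lt0n.
  have [l [c E]] := rt_eq h0' jh (esym rj).
  have c0 : c != 0.
    by apply/eqP => c0; apply: (dist j0); exists l; rewrite E c0 scale0r addr0.
  have uE : uA j = c * uA h by rewrite /uA E dotDl !dotZl faP mulr0 add0r.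
  have vE : vA j = c * vA h by rewrite /vA E dotDl !dotZl faN mulr0 add0r.
  apply: (@divsZ _ _ c) => //.
  have -> : c *: form h x = form j x by rewrite /form uE vE scalerDr !scalerA.
  by apply: hx; rewrite -mem_earlier.
rewrite (_ : [seq j <- earlier | _ & rt j == _] = [::]) ?addn0; last first.
  rewrite -(filter_pred0 earlier); apply: eq_filter => j /=.
  by apply/negbTE/negP => /andP[/eqP-> /eqP E]; case/eqP: yn.
set R := filter _ _.
have hR j : j \in R -> j \in earlier /\ rt j = y.
  by rewrite mem_filter => /andP[/andP[/eqP rj _] jT].
have : uniq R by exact/filter_uniq/uniq_earlier.
case: R hR => [|i R] hR; first by rewrite dvd1p.
case/andP => iR uR /=.
have [iT ri] := hR i (mem_head _ _); have [ih _] := earlier_neq iT.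
have [g gE] : divs (lin (al i)) (form i x) by apply: hx; rewrite -mem_earlier.
have -> : rho (form h x) = rho (form h x - g * lin (al h)).
  rewrite rmorphB rmorphM.
  have -> : rho (lin (al h)) = 0 by rewrite along_lin faP faN scale0r addr0.
  by rewrite mulr0 subr0.
apply: rho_prod_dvdp => // j jR.
have [|jT rj] := hR j; first by rewrite inE jR orbT.
have [jh _] := earlier_neq jT; split=> //.
have [l [c E]] := rt_eq ih jh (etrans ri (esym rj)).
have c0 : c != 0.
  apply/eqP => c0; apply: (@dist j i); first by apply: contraNneq iR => <-.
  by exists l; rewrite E c0 scale0r addr0.
apply: (@divsZ _ _ c) => //.
have formE : form j x = l *: form i x + c *: form h x.
  rewrite /form /uA /vA E !dotDl !dotZl !scalerDl !scalerDr !scalerA.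
  by rewrite addrACA.
have -> : c *: (form h x - g * lin (al h)) = form j x - g * lin (al j).
  rewrite formE gE E linD !linZ scalerBr -!mul_mpolyC; ring.
by apply: divsB; [apply: hx; rewrite -mem_earlier | exact/divsMl/divs_refl].
Qed.

Lemma prod_homog (R : seq 'I_m.+1) : \prod_(j <- R) lin (al j) \is (size R).-homog.
Proof.
elim: R => [|j R IH]; first by rewrite big_nil dhomog1.
by rewrite big_cons; apply: (@dhomogM _ _ _ 1%N _ (size R)) => //; apply: lin_homog.
Qed.

Lemma rho_prod (R : seq 'I_m.+1) : (forall j, j \in R -> j != h) ->
  exists2 c, c != 0 & rho (\prod_(j <- R) lin (al j)) = c *: \prod_(j <- R) ('X - (rt j)%:P).
Proof.
move=> hR; exists (\prod_(j <- R) dot (al j) (fN f)).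
  by rewrite prodf_seq_neq0; apply/allP => j /hR/generic.
rewrite -scaler_prod rmorph_prod big_seq [RHS]big_seq; apply: eq_bigr => j jR.
by rewrite -along_al ?hR.
Qed.

Lemma restr_divisor_undup :
  \prod_(j <- earlier) ('X - (rt j)%:P) = restr_divisor * \prod_(y <- undup roots1) ('X - y%:P).
Proof.
rewrite -big_cat -(big_map rt xpredT (fun y => 'X - y%:P)) /=; apply: perm_big.
have /permP P := perm_dups roots1.
have /permP Q : perm_eq (map rt earlier) (roots1 ++ roots0).
  rewrite /roots1 /roots0 -map_cat; apply: perm_map; rewrite perm_sym perm_catC.
  exact: permEl (perm_filterC (fun j => rt j == rt ord0) earlier).
apply/permP => p; rewrite Q !count_cat P count_cat; lia.
Qed.

(* Products of forms realize [restr_divisor * \prod_(z != y) ('X - z)] times any polynomial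
   of small degree, for [y] in [undup roots1]; Lagrange interpolation combines these. *)
Lemma DD_realize k g : (h <= k.+1)%N -> (size (restr_divisor * g)%R <= k.+1)%N ->
  exists2 x, DDh h k x & rho (form h x) = restr_divisor * g.
Proof.
move=> hk sBg.
have h0' : h != ord0 by rewrite -val_eqE /= -lt0n.
have [->|g0] := eqVneq g 0.
  exists 0; first by case: (DDh_subspace h k).
  by rewrite /form !scaler0 addr0 rmorph0 mulr0.
have BBm : restr_divisor \is monic by apply: monic_prod_XsubC.
have sg : (size restr_divisor + size g <= k.+2)%N.
  by move: sBg; rewrite size_monicM // -ltnS; case: (size restr_divisor) (size_restr_divisor) => //; lia.
(* When all earlier planes pass through the point of plane [ord0], the product of all their forms
   restricts to a multiple of [restr_divisor], and a constant direction with value 1 on [al h]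
   finishes. *)
have [s1n|s1n] := eqVneq (undup roots1) [::].
  have sBB : size restr_divisor = h by rewrite -size_restr_divisor /new_roots s1n addn0.
  have [c c0 cE] := rho_prod (fun j jT => (earlier_neq jT).1).
  rewrite restr_divisor_undup s1n big_nil mulr1 in cE.
  have [|q hq qE] := @along_lift _ _ f (k - h.-1) (c^-1 *: g).
    by apply: leq_trans (size_scale_leq _ _) _; move: sg; rewrite sBB; lia.
  have [a [b abE]] : exists a b, uA h * a + vA h * b = 1.
    case: (uv_neq0 h0') => n; first by exists (uA h)^-1, 0; rewrite mulr0 addr0 mulfV.
    by exists 0, (vA h)^-1; rewrite mulr0 add0r mulfV.
  have hQ : \prod_(j <- earlier) lin (al j) * q \is k.-homog.
    have -> : k = (size earlier + (k - h.-1))%N by rewrite size_earlier; lia.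
    by apply: dhomogM => //; apply: prod_homog.
  exists (\prod_(j <- earlier) lin (al j) * q * a%:MP, \prod_(j <- earlier) lin (al j) * q * b%:MP).
    split; last by split; rewrite /= mulrC mul_mpolyC rpredZ.
    move=> j jh; rewrite (formM j _ (a%:MP, b%:MP)); apply/divsMr/divsMr.
    rewrite (bigD1_seq j) ?mem_earlier ?uniq_earlier //=; exact/divsMr/divs_refl.
  rewrite (formM h _ (a%:MP, b%:MP)) /form /= -!mul_mpolyC -!mpolyCM -mpolyCD abE mulr1.
  by rewrite rmorphM cE qE -scalerAl -scalerAr scalerA mulfV // scale1r.
have sBB := size_restr_divisor; have T0 : (0 < size earlier)%N.
  rewrite lt0n; apply: contraNneq s1n => /size0nil T0; by rewrite /roots1 T0.
rewrite size_earlier in T0.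
(* The products used below have [h - 2] factors, which leaves degree [(k - h.-1).+1] for the
   multiplier. *)
have [|c [sc gE]] := @lagrange_span _ (undup roots1) (k - h.-1).+1 g (undup_uniq _) s1n.
  move: h0 hk sg sBB; rewrite /new_roots.
  move: (size restr_divisor) (size (undup roots1)) (size g) (nat_of_ord h) => x y z t. lia.
(* The factor [al j] can be omitted from the product because the constant direction [(- vA j, uA j)]
   kills it; [e] is the value of this direction on [al h]. *)
have real y : y \in undup roots1 -> exists2 x, DDh h k x &
    rho (form h x) = restr_divisor * (c y * \prod_(z <- undup roots1 | z != y) ('X - z%:P)).
  rewrite mem_undup => /mapP[j]; rewrite mem_filter => /andP[jr jT] ->.
  have [jh j0] := earlier_neq jT.
  pose R := rem j earlier.
  have uR : uniq R by apply/rem_uniq/uniq_earlier.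
  have pR : perm_eq earlier (j :: R) by apply: perm_to_rem.
  have sR : size R = (h.-1).-1 by rewrite size_rem // size_earlier.
  have hR i : i \in R -> i != h by move/mem_rem => /earlier_neq[].
  have [d d0 dE] := rho_prod hR.
  have e0 := rt_inj_uv jh j0 jr; set e := _ - _ in e0.
  have dR : \prod_(i <- R) ('X - (rt i)%:P) =
      restr_divisor * \prod_(z <- undup roots1 | z != rt j) ('X - z%:P).
    apply: (mulfI (_ : 'X - (rt j)%:P != 0)); first by rewrite polyXsubC_eq0.
    transitivity (\prod_(i <- earlier) ('X - (rt i)%:P)).
      by rewrite (perm_big _ pR) big_cons.
    rewrite restr_divisor_undup mulrCA; congr (_ * _).
    rewrite (bigD1_seq (rt j)) ?undup_uniq //= mem_undup.
    by apply/mapP; exists j => //; rewrite mem_filter jr.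
  have [|q hq qE] := @along_lift _ _ f (k - h.-1).+1 ((d * e)^-1 *: c (rt j)).
    exact: leq_trans (size_scale_leq _ _) (sc _).
  have hQ : \prod_(i <- R) lin (al i) * q \is k.-homog.
    have -> : k = (size R + (k - h.-1).+1)%N by rewrite sR; move: hk T0; clear; lia.
    by apply: dhomogM => //; apply: prod_homog.
  exists (\prod_(i <- R) lin (al i) * q * (- vA j)%:MP, \prod_(i <- R) lin (al i) * q * (uA j)%:MP).
    split; last by split; rewrite /= mulrC mul_mpolyC rpredZ.
    move=> i ih; rewrite (formM i _ ((- vA j)%:MP, (uA j)%:MP)).
    have [->|ij] := eqVneq i j.
      rewrite /form /= -!mul_mpolyC -!mpolyCM -mpolyCD.
      have -> : uA j * - vA j + vA j * uA j = 0 by ring.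
      by rewrite mpolyC0 mulr0; apply: divs0.
    have iR : i \in R by rewrite mem_rem_uniq ?uniq_earlier // inE ij mem_earlier.
    apply/divsMr/divsMr; rewrite (bigD1_seq i) //=; exact/divsMr/divs_refl.
  rewrite (formM h _ ((- vA j)%:MP, (uA j)%:MP)) /form /= -!mul_mpolyC -!mpolyCM -mpolyCD.
  have -> : uA h * - vA j + vA h * uA j = e by rewrite /e; ring.
  rewrite !rmorphM alongC dE qE dR -!mul_polyC.
  have E : d%:P * (d * e)^-1%:P * e%:P = 1 :> {poly F}.
    by rewrite -!polyCM mulrAC mulfV ?mulf_neq0.
  set Z := \prod_(z <- _ | _) _.
  transitivity (d%:P * (d * e)^-1%:P * e%:P * (restr_divisor * (c (rt j) * Z))); last by rewrite E mul1r.
  by move: ((d * e)^-1%:P) (c (rt j)) => *; ring.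
have /choice[X XP] y : exists x, y \in undup roots1 -> DDh h k x /\
    rho (form h x) = restr_divisor * (c y * \prod_(z <- undup roots1 | z != y) ('X - z%:P)).
  have [/real[x hx xE]|//] := boolP (y \in undup roots1); first by exists x.
  by exists 0.
exists (\sum_(y <- undup roots1) X y).
  by rewrite big_seq; apply: subspace_sum; [exact: DDh_subspace | move=> y /XP[]].
have fD x y : rho (form h (x + y)) = rho (form h x) + rho (form h y).
  by have := form_linear h 1 x y; rewrite !scale1r => ->; rewrite rmorphD.
have f0' : rho (form h 0) = 0 by rewrite /form !scaler0 addr0 rmorph0.
rewrite (big_morph (fun x => rho (form h x)) fD f0') gE mulr_sumr big_seq [RHS]big_seq.
by apply: eq_bigr => y /XP[].
Qed.

Lemma restr_divisor_neq0 : restr_divisor != 0.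
Proof. exact/monic_neq0/monic_prod_XsubC. Qed.

(** Rank-nullity for restriction to plane [h]: the image has dimension [k.+2 - size restr_divisor].
    The additive form of the equation avoids truncated subtraction. *)
Lemma DD_step_hasdim k d : (h <= k.+1)%N -> hasdim (DDh h k) d ->
  exists2 d', hasdim (DDh h.+1 k) d' & (d + h = d' + k.+2 + new_roots)%N.
Proof.
move=> hk hd.
have fl : linear (fun x => rho (form h x)).
  by move=> a x y; rewrite form_linear rmorphD alongZ.
have Bl : linear (fun g : {poly F} => restr_divisor * g).
  by move=> a x y; rewrite mulrDr -scalerAr.
have him : hasdim (fun y : {poly F} => exists2 x, DDh h k x & rho (form h x) = y) (k.+2 - size restr_divisor).
  apply: (@hasdim_eq _ _ (fun y : {poly F} =>
    exists2 g : {poly F}, (size g <= k.+2 - size restr_divisor)%N & restr_divisor * g = y)).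
    move=> y; split=> [[g sg <-]|[x hx <-]].
      apply: DD_realize => //; have [->|g0] := eqVneq g 0; first by rewrite mulr0 size_poly0.
      rewrite size_monicM ?monic_prod_XsubC //.
      have := size_restr_divisor; move: sg; case: (size restr_divisor) (size g) => [|x] y'; lia.
    have [hD hH] := hx; have /dvdpP[g gE] := restr_divisor_dvdp hD.
    exists g; last by rewrite mulrC gE.
    have := size_along (fP f) (fN f) (form_homog h hH).
    rewrite gE mulrC; have [->|g0] := eqVneq g 0; first by rewrite size_poly0.
    rewrite size_monicM ?monic_prod_XsubC //.
    by case: (size restr_divisor) (size_restr_divisor) => //; lia.
  apply: (hasdim_inj Bl); last exact: hasdim_poly.
    by move=> g _ /eqP; rewrite mulf_eq0 (negbTE restr_divisor_neq0) => /eqP.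
  split=> [|a x y sx sy]; first by rewrite size_poly0.
  apply: leq_trans (size_polyD _ _) _; rewrite geq_max sy andbT.
  exact: leq_trans (size_scale_leq _ _) sx.
have [d' hd' dE] := hasdim_rank_nullity fl (DDh_subspace h k) hd him.
exists d'; last first.
  have := size_restr_divisor; move: dE; case: (size restr_divisor) => [|x]; lia.
apply: hasdim_eq hd' => x; split=> [[[hD hH] rx]|[hD hH]].
  split=> // j /andP[j0]; rewrite ltnS leq_eqVlt => /orP[/eqP jh|jh].
    by have -> : j = h by [apply: val_inj]; apply: along_eq0 (form_homog h hH) rx.
  by apply: hD; rewrite j0.
split; first by split=> // j /andP[j0 jh]; apply: hD; rewrite j0 ltnS ltnW.
have [q ->] : divs (lin (al h)) (form h x) by apply: hD; rewrite h0 /=.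
by rewrite rmorphM along_lin faP faN scale0r addr0 mulr0.
Qed.

End Step.
End PairModule.

(** * The characteristic polynomial *)

Section Lattice.
Variables (F : numFieldType) (m : nat).
Variable A : 'M[F]_(m.+1, 3).

(* The lattice and characteristic polynomial of Defs over any [numFieldType]; over
   [R[i]] they are convertible to the originals. *)
Definition restr (T : {set 'I_m.+1}) : 'M[F]_(m.+1, 3) :=
  \matrix_(i, j) (if i \in T then A i j else 0).

Definition inter (T : {set 'I_m.+1}) : 'M[F]_3 := <<kermx (restr T)^T>>%MS.

Definition lattice : seq 'M[F]_3 := undup [seq inter T | T : {set 'I_m.+1}].

Fixpoint mobius (fuel : nat) (X : 'M[F]_3) : int :=
  match fuel with
  | 0 => 0
  | k.+1 => if (X == 1%:M)%MS then 1 else - \sum_(Y <- lattice | (X < Y)%MS) mobius k Y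
  end.

Lemma mobiusS k X : mobius k.+1 X =
  if (X == 1%:M)%MS then 1 else - \sum_(Y <- lattice | (X < Y)%MS) mobius k Y.
Proof. by []. Qed.

Arguments mobius : simpl never.

Definition char_poly_gen : {poly int} :=
  \sum_(X <- lattice) mobius 4 X *: 'X^(\rank X).

Local Notation al j := (row j A).
Hypothesis nz : forall i, al i != 0.
Hypothesis dist : forall i j, i != j -> ~ exists c, al i = c *: al j.

Local Notation hyp i := (inter [set i]).
Local Notation pt i j := (inter [set i; j]).

Lemma sub_interP k (Y : 'M[F]_(k, 3)) (T : {set 'I_m.+1}) :
  reflect (forall i, i \in T -> Y *m (al i)^T = 0) (Y <= inter T)%MS.
Proof.
rewrite genmxE; apply: (iffP sub_kermxP) => [E i iT|E].
  have -> : al i = row i (restr T) by apply/rowP => j; rewrite !mxE iT.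
  by rewrite tr_row colE mulmxA E mul0mx.
apply/matrixP => a i; rewrite !mxE; case: (boolP (i \in T)) => iT; last first.
  by rewrite big1 // => j _; rewrite !mxE (negbTE iT) mulr0.
have := congr1 (fun M : 'M_(k, 1) => M a 0) (E i iT); rewrite !mxE => E0.
by rewrite -[RHS]E0; apply: eq_bigr => j _; rewrite !mxE iT.
Qed.

Lemma sub_inter k (Y : 'M[F]_(k, 3)) (T : {set 'I_m.+1}) :
  (Y <= inter T)%MS = [forall i in T, (Y <= hyp i)%MS].
Proof.
apply/sub_interP/forall_inP => [h i iT|h i iT].
  by apply/sub_interP => j; rewrite inE => /eqP->; apply: h.
by have /sub_interP := h i iT; apply; rewrite inE.
Qed.

Lemma sub_pt k (Y : 'M[F]_(k, 3)) i j :
  (Y <= pt i j)%MS = (Y <= hyp i)%MS && (Y <= hyp j)%MS.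
Proof.
rewrite sub_inter; apply/forall_inP/andP => [h|[h1 h2] l].
  by split; apply: h; rewrite !inE eqxx ?orbT.
by rewrite !inE => /orP[]/eqP->.
Qed.

Lemma row_dot (a x : 'rV[F]_3) : (x *m a^T == 0) = (dot a x == 0).
Proof.
rewrite [x *m _]mx11_scalar -scalemx1 scaler_eq0 oner_eq0 orbF mxE /dot.
by congr (_ == 0); apply: eq_bigr => k _; rewrite mxE mulrC.
Qed.

Lemma sub_hyp (x : 'rV[F]_3) i : (x <= hyp i)%MS = (dot (al i) x == 0).
Proof.
rewrite -row_dot; apply/sub_interP/eqP => [|E j]; first by apply; rewrite inE.
by rewrite inE => /eqP->.
Qed.

Lemma inter_space_inj T1 T2 : (inter T1 == inter T2)%MS ->
  inter T1 = inter T2.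
Proof. by move=> /genmxP; rewrite !genmx_id. Qed.

Lemma mem_lattice T : inter T \in lattice.
Proof. by rewrite mem_undup; apply/mapP; exists T; rewrite ?mem_enum. Qed.

Lemma latticeP X : X \in lattice -> exists T, X = inter T.
Proof. by rewrite mem_undup => /mapP[T _ ->]; exists T. Qed.

Lemma lattice_inj X Y : X \in lattice -> Y \in lattice ->
  (X == Y)%MS -> X = Y.
Proof. by move=> /latticeP[T ->] /latticeP[U ->]; apply: inter_space_inj. Qed.

Local Notation full := (inter set0).

Lemma sub_full k (Y : 'M[F]_(k, 3)) : (Y <= full)%MS.
Proof. by apply/sub_interP => i; rewrite inE. Qed.

Lemma eq_full : (full == 1%:M)%MS.
Proof. by rewrite sub_full submx1. Qed.

Lemma rank_full : \rank full = 3.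
Proof. by rewrite (eqmxP eq_full) mxrank1. Qed.

Lemma hyp_kermx i : (hyp i :=: kermx (al i)^T)%MS.
Proof.
apply/eqmxP/andP; split; last first.
  by apply/sub_interP => j; rewrite inE => /eqP->; apply: mulmx_ker.
by apply/sub_kermxP; have /sub_interP := submx_refl (hyp i); apply; rewrite inE.
Qed.

Lemma rank_hyp i : \rank (hyp i) = 2.
Proof. by rewrite hyp_kermx mxrank_ker mxrank_tr rank_rV nz. Qed.

Lemma hyp_inj i j : (hyp i <= hyp j)%MS -> i = j.
Proof.
move=> le; apply/eqP/negP => /negP ij.
have [f _] := frame_exists (nz j).
have [f' _] := frame_exists (nz i).
have h1 : dot (al j) (fP f') = 0.
  by apply/eqP; rewrite -sub_hyp (submx_trans _ le) // sub_hyp faP.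
have h2 : dot (al j) (fN f') = 0.
  by apply/eqP; rewrite -sub_hyp (submx_trans _ le) // sub_hyp faN.
apply: (@dist j i); first by rewrite eq_sym.
by exists (dot (al j) (fR f')); apply: frame_span.
Qed.

Lemma rank_pt i j : i != j -> \rank (pt i j) = 1%N.
Proof.
move=> ij; apply/eqP; rewrite eqn_leq; apply/andP; split.
  have sub : (pt i j <= hyp i)%MS by have := submx_refl (pt i j); rewrite sub_pt => /andP[].
  have := mxrankS sub; rewrite rank_hyp leq_eqVlt => /orP[/eqP r2|]; last by rewrite ltnS.
  have : (hyp i <= pt i j)%MS.
    by have := mxrank_leqif_sup sub => -[_]; rewrite r2 rank_hyp eqxx => <-.
  by rewrite sub_pt => /andP[_ /hyp_inj E]; rewrite E eqxx in ij.
have ji : j != i by rewrite eq_sym.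
have [f gf] : exists f : frame (al i), forall b, b \in [:: al j] -> dot b (fN f) != 0.
  by apply: frame_generic (nz i) _ => b; rewrite inE => /eqP->; apply: dist.
have {}gf := gf (al j) (mem_head _ _).
(* The common zero of both forms on the line through [fP] in direction [fN]; it is nonzero because
   [fs] takes the value 1 on it. *)
pose z := fP f - (dot (al j) (fP f) / dot (al j) (fN f)) *: fN f.
have z0 : z != 0.
  apply/eqP => z0; have := congr1 (dot (fs f)) z0.
  rewrite /z -scaleNr dotDr dotZr fsP fsN mulr0 addr0 -(scale0r z) dotZr mul0r.
  by move/eqP; rewrite oner_eq0.
have zs : (z <= pt i j)%MS.
  rewrite sub_pt !sub_hyp /z -scaleNr !dotDr !dotZr faP faN mulr0 addr0 eqxx /=.
  by rewrite mulNr divfK // subrr.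
by apply: leq_trans (mxrankS zs); rewrite rank_rV z0.
Qed.

Lemma rank_lattice_lt3 T : T != set0 -> (\rank (inter T) < 3)%N.
Proof.
case/set0Pn => i iT.
have sub : (inter T <= hyp i)%MS.
  by have := submx_refl (inter T); rewrite {2}[inter T]/inter -/(inter T) sub_inter => /forall_inP/(_ _ iT).
by have := mxrankS sub; rewrite rank_hyp.
Qed.

Lemma lattice_full X : X \in lattice -> \rank X = 3 -> X = full.
Proof.
move=> /latticeP[T ->]; have [->//|/rank_lattice_lt3] := eqVneq T set0.
by move=> lt E; rewrite E in lt.
Qed.

Lemma lattice_hyp X : X \in lattice -> \rank X = 2 -> exists i, X = hyp i.
Proof.
move=> /latticeP[T ->]; have [->|/set0Pn[i iT]] := eqVneq T set0.
  by rewrite rank_full.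
have sub : (inter T <= hyp i)%MS.
  by have := submx_refl (inter T); rewrite sub_inter => /forall_inP/(_ _ iT).
move=> r2; exists i; apply: inter_space_inj; rewrite sub /=.
by have := mxrank_leqif_sup sub => -[_]; rewrite r2 rank_hyp eqxx => <-.
Qed.

Lemma lattice_pt X i j : X \in lattice -> \rank X = 1%N -> i != j ->
  (X <= hyp i)%MS -> (X <= hyp j)%MS -> X = pt i j.
Proof.
move=> XL r1 ij Xi Xj; apply: lattice_inj => //; first exact: mem_lattice.
have sub : (X <= pt i j)%MS by rewrite sub_pt Xi.
rewrite sub /=.
by have := mxrank_leqif_sup sub => -[_]; rewrite r1 rank_pt // eqxx => <-.
Qed.

Lemma hyp_neq1 (X : 'M[F]_3) : (\rank X < 3)%N -> (X == 1%:M)%MS = false.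
Proof. by move=> lt; apply/negP => /eqmxP E; rewrite E mxrank1 in lt. Qed.

Lemma moebius_full k : mobius k.+1 full = 1.
Proof. by rewrite mobiusS eq_full. Qed.

Lemma moebius_hyp i k : mobius k.+2 (hyp i) = -1.
Proof.
rewrite mobiusS hyp_neq1 ?rank_hyp // -big_filter.
have -> : [seq Y <- lattice | (hyp i < Y)%MS] = [:: full].
  apply: perm_small_eq => //; apply: uniq_perm => //; first exact/filter_uniq/undup_uniq.
  move=> Y; rewrite mem_filter !inE; apply/andP/eqP => [[lt YL]|->].
    apply: lattice_full => //; have := rank_leq_row Y; have := ltmx1.
    by have := rank_ltmx lt; rewrite rank_hyp; lia.
  by rewrite mem_lattice ltmxErank sub_full rank_hyp rank_full.
by rewrite big_seq1 moebius_full.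
Qed.

(** The proper overspaces of a line in the lattice are the full space, of value 1, and the planes
    through the line, of value -1 each. *)
Lemma moebius_pt X : X \in lattice -> \rank X = 1%N ->
  mobius 4 X = (#|[set i | (X <= hyp i)%MS]|)%:Z - 1.
Proof.
move=> XL r1; have -> : mobius 4 X = - \sum_(Y <- lattice | (X < Y)%MS) mobius 3 Y.
  by rewrite mobiusS hyp_neq1 ?r1.
rewrite -big_filter (perm_big (full :: [seq hyp i | i <- enum [set i | (X <= hyp i)%MS]])); last first.
  apply: uniq_perm; first exact/filter_uniq/undup_uniq.
    rewrite /= map_inj_uniq ?enum_uniq ?andbT.
      by apply/mapP => -[i _ E]; have := rank_hyp i; rewrite -E rank_full.
    by move=> i j E; apply: hyp_inj; rewrite E.
  move=> Y; rewrite mem_filter !inE; apply/andP/orP => [[lt YL]|[/eqP->|/mapP[l]]].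
  - have r := rank_ltmx lt; have := rank_leq_row Y; rewrite r1 in r.
    have [r2|r2] := eqVneq (\rank Y) 2.
      have [i E] := lattice_hyp YL r2; move=> _; right; apply/mapP; exists i => //.
      by rewrite mem_enum inE -E ltmxW.
    by move=> r3; left; apply/eqP/lattice_full => //; move: r r2 r3; lia.
  - by rewrite mem_lattice ltmxErank sub_full r1 rank_full.
  - by rewrite mem_enum inE => Xi ->; rewrite mem_lattice ltmxErank Xi r1 rank_hyp.
rewrite big_cons moebius_full big_map (eq_bigr (fun _ => -1)); last first.
  by move=> i _; apply: moebius_hyp.
rewrite big_const_seq count_predT -cardE iter_addr_0 opprD addrC.
by rewrite -mulNrn opprK natz.
Qed.

Definition lines := [seq X <- lattice | \rank X == 1%N].

Lemma char_poly_coef1 : char_poly_gen`_1 =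
  \sum_(X <- lines) (#|[set i | (X <= hyp i)%MS]|%:Z - 1).
Proof.
rewrite /char_poly_gen coef_sum /lines big_filter [LHS](bigID (fun X => \rank X == 1%N)) /=.
rewrite [X in _ + X]big1 ?addr0 => [|X rX]; last first.
  by rewrite coefZ coefXn eq_sym (negbTE rX) mulr0.
rewrite big_seq_cond [RHS]big_seq_cond; apply: eq_bigr => X /andP[XL /eqP r1].
by rewrite coefZ coefXn r1 eqxx mulr1 moebius_pt.
Qed.

(** In projective terms, the number of points cut out on plane [h] by the planes added before it. *)
Definition npts (h : 'I_m.+1) :=
  size (undup [seq pt h j | j : 'I_m.+1 <- enum 'I_m.+1 & (j < h)%N]).

Lemma nptsE h : npts h = (\sum_(X <- lines)
  ((X <= hyp h)%MS && [exists j : 'I_m.+1, (j < h)%N && (X <= hyp j)%MS]))%N.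
Proof.
have -> : (\sum_(X <- lines) ((X <= hyp h)%MS &&
      [exists j : 'I_m.+1, (j < h)%N && (X <= hyp j)%MS]) = count (fun X =>
    (X <= hyp h)%MS && [exists j : 'I_m.+1, (j < h)%N && (X <= hyp j)%MS]) lines)%N.
  by rewrite -sum1_count [RHS]big_mkcond; apply: eq_bigr => X _; case: (_ && _).
rewrite -size_filter /npts; apply/perm_size/uniq_perm.
- exact: undup_uniq.
- exact/filter_uniq/filter_uniq/undup_uniq.
move=> X; rewrite mem_undup mem_filter mem_filter.
apply/mapP/andP => [[j]|[/andP[Xh /existsP[j /andP[jh Xj]]] /andP[/eqP r1 XL]]].
  rewrite mem_filter mem_enum andbT => jh ->.
  have hj : h != j by rewrite -val_eqE /= gtn_eqF.
  have := submx_refl (pt h j); rewrite sub_pt => /andP[ph pj].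
  rewrite ph /= rank_pt // eqxx mem_lattice; split=> //.
  by apply/existsP; exists j; rewrite jh.
exists j; first by rewrite mem_filter jh mem_enum.
by apply: lattice_pt => //; rewrite -val_eqE /= gtn_eqF.
Qed.

(** A line of the lattice is counted by every plane through it except the first, and that count is
    its Möbius value. *)
Lemma sum_npts : (\sum_h npts h)%:Z = char_poly_gen`_1.
Proof.
rewrite char_poly_coef1; under eq_bigr => h _ do rewrite nptsE.
rewrite exchange_big /= -[LHS]natz natr_sum big_seq [RHS]big_seq; apply: eq_bigr => X.
rewrite mem_filter => /andP[/eqP r1 XL]; rewrite natz.
pose G := [set i | (X <= hyp i)%MS].
have [i0 i0G] : exists i, i \in G.
  have [T XE] := latticeP XL; have [T0|/set0Pn[i iT]] := eqVneq T set0.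
    by move: r1; rewrite XE T0 rank_full.
  have := submx_refl X; rewrite {2}XE sub_inter => /forall_inP/(_ i iT) Xi.
  by exists i; rewrite inE.
have [i iG imin] := @arg_minnP _ i0 (mem G) val i0G.
have {}iG : i \in G := iG.
rewrite -/G (cardsD1 i) iG PoszD addrC addKr -sum1_card; congr Posz.
rewrite [RHS]big_mkcond; apply: eq_bigr => h _; rewrite !inE.
case: (boolP (X <= hyp h)%MS) => Xh; last by rewrite andbF.
have hG : h \in G by rewrite inE.
have le_ih := imin h hG; rewrite andbT /=.
have [->|hi] := eqVneq h i.
  case: existsP => // -[j /andP[ji Xj]].
  by have := imin j; rewrite !inE => /(_ Xj); rewrite leqNgt ji.
case: existsP => // -[]; exists i; move: iG; rewrite inE => ->.
by rewrite ltn_neqAle eq_sym hi le_ih.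
Qed.

Section Roots.
Variables (h : 'I_m.+1) (f : frame (al h)).
Hypothesis generic : forall j, j != h -> dot (al j) (fN f) != 0.

Lemma rt_eq_pt i j : i != h -> j != h -> (rt f i == rt f j) = (pt h i == pt h j).
Proof.
move=> ih jh; apply/eqP/eqP => [E|E].
  have le a b : a != h -> b != h -> rt f a = rt f b -> (pt h a <= pt h b)%MS.
    move=> ah bh ab; have [l [c bE]] := rt_eq generic ah bh ab.
    have := submx_refl (pt h a); rewrite sub_pt => /andP[ph pa].
    rewrite sub_pt ph /=; apply/sub_interP => k; rewrite inE => /eqP-> {k}.
    rewrite bE linearD !linearZ /= mulmxDr -!scalemxAr.
    have /sub_interP/(_ h) -> := ph; last by rewrite inE.
    by have /sub_interP/(_ a) -> := pa; rewrite ?inE // !scaler0 addr0.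
  by apply: inter_space_inj; rewrite !le.
pose z := fP f + rt f i *: fN f.
have dz k : dot (al k) z = dot (al k) (fP f) + rt f i * dot (al k) (fN f).
  by rewrite dotDr dotZr.
have : (z <= pt h i)%MS.
  rewrite sub_pt !sub_hyp !dz faP faN mulr0 addr0 eqxx /=.
  by rewrite /rt divfK ?generic // subrr.
rewrite E sub_pt !sub_hyp !dz => /andP[_ /eqP]; rewrite /rt.
have := generic jh; have := generic ih => ni nj E2.
by move/eqP: E2; rewrite addrC addr_eq0 => /eqP E2; apply: (mulIf nj); rewrite E2 divfK.
Qed.

(** The additional 1 is the point on plane [ord0]. *)
Lemma npts_new_roots : (0 < h)%N -> npts h = (new_roots f).+1.
Proof.
move=> h0.
pose s := [seq j : 'I_m.+1 <- enum 'I_m.+1 | (j < h)%N].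
have sh j : j \in s -> j != h by rewrite mem_filter -val_eqE /= => /andP[/ltn_eqF->].
have -> : npts h = size (undup [seq rt f j | j <- s]).
  rewrite /npts -/s; elim: s sh => //= j s IH sh.
  have jh := sh j (mem_head _ _).
  have {}sh i : i \in s -> i != h by move=> hi; apply: sh; rewrite inE hi orbT.
  have -> : (pt h j \in [seq pt h i | i <- s]) = (rt f j \in [seq rt f i | i <- s]).
    apply/mapP/mapP => -[i iS /eqP E]; exists i => //; apply/eqP; move: E;
    by rewrite (rt_eq_pt jh (sh i iS)).
  by case: ifP => _ /=; rewrite IH.
have os : ord0 \in s by rewrite mem_filter mem_enum h0.
rewrite /new_roots -(size_map id) /= -[(size _).+1]/(size (rt f ord0 :: undup (roots1 f))).
apply/perm_size/uniq_perm; rewrite ?map_id ?undup_uniq //=.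
  rewrite undup_uniq andbT mem_undup; apply/mapP => -[j].
  by rewrite mem_filter => /andP[jr _] E; rewrite -E eqxx in jr.
move=> y; rewrite mem_undup inE mem_undup; apply/mapP/orP => [[j js ->]|].
  have [->|jr] := eqVneq (rt f j) (rt f ord0); first by left.
  right; apply/mapP; exists j => //; rewrite mem_filter jr mem_earlier /=.
  move: js; rewrite mem_filter => /andP[-> _]; rewrite andbT lt0n.
  apply: contraNneq jr => j0; suff -> : j = ord0 by [].
  exact: val_inj.
case=> [/eqP->|/mapP[j]]; first by exists ord0.
rewrite mem_filter mem_earlier => /andP[_ /andP[_ jh]] ->.
by exists j => //; rewrite mem_filter jh mem_enum.
Qed.

End Roots.
End Lattice.

(** * Saturated ideals *)

Lemma pihomogMr (F : comNzRingType) n (p q : {mpoly F[n]}) e k : q \is e.-homog ->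
  pihomog mdeg k (p * q) = if (e <= k)%N then pihomog mdeg (k - e) p * q else 0.
Proof.
move=> hq; pose K := maxn (msize p) k.+1.
have pE := pihomog_partitionE (mf := mdeg) (leq_maxl (msize p) k.+1).
rewrite {1}pE mulr_suml linear_sum /=.
have term d : pihomog mdeg k (pihomog mdeg d p * q) =
    if (d + e)%N == k then pihomog mdeg d p * q else 0.
  have hd := dhomogM (pihomogP mdeg d p) hq.
  case: eqP => [<-|/eqP ne]; first exact: pihomog_dE.
  exact: pihomog_ne0 hd.
under eq_bigr => d _ do rewrite term.
rewrite -big_mkcond /=; case: leqP => ek.
  have lt : (k - e < maxn (msize p) k.+1)%N by rewrite leq_max ltnS leq_subr orbT.
  rewrite (big_pred1 (Ordinal lt)) // => d /=; rewrite -val_eqE /=; lia.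
by rewrite big_pred0 // => d; lia.
Qed.

Section Saturation.
Variable F : numFieldType.
Local Notation S := {mpoly F[3]}.
Implicit Types (I J : S -> Prop) (p q : S).

Definition ideal I := [/\ I 0, forall p q, I p -> I q -> I (p + q)
  & forall p q, I q -> I (p * q)].

Definition saturated I := forall p, (forall i : 'I_3, I ('X_i * p)) -> I p.

(** The degree [k] part of [S / I] has dimension at most [l], expressed without forming the
    quotient. *)
Definition codim_le I k l := forall x : 'I_l.+1 -> S, (forall i, x i \is k.-homog) ->
  exists c : 'I_l.+1 -> F, (exists i, c i != 0) /\ I (\sum_i c i *: x i).

Lemma idealZ I c p : ideal I -> I p -> I (c *: p).
Proof. by case=> _ _ IM Ip; rewrite -mul_mpolyC; apply: IM. Qed.

Lemma ideal_sum I (T : Type) (r : seq T) (P : pred T) (G : T -> S) : ideal I ->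
  (forall i, P i -> I (G i)) -> I (\sum_(i <- r | P i) G i).
Proof. by case=> I0 ID IM h; apply: big_ind. Qed.

Definition radical J p := exists N, J (p ^+ N).

Lemma radicalD J p q : ideal J -> radical J p -> radical J q -> radical J (p + q).
Proof.
move=> iJ [M hM] [N hN]; exists (M + N)%N; have [_ _ JM] := iJ.
rewrite exprDn; apply: ideal_sum => // i _; rewrite -mulr_natl; apply: (JM).
have [iN|iN] := leqP N i.
  by rewrite -(subnK iN) exprD; apply: (JM); apply: (JM).
have Mi : (M <= M + N - i)%N by lia.
by rewrite mulrC -(subnK Mi) exprD; apply: (JM); apply: (JM).
Qed.

Lemma radicalM J p q : ideal J -> radical J q -> radical J (p * q).
Proof. by move=> [_ _ JM] [N hN]; exists N; rewrite exprMn; apply: JM. Qed.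

Lemma radicalX J p k : radical J (p ^+ k) -> radical J p.
Proof. by move=> [N hN]; exists (k * N)%N; rewrite exprM. Qed.

Lemma radical_id J p : J p -> radical J p.
Proof. by exists 1%N. Qed.

Lemma binary_form_mod l k (c : 'I_l.+1 -> F) (x y : S) a : (l <= k)%N ->
  exists s, \sum_i c i *: (x ^+ i * y ^+ (k - i)) =
    (\sum_i c i * a ^+ i) *: y ^+ k + s * (x - a *: y).
Proof.
move=> lk.
have term (i : 'I_l.+1) : exists s, x ^+ i * y ^+ (k - i) = a ^+ i *: y ^+ k + s * (x - a *: y).
  have ik : (i <= k)%N by apply: leq_trans lk; rewrite -ltnS.
  exists ((\sum_(j < i) x ^+ (i.-1 - j) * (a *: y) ^+ j) * y ^+ (k - i)).
  have := subrXX x (a *: y) i; set T := \sum_(j < i) _ => /eqP.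
  rewrite subr_eq => /eqP ->; rewrite mulrDl exprZn -scalerAl -exprD subnKC //.
  by rewrite addrC; congr (_ + _); rewrite mulrC mulrCA mulrC -mulrA (mulrC (y ^+ _)) mulrA.
have /choice[s sE] := term.
exists (\sum_i c i *: s i); rewrite scaler_suml mulr_suml -big_split /=.
by apply: eq_bigr => i _; rewrite sE scalerDr scalerA scalerAl.
Qed.

Lemma coefs_nonroot l (c : 'I_l.+1 -> F) : (exists i, c i != 0) ->
  exists a, \sum_i c i * a ^+ i != 0.
Proof.
move=> [i ci]; pose g : {poly F} := \poly_(j < l.+1) c (inord j).
have [|a ga] := @poly_nonroot _ g.
  by apply: contraNneq ci => g0; have := coef_poly l.+1 (fun j => c (inord j)) i;
    rewrite -/g g0 coef0 ltn_ord inord_val => <-.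
exists a; move: ga; rewrite /g horner_poly; congr (_ != 0).
by apply: eq_bigr => j _; rewrite inord_val.
Qed.

(** Since [l <= k], two variables have [l.+1] monomials of degree [k] available, so [I] contains
    nonzero binary forms in [X0], [X1] and in [y], [X2]. Generic [a], [b] turn them into pure powers
    modulo [L], so [I] and [L] together contain all monomials of large degree. If [L * p] is in [I],
    these monomials multiply [p] into [I], and saturation strips them off. *)
Lemma saturated_nzdivisor I l k : ideal I -> saturated I -> (l <= k)%N ->
  codim_le I k l -> exists2 a : 'rV[F]_3, true & forall p, I (lin a * p) -> I p.
Proof.
move=> iI satI lk cI.
pose X0 : S := 'X_ord0; pose X1 : S := 'X_(inord 1); pose X2 : S := 'X_(inord 2).
have hom (x y : S) : x \is 1.-homog -> y \is 1.-homog ->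
    forall i : 'I_l.+1, x ^+ i * y ^+ (k - i) \is k.-homog.
  move=> hx hy i; have ik : (i <= k)%N by apply: leq_trans lk; rewrite -ltnS.
  by have := dhomogM (dhomogMn i hx) (dhomogMn (k - i) hy); rewrite !mul1n subnKC.
have hX i : ('X_i : S) \is 1.-homog by rewrite dhomogX /= mdeg1.
have [c [c0 cE]] := cI _ (hom X0 X1 (hX _) (hX _)).
have [a ga] := coefs_nonroot c0.
have [s sE] := binary_form_mod c X0 X1 a lk.
pose y : S := X0 - a *: X1.
have hy : y \is 1.-homog by apply: rpredB; [exact: hX | apply: rpredZ; exact: hX].
have [d [d0 dE]] := cI _ (hom y X2 hy (hX _)).
have [b gb] := coefs_nonroot d0.
have [t tE] := binary_form_mod d y X2 b lk.
pose v : 'rV[F]_3 := delta_mx 0 ord0 - a *: delta_mx 0 (inord 1) - b *: delta_mx 0 (inord 2).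
have lin_delta i : lin (delta_mx 0 i) = 'X_i :> S.
  rewrite /lin (bigD1 i) //= mxE !eqxx scale1r big1 ?addr0 // => j ji.
  by rewrite mxE (negbTE ji) scale0r.
have vE : lin v = y - b *: X2 by rewrite /v -!scaleNr !linD !linZ !lin_delta !scaleNr.
exists v => //; rewrite vE; set L : S := y - b *: X2.
have [I0 ID IM] := iI.
pose J p := exists i q, I i /\ p = i + q * L.
have iJ : ideal J.
  split; first by exists 0, 0; rewrite mul0r addr0.
    move=> _ _ [i [q [Ii ->]]] [j [r [Ij ->]]]; exists (i + j), (q + r).
    by split; [exact: ID | ring].
  move=> p _ [i [q [Ii ->]]]; exists (p * i), (p * q).
  by split; [exact: IM | ring].
have JI p : I p -> J p by move=> Ip; exists p, 0; rewrite mul0r addr0.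
have JL : J L by exists 0, 1; rewrite mul1r add0r.
have rZ e p : radical J p -> radical J (e *: p).
  by move=> h; rewrite -mul_mpolyC; apply: radicalM.
have r2 : radical J X2.
  apply: (@radicalX _ _ k); apply: radical_id.
  have -> : X2 ^+ k = (\sum_i d i * b ^+ i)^-1 *:
      (\sum_i d i *: (y ^+ i * X2 ^+ (k - i)) + (- t) * L).
    by rewrite tE -/L mulNr addrK scalerA mulVf // scale1r.
  apply: idealZ => //; case: (iJ) => _ JD JM; apply: JD; first exact: JI.
  exact: JM.
have ry : radical J y.
  rewrite -[y](subrK (b *: X2)); apply: radicalD => //; first exact: radical_id.
  exact: rZ.
have r1 : radical J X1.
  apply: (@radicalX _ _ k).
  have -> : X1 ^+ k = (\sum_i c i * a ^+ i)^-1 *: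
      (\sum_i c i *: (X0 ^+ i * X1 ^+ (k - i)) + (- s) * y).
    by rewrite sE -/y mulNr addrK scalerA mulVf // scale1r.
  apply: rZ; apply: radicalD => //; first exact/radical_id/JI.
  exact: radicalM.
have r0 : radical J X0.
  by rewrite -[X0](subrK (a *: X1)); apply: radicalD => //; apply: rZ.
have rX i : radical J 'X_i.
  have [E|[E|E]] : i = ord0 \/ i = inord 1 \/ i = inord 2.
  - case: i => -[|[|[|//]]] lt; [left|right;left|right;right]; apply: val_inj => //=;
    by rewrite inordK.
  - by rewrite E.
  - by rewrite E.
  - by rewrite E.
(* Pigeonhole: a monomial of degree at least the sum of the [N i] has some exponent at least
   [N i]. *)
have /choice[N NE] := rX.
pose M := (\sum_i N i)%N.
have big_mono (mu : 'X_{1..3}) : (M <= mdeg mu)%N -> J 'X_[mu].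
  move=> Mm; have [i Ni] : exists i, (N i <= mu i)%N.
    apply/existsP; move: Mm; apply: contraLR; rewrite -ltnNge => /existsPn h.
    rewrite mdegE; apply: (@leq_trans (\sum_i (mu i).+1)%N).
      by rewrite !big_ord_recl big_ord0; lia.
    by apply: leq_sum => i _; rewrite ltnNge; apply: h.
  have [_ _ JM] := iJ.
  rewrite mpolyXE_id (bigD1 i) //= -(subnK Ni) exprD mulrC mulrA; apply: JM.
  exact: NE.
move=> p IL.
have desc t' : (forall mu : 'X_{1..3}, (t' <= mdeg mu)%N -> I ('X_[mu] * p)) -> I p.
  elim: t' => [|t' IH] h; first by have := h 0%MM (leq0n _); rewrite mpolyX0 mul1r.
  apply: IH => mu; rewrite leq_eqVlt => /orP[/eqP tE'|]; last exact: h.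
  apply: satI => i; rewrite mulrA -mpolyXD; apply: h.
  by rewrite mdegD mdeg1 -tE'.
apply: (desc M) => mu /big_mono[i [q [Ii ->]]].
rewrite mulrDl; apply: ID; first by rewrite mulrC; apply: IM.
by rewrite -mulrA; apply: IM.
Qed.

(* Multiplication by a linear form that is a nonzerodivisor modulo [I] embeds the
   degree [j] part of the quotient into its high degree parts. *)
Lemma saturated_codim I l k0 : ideal I -> saturated I ->
  (forall k, (k0 <= k)%N -> codim_le I k l) -> forall j, codim_le I j l.
Proof.
move=> iI satI cI j x hx.
(* The degree [maxn k0 l] lies in the range of the hypothesis and is at least [l]. *)
have [a _ La] := saturated_nzdivisor iI satI (leq_maxr k0 l) (cI _ (leq_maxl k0 l)).
have hLx i : lin a ^+ k0 * x i \is (k0 + j).-homog.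
  by have := dhomogM (dhomogMn k0 (lin_homog a)) (hx i); rewrite mul1n.
have [c [c0 cE]] := cI _ (leq_addr j k0) _ hLx.
exists c; split=> //.
have : I (lin a ^+ k0 * \sum_i c i *: x i).
  rewrite mulr_sumr; move: cE; under eq_bigr => i _ do rewrite scalerAr; exact.
elim: (k0) => [|e IH]; first by rewrite mul1r.
by rewrite exprS -mulrA => /La.
Qed.

End Saturation.

(** * The ideal of determinants *)

Section SectionIdeal.
Variable F : numFieldType.
Local Notation S := {mpoly F[3]}.
Variables (m : nat) (A : 'M[F]_(m.+1, 3)).
Local Notation al j := (row j A).
Hypothesis nz : forall i, al i != 0.
Hypothesis dist : forall i j, i != j -> ~ exists c, al i = c *: al j.
Variable f0 : frame (al ord0).
Local Notation DM := (DD f0 m.+1).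

Definition wedge (x y : S * S) : S := x.1 * y.2 - x.2 * y.1.

Definition others : seq 'I_m.+1 := [seq lift ord0 i | i <- enum 'I_m].
Definition Q0 : S := \prod_(j <- others) lin (al j).

Lemma mem_others j : (j \in others) = (j != ord0).
Proof.
apply/mapP/idP => [[i _ ->]|]; first by rewrite eq_sym neq_lift.
by case: (unliftP ord0 j) => [i -> _|->]; [exists i; rewrite ?mem_enum | rewrite eqxx].
Qed.

Lemma uniq_others : uniq others.
Proof. by rewrite map_inj_uniq ?enum_uniq //; apply: lift_inj. Qed.

Lemma Q0_homog : Q0 \is m.-homog.
Proof. by have := prod_homog A others; rewrite size_map size_enum_ord. Qed.

Lemma Q0_neq0 : Q0 != 0.
Proof. by rewrite prodf_seq_neq0; apply/allP => j _; rewrite lin_eq0 nz. Qed.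

Lemma Q0_divs p : (forall j, j != ord0 -> divs (lin (al j)) p) -> divs Q0 p.
Proof.
move=> h; apply: prime_prod_divs => [|i _|i j _ _ ij|i]; first exact: uniq_others.
- exact/prime_lin/nz.
- by move/(divs_lin_lin (nz i)); apply: dist; rewrite eq_sym.
- by rewrite mem_others; apply: h.
Qed.

Lemma DMP x : DM x <-> forall j, j != ord0 -> divs (lin (al j)) (form f0 j x).
Proof.
split=> h j; first by rewrite -val_eqE /= -lt0n => j0; apply: h; rewrite j0 ltn_ord.
by rewrite lt0n => /andP[j0 _]; apply: h; rewrite -val_eqE.
Qed.

(** Tangency passes to homogeneous components because the defining forms are homogeneous. This makes
    the minimality of [d] applicable to inhomogeneous pairs. *)
Lemma DM_pihomog k x : DM x -> DM (pihomog mdeg k x.1, pihomog mdeg k x.2).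
Proof.
move=> hx j jm; have [q E] := hx j jm.
have -> : form f0 j (pihomog mdeg k x.1, pihomog mdeg k x.2) = pihomog mdeg k (form f0 j x).
  by rewrite /form /= linearD !linearZ.
rewrite E (pihomogMr _ _ (lin_homog _)).
by case: ifP => _; [exact/divsMl/divs_refl | exact: divs0].
Qed.

Lemma wedge_linear x : linear (wedge x).
Proof. by move=> a y z; rewrite /wedge /= -!mul_mpolyC; ring. Qed.

(** Eliminating a component writes [uA j] and [vA j] times the determinant through the values of [x]
    and [y] on [al j]; one of these two constants is nonzero. *)
Lemma wedge_divs x y : DM x -> DM y -> divs Q0 (wedge x y).
Proof.
move=> /DMP hx /DMP hy; apply: Q0_divs => j j0.
have eu : uA f0 j *: wedge x y = form f0 j x * y.2 - x.2 * form f0 j y.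
  by rewrite /wedge /form -!mul_mpolyC; ring.
have ev : vA f0 j *: wedge x y = x.1 * form f0 j y - y.1 * form f0 j x.
  by rewrite /wedge /form -!mul_mpolyC; ring.
case: (uv_neq0 dist f0 j0) => n; apply: divsZ (n) _; rewrite ?eu ?ev; apply: divsB;
  by [apply: divsMr; auto | apply: divsMl; auto].
Qed.

Lemma wedge_cramer x y z :
  (wedge x y * z.1, wedge x y * z.2) =
  (wedge z y * x.1 + wedge x z * y.1, wedge z y * x.2 + wedge x z * y.2) :> S * S.
Proof. by congr (_, _); rewrite /wedge; ring. Qed.

Lemma divs_Q0 j : j != ord0 -> divs (lin (al j)) Q0.
Proof.
by move=> j0; apply: (divs_prod_mem (fun i => lin (al i))); rewrite mem_others.
Qed.

Lemma Q0_DDh : DDh f0 m.+1 m (Q0, 0).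
Proof.
split; last by split; rewrite /= ?Q0_homog ?dhomog0.
apply/DMP => j j0; rewrite /form /= scaler0 addr0 -mul_mpolyC.
exact/divsMl/divs_Q0.
Qed.

Lemma Q0_pair_neq0 : (Q0, 0) != 0 :> S * S.
Proof. by apply/eqP => -[] /eqP; apply/negP/Q0_neq0. Qed.

Lemma DD_degree_le d : (forall k x, (k < d)%N -> DDh f0 m.+1 k x -> x = 0) -> (d <= m)%N.
Proof.
move=> thmin; rewrite leqNgt; apply/negP => /thmin/(_ Q0_DDh)/eqP.
exact/negP/Q0_pair_neq0.
Qed.

(** * The ideal attached to a derivation of minimal degree *)

Section Theta.
Variables (d : nat) (th : S * S).
Hypothesis hth : DDh f0 m.+1 d th.
Hypothesis th0 : th != 0.
Hypothesis thmin : forall k x, (k < d)%N -> DDh f0 m.+1 k x -> x = 0.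

Lemma DM_msize x : DM x -> x != 0 -> (d < msize x.1)%N \/ (d < msize x.2)%N.
Proof.
move=> hx; have [h1|] := ltnP d (msize x.1); first by left.
have [h2|] := ltnP d (msize x.2); first by right.
move=> h2 h1; case/eqP.
have comp k : (k < d)%N -> pihomog mdeg k x.1 = 0 /\ pihomog mdeg k x.2 = 0.
  move=> kd; suff [-> ->] : (pihomog mdeg k x.1, pihomog mdeg k x.2) = 0 by [].
  apply: (thmin kd); split; first exact: DM_pihomog.
  by split; apply: pihomogP.
rewrite [x]surjective_pairing (pihomog_partitionE h1) (pihomog_partitionE h2).
by rewrite !big1 // => i _; case: (comp i (ltn_ord i)).
Qed.

(** Factoriality writes [th] and [x] as multiples of one pair [t]. This [t] may fail tangency to
    some planes; [P] collects their forms, and the tangent multiples of [t] are exactly the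
    multiples of [P * t]. *)
Lemma wedge_ker x : DM x -> wedge th x = 0 -> exists c : S, x = (c * th.1, c * th.2).
Proof.
have [hD [hh1 hh2]] := hth.
move=> hx /eqP; rewrite subr_eq0 => /eqP /mpoly_proportional[c [e [t1 [t2 [e1 e2 e3 e4]]]]].
pose t : S * S := (t1, t2).
have [c0|c0] := eqVneq c 0.
  by case/eqP: th0; rewrite [th]surjective_pairing e1 e2 c0 !mul0r.
have thE : th = (c * t.1, c * t.2) by rewrite [th]surjective_pairing e1 e2.
have xE : x = (e * t.1, e * t.2) by rewrite [x]surjective_pairing e3 e4.
pose bad := [seq j <- others | `[< ~ divs (lin (al j)) (form f0 j t) >]].
pose P := \prod_(j <- bad) lin (al j).
have badP (p : S) : DM (p * t.1, p * t.2) -> divs P p.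
  move=> /DMP hp; apply: prime_prod_divs; first exact/filter_uniq/uniq_others.
  - by move=> i _; apply/prime_lin/nz.
  - by move=> i j _ _ ij /(divs_lin_lin (nz i)); apply: dist; rewrite eq_sym.
  move=> j; rewrite mem_filter mem_others => /andP[/asboolP nj j0].
  by have := hp j j0; rewrite formM; case: (prime_lin (nz j)) => _ _ pr /pr[].
have DP : DM (P * t.1, P * t.2).
  apply/DMP => j j0; rewrite formM.
  have [/divsMl//|nd] := EM (divs (lin (al j)) (form f0 j t)).
  apply: divsMr; rewrite /P (bigD1_seq j) ?filter_uniq ?uniq_others //=.
    exact/divsMr/divs_refl.
  by rewrite mem_filter mem_others j0 andbT; apply/asboolP.
have [c' cE] : divs P c by apply: badP; rewrite -thE.
have [e' eE] : divs P e by apply: badP; rewrite -xE.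
have c'0 : c' != 0 by apply: contraNneq c0 => z; rewrite cE z mul0r.
(* The pair [P * t] is tangent and nonzero, so it reaches degree [d]; its cofactor in [th] must
   therefore be constant. *)
have [g gE] : exists g : F, c' = g%:MP.
  have n0 : ((P * t.1, P * t.2) : S * S) != 0.
    apply: contraNneq th0 => z.
    have z1 : P * t.1 = 0 := congr1 fst z; have z2 : P * t.2 = 0 := congr1 snd z.
    by rewrite thE cE -!mulrA z1 z2 !mulr0.
  exists c'@_0%MM; apply: msize1_polyC.
  have sz (q r : S) : q \is d.-homog -> q = c' * r -> (d < msize r)%N -> (msize c' <= 1)%N.
    move=> hq qE lt; have r0 : r != 0 by apply: contraTneq lt => ->; rewrite msize0.
    have : (msize q <= d.+1)%N.
      rewrite msizeE; apply/bigmax_leqP_seq => mu /(dhomog_mf hq) /= -> _; exact: ltnSn.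
    rewrite qE msizeM //; move: lt; move: (msize r) (msize c') => *; lia.
  case: (DM_msize DP n0) => /=.
    by apply: sz hh1 _; rewrite {1}thE cE mulrA.
  by apply: sz hh2 _; rewrite {1}thE cE mulrA.
have g0 : g != 0 by apply: contraNneq c'0 => z; rewrite gE z mpolyC0.
exists (e' * (g^-1)%:MP); rewrite thE xE eE cE gE /=.
have E : g^-1%:MP * g%:MP = 1 :> S by rewrite -mpolyCM mulVf.
by congr (_, _); rewrite -!mulrA [X in _ = _ * X]mulrA E mul1r.
Qed.

Definition sec_ideal (p : S) := exists2 de, DM de & wedge th de = p * Q0.

Lemma sec_ideal_ideal : ideal sec_ideal.
Proof.
have [d0 dL] := DD_subspace f0 m.+1.
split.
- by exists 0 => //; rewrite /wedge !mulr0 subr0 mul0r.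
- move=> p q [x hx px] [y hy qy]; exists (x + y).
    exact: (subspaceD (DD_subspace f0 m.+1)).
  by have := wedge_linear th 1 x y; rewrite !scale1r => ->; rewrite px qy mulrDl.
- move=> p q [x hx px]; exists (p * x.1, p * x.2); first exact: DDM.
  by rewrite -mulrA -px /wedge /=; ring.
Qed.

(** Koszul argument: ['X_j * D i - 'X_i * D j] is killed by [wedge th], hence a multiple of [th].
    The syzygy between these multiples allows [D o0] and [D o1] to be corrected by multiples of [th]
    until they are ['X_o0] and ['X_o1] times one pair, which realizes [p]. *)
Lemma sec_ideal_saturated : saturated sec_ideal.
Proof.
have [hD _] := hth; have [d0 dL] := DD_subspace f0 m.+1.
have linX i : lin (delta_mx 0 i) = 'X_i :> S.
  rewrite /lin (bigD1 i) //= mxE !eqxx scale1r big1 ?addr0 // => j ji.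
  by rewrite mxE (negbTE ji) scale0r.
have delta0 i : delta_mx 0 i != 0 :> 'rV[F]_3.
  apply/eqP => /rowP/(_ i); rewrite !mxE !eqxx => /eqP; exact/negP/oner_neq0.
have delta_indep i j c : i != j -> delta_mx 0 j <> c *: delta_mx 0 i :> 'rV[F]_3.
  move=> ij /rowP/(_ j); rewrite !mxE !eqxx eq_sym (negbTE ij) mulr0 => /eqP.
  exact/negP/oner_neq0.
have primeX i : prime_elt ('X_i : S) by rewrite -linX; apply: prime_lin.
have Xn0 i : 'X_i != 0 :> S by case: (primeX i).
have ndX i j : i != j -> ~ divs ('X_i : S) 'X_j.
  by move=> ij; rewrite -!linX => /(divs_lin_lin (delta0 i))[c]; apply: delta_indep.
move=> p hp; have /choice[D] i : exists x, DM x /\ wedge th x = 'X_i * p * Q0.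
  by case: (hp i) => x; exists x.
move=> DE.
have koszul i j : exists c, ('X_j * (D i).1 - 'X_i * (D j).1 = c * th.1) /\
     ('X_j * (D i).2 - 'X_i * (D j).2 = c * th.2).
  have [[Di wi] [Dj wj]] := (DE i, DE j).
  have [||c E] := @wedge_ker ('X_j * (D i).1 - 'X_i * (D j).1, 'X_j * (D i).2 - 'X_i * (D j).2).
  - apply: (subspaceB (DD_subspace f0 m.+1) (x := ('X_j * (D i).1, 'X_j * (D i).2))
      (y := ('X_i * (D j).1, 'X_i * (D j).2))); exact: DDM.
  - transitivity ('X_j * wedge th (D i) - 'X_i * wedge th (D j)); first by rewrite /wedge /=; ring.
    by rewrite wi wj; ring.
  by exists c; split; [exact: (congr1 fst E) | exact: (congr1 snd E)].
pose o0 : 'I_3 := ord0; pose o1 : 'I_3 := inord 1; pose o2 : 'I_3 := inord 2.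
have n01 : o0 != o1 by rewrite -val_eqE /= inordK.
have n02 : o0 != o2 by rewrite -val_eqE /= inordK.
have n12 : o1 != o2 by rewrite -val_eqE /= !inordK.
have [c2 [c21 c22]] := koszul o0 o1.
have [c0 [c01 c02]] := koszul o1 o2.
have [c1 [c11 c12]] := koszul o2 o0.
have rel : 'X_o2 * c2 + 'X_o0 * c0 + 'X_o1 * c1 = 0.
  have r1 : ('X_o2 * c2 + 'X_o0 * c0 + 'X_o1 * c1) * th.1 = 0.
    by rewrite !mulrDl -!mulrA -c21 -c01 -c11; ring.
  have r2 : ('X_o2 * c2 + 'X_o0 * c0 + 'X_o1 * c1) * th.2 = 0.
    by rewrite !mulrDl -!mulrA -c22 -c02 -c12; ring.
  apply/eqP; move/eqP: r1; rewrite mulf_eq0 => /orP[//|/eqP t1].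
  move/eqP: r2; rewrite mulf_eq0 => /orP[//|/eqP t2].
  by case/eqP: th0; rewrite [th]surjective_pairing t1 t2.
(* Setting the first variable to 0 in [rel] leaves a two-term relation, from which ['X_o1] divides
   [pr c2]. *)
have [s [t stE]] : exists s t, c2 = 'X_o1 * s - 'X_o0 * t.
  have dd : dot (delta_mx 0 o0) (delta_mx 0 o0) = 1 :> F.
    rewrite /dot (bigD1 o0) //= !mxE !eqxx mulr1 big1 ?addr0 // => j j0.
    by rewrite mxE (negbTE j0) mul0r.
  pose pr := @proj_subst F (delta_mx 0 o0) (delta_mx 0 o0).
  have [t tE] : divs 'X_o0 (c2 - pr c2) by rewrite -linX; apply: divs_sub_subst.
  have prM (q r : S) : pr (q * r) = pr q * pr r by rewrite /pr /proj_subst rmorphM.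
  have prX i : i != o0 -> pr 'X_i = 'X_i.
    move=> i0; rewrite /pr /proj_subst comp_mpolyXU -tnth_nth tnth_mktuple.
    by rewrite mxE (negbTE i0) scale0r subr0.
  have pr0 : pr 'X_o0 = 0 by rewrite -linX; apply: proj_subst_lin.
  have : pr ('X_o2 * c2 + 'X_o0 * c0 + 'X_o1 * c1) = 0 by rewrite rel /pr /proj_subst rmorph0.
  rewrite {1}/pr /proj_subst 2!rmorphD /= -!/(proj_subst _ _ _) -!/(pr _) !prM.
  rewrite pr0 mul0r addr0 !prX 1?eq_sym // => /eqP; rewrite addr_eq0 => /eqP E.
  have [_ _ pX1] := primeX o1.
  have /pX1[/(ndX _ _ n12)//|[s sE]] : divs 'X_o1 ('X_o2 * pr c2).
    by exists (- pr c1); rewrite E mulNr mulrC.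
  by exists s, (- t); rewrite -[c2](subrK (pr c2)) tE sE; ring.
have e1 : 'X_o1 * ((D o0).1 - s * th.1) = 'X_o0 * ((D o1).1 - t * th.1).
  apply/eqP; rewrite -subr_eq0; apply/eqP.
  transitivity ('X_o1 * (D o0).1 - 'X_o0 * (D o1).1 - ('X_o1 * s - 'X_o0 * t) * th.1); first ring.
  by rewrite -stE c21 subrr.
have e2 : 'X_o1 * ((D o0).2 - s * th.2) = 'X_o0 * ((D o1).2 - t * th.2).
  apply/eqP; rewrite -subr_eq0; apply/eqP.
  transitivity ('X_o1 * (D o0).2 - 'X_o0 * (D o1).2 - ('X_o1 * s - 'X_o0 * t) * th.2); first ring.
  by rewrite -stE c22 subrr.
have quot (a b : S) : 'X_o1 * a = 'X_o0 * b -> exists q : S, a = 'X_o0 * q /\ b = 'X_o1 * q.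
  move=> E; have [_ _ pX0] := primeX o0.
  have /pX0[/(ndX _ _ n01)//|[q qE]] : divs 'X_o0 ('X_o1 * a) by exists b; rewrite E mulrC.
  exists q; rewrite qE mulrC; split=> //; apply: (mulfI (Xn0 o0)); rewrite -E qE; ring.
have [q1 [a1 b1]] := quot _ _ e1; have [q2 [a2 b2]] := quot _ _ e2.
have D0 : DM ('X_o0 * q1, 'X_o0 * q2).
  rewrite -a1 -a2; apply: (subspaceB (DD_subspace f0 m.+1) (x := ((D o0).1, (D o0).2))
      (y := (s * th.1, s * th.2))); last exact: DDM.
  by rewrite -surjective_pairing; case: (DE o0).
have D1 : DM ('X_o1 * q1, 'X_o1 * q2).
  rewrite -b1 -b2; apply: (subspaceB (DD_subspace f0 m.+1) (x := ((D o1).1, (D o1).2))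
      (y := (t * th.1, t * th.2))); last exact: DDM.
  by rewrite -surjective_pairing; case: (DE o1).
exists (q1, q2).
  (* No [al j] is proportional to two different variables, so tangency survives the division by one
     of them. *)
  apply/DMP => j j0; have [_ _ pj] := prime_lin (nz j).
  have := (DMP _).1 D0 j j0; rewrite (formM f0 j _ (q1, q2)) => /pj[|//] dj0.
  have := (DMP _).1 D1 j j0; rewrite (formM f0 j _ (q1, q2)) => /pj[|//] dj1.
  exfalso; move: dj0 dj1; rewrite -!linX => /(divs_lin_lin (nz j))[x xE] /(divs_lin_lin (nz j))[y yE].
  have x0 : x != 0 by apply: contraTneq (delta0 o0) => z; rewrite xE z scale0r eqxx.
  apply: (delta_indep o0 o1 (y / x) n01).
  by rewrite yE xE scalerA divfK.
apply: (mulfI (Xn0 o0)).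
transitivity (wedge th ('X_o0 * q1, 'X_o0 * q2)); first by rewrite /wedge /=; ring.
transitivity (wedge th (D o0)); first by rewrite -a1 -a2 /wedge /=; ring.
by case: (DE o0) => _ ->; rewrite mulrA.
Qed.

Lemma wedge_pihomog k x : wedge th (pihomog mdeg k x.1, pihomog mdeg k x.2) =
  pihomog mdeg (k + d) (wedge th x).
Proof.
have [_ [h1 h2]] := hth; rewrite /wedge linearB /= mulrC (mulrC th.2).
by rewrite (mulrC th.1 x.2) (mulrC th.2 x.1) !(pihomogMr _ _ h1, pihomogMr _ _ h2) leq_addl addnK.
Qed.

Lemma sec_ideal_realize k j p : (k + d = j + m)%N -> p \is j.-homog -> sec_ideal p ->
  exists2 x, DDh f0 m.+1 k x & wedge th x = p * Q0.
Proof.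
move=> kd hp [x hx xE]; exists (pihomog mdeg k x.1, pihomog mdeg k x.2).
  by split; [exact: DM_pihomog | split; apply: pihomogP].
by rewrite wedge_pihomog xE kd pihomog_dE //; apply: dhomogM => //; apply: Q0_homog.
Qed.

(** Such a [p] would be realized by a derivation of degree [d.-1], which vanishes by minimality. *)
Lemma sec_ideal_low j p : (j + m).+1 = (d + d)%N -> p \is j.-homog -> sec_ideal p -> p = 0.
Proof.
move=> jm hp Ip; have dpos : (0 < d)%N by lia.
have [|x hx xE] := @sec_ideal_realize d.-1 j p _ hp Ip; first by lia.
have x0 : x = 0 by apply: thmin hx; rewrite prednK.
apply/eqP; move/eqP: xE; rewrite x0 /wedge !mulr0 subr0 eq_sym mulf_eq0.
by rewrite (negbTE Q0_neq0) orbF.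
Qed.

(** Rank-nullity for [wedge th]: by [wedge_ker] the kernel is the forms of degree [k - d] times
    [th], and the image is the degree [j] part of the ideal times [Q0]. *)
Lemma sec_ideal_dim k j D : (d <= k)%N -> (k + d = j + m)%N -> hasdim (DDh f0 m.+1 k) D ->
  exists2 e, hasdim (fun p => p \is j.-homog /\ sec_ideal p) e &
    D = ('C(k - d + 2, k - d) + e)%N.
Proof.
move=> dk kd hD; have [hth1 [h1 h2]] := hth.
have [e he] : exists e, hasdim (fun p => p \is j.-homog /\ sec_ideal p) e.
  by apply: (hasdim_sub _ (hasdim_homog F 2 j)) => p [].
exists e => //.
have Ql : linear (fun p : S => p * Q0) by move=> a x y; rewrite mulrDl scalerAl.
have [I0 ID IM] := sec_ideal_ideal.
have him : hasdim (fun y => exists2 x, DDh f0 m.+1 k x & wedge th x = y) e.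
  apply: (@hasdim_eq _ _ (fun y => exists2 p, (p \is j.-homog /\ sec_ideal p) & p * Q0 = y)).
    move=> y; split=> [[p [hp Ip] <-]|[x [hD' hH] <-]]; first exact: sec_ideal_realize kd hp Ip.
    have [p pE] := wedge_divs hth1 hD'; exists p => //; split; last by exists x.
    have -> : p = pihomog mdeg j p; last exact: pihomogP.
    apply: (mulIf Q0_neq0); rewrite -pE.
    have hw : wedge th x \is (j + m).-homog.
      by rewrite -kd addnC; case: hH => *; apply: rpredB; apply: dhomogM.
    by rewrite -(pihomog_dE hw) pE (pihomogMr _ _ Q0_homog) leq_addl addnK.
  apply: (hasdim_inj Ql) he.
    by move=> p _ /eqP; rewrite mulf_eq0 (negbTE Q0_neq0) orbF => /eqP.
  split=> [|a x y [hx Ix] [hy Iy]]; first by split=> //; apply: dhomog0.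
  split; first by rewrite rpredD ?rpredZ.
  by apply: ID => //; apply: idealZ sec_ideal_ideal Ix.
have [a ha ->] := hasdim_rank_nullity (wedge_linear th) (DDh_subspace f0 m.+1 k) hD him.
congr (_ + _)%N; apply: (hasdim_uniq ha).
have cl : linear (fun c : S => (c * th.1, c * th.2) : S * S).
  by move=> b x y; congr (_, _); rewrite /= mulrDl scalerAl.
apply: (@hasdim_eq _ _ (fun x => exists2 c : S, c \is (k - d).-homog & (c * th.1, c * th.2) = x)).
  move=> x; split=> [[c hc <-]|[[hx [hx1 hx2]] wx]].
    split; last by rewrite /wedge /=; ring.
    split; first exact: DDM.
    by split; rewrite /= -(subnK dk); apply: dhomogM.
  have [c xE] := wedge_ker hx wx; exists (pihomog mdeg (k - d) c); first exact: pihomogP.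
  have e1 : x.1 = c * th.1 by rewrite xE.
  have e2 : x.2 = c * th.2 by rewrite xE.
  have F1 := pihomogMr c k h1; have F2 := pihomogMr c k h2; rewrite dk in F1 F2.
  by rewrite -F1 -F2 -e1 -e2 !pihomog_dE // -surjective_pairing.
apply: (hasdim_inj cl _ (subspace_homog F 3 (k - d)) (hasdim_homog F 2 (k - d))).
move=> c _ E; have E1 : c * th.1 = 0 := congr1 fst E; have E2 : c * th.2 = 0 := congr1 snd E.
apply/eqP; move/eqP: E1; rewrite mulf_eq0 => /orP[//|/eqP t1].
move/eqP: E2; rewrite mulf_eq0 => /orP[//|/eqP t2].
by case/eqP: th0; rewrite [th]surjective_pairing t1 t2.
Qed.

Lemma sec_ideal_codim k j D l : (d <= k)%N -> (k + d = j + m)%N ->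
  hasdim (DDh f0 m.+1 k) D -> ('C(j + 2, j) + 'C(k - d + 2, k - d) <= D + l)%N ->
  codim_le sec_ideal j l.
Proof.
move=> dk kd hD le; have [e [b [bI ib gb]] DE] := sec_ideal_dim dk kd hD.
move=> x hx; pose y i := match split i with inl i => b i | inr i => x i end.
have El i : y (lshift l.+1 i) = b i by rewrite /y (unsplitK (inl i)).
have Er i : y (rshift e i) = x i by rewrite /y (unsplitK (inr i)).
have [||c [[i ci] cE]] := hasdim_dep (x := y) (hasdim_homog F 2 j).
- by move=> i; rewrite /y; case: (split i) => // i'; case: (bI i').
- by lia.
rewrite big_split_ord /= in cE.
exists (fun i => c (rshift e i)); split.
  have [//|/forallNP n] := EM (exists i, c (rshift e i) != 0).
  have cr i' : c (rshift e i') = 0 by apply/eqP/negP => /negP; apply: n.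
  exfalso; move: cE; rewrite [X in _ + X]big1 ?addr0 => [|i' _]; last by rewrite cr scale0r.
  under eq_bigr => i' _ do rewrite El.
  by move/ib => cl; case: (split_ordP i) ci => i' ->; rewrite ?cl ?cr eqxx.
have -> : \sum_i c (rshift e i) *: x i = - 1 *: \sum_i c (lshift l.+1 i) *: b i.
  rewrite scaleN1r; apply/eqP; rewrite -addr_eq0 addrC -[X in _ == X]cE; apply/eqP.
  by congr (_ + _); apply: eq_bigr => i' _; rewrite ?El ?Er.
apply: idealZ; first exact: sec_ideal_ideal.
apply: ideal_sum; first exact: sec_ideal_ideal.
move=> i' _; apply: idealZ; first exact: sec_ideal_ideal.
by case: (bI i').
Qed.

Lemma bin_add2 n : (2 * 'C(n + 2, n) = (n + 2) * (n + 1))%N.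
Proof.
have -> : 'C(n + 2, n) = 'C(n + 2, 2) by rewrite -(bin_sub (leq_addl n 2)) addnK.
have := bin_ffact (n + 2) 2; rewrite mulnC => ->.
by rewrite addn2 addn1 ffactnS ffactn1.
Qed.

(** Source of the colength formula: for [c = k - d], [p = d - d1], [q = d - d2] and [d1 + d2 = m],
    the degree [j] equals [c + p + q], and the excess [p * q] is the colength. *)
Lemma bin_add2_exchange c p q : ('C(c + p + q + 2, c + p + q) + 'C(c + 2, c) =
  'C(c + p + 2, c + p) + 'C(c + q + 2, c + q) + p * q)%N.
Proof.
have := bin_add2 (c + p + q); have := bin_add2 c.
have := bin_add2 (c + p); have := bin_add2 (c + q).
move: 'C(_, _) 'C(_, _) 'C(_, _) 'C(_, _) => x y z t; nia.
Qed.

(* The dimensions are those of a free module with exponents [d1], [d2]. *)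
Lemma sec_ideal_unit d1 d2 k0 : (d1 + d2 = m)%N -> (d1 <= d2)%N -> (d1 <= d)%N ->
  (forall k, (k0 <= k)%N ->
    hasdim (DDh f0 m.+1 k) ('C(k - d1 + 2, k - d1) + 'C(k - d2 + 2, k - d2))) ->
  sec_ideal 1.
Proof.
move=> d12 le12 led1 hdim.
have cod l : ((d - d1) * (d - d2) <= l)%N -> forall j, codim_le sec_ideal j l.
  move=> ll; apply: (saturated_codim (k0 := (k0 + m + m + d + d)%N)) sec_ideal_ideal
    sec_ideal_saturated _ => j jk.
  have hk : (k0 <= j + m - d)%N by lia.
  apply: (sec_ideal_codim _ _ (hdim _ hk)); last first.
  (* For [d <= d2] the claimed bound is truncated to 0; it holds because the exact value is minus
     [(d - d1) * (d2 - d)]. *)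
  - have [le2|/ltnW gt2] := leqP d2 d.
      have := bin_add2_exchange (j + m - d - d) (d - d1) (d - d2).
      have -> : (j + m - d - d + (d - d1) + (d - d2) = j)%N by lia.
      have -> : (j + m - d - d + (d - d1) = j + m - d - d1)%N by lia.
      have -> : (j + m - d - d + (d - d2) = j + m - d - d2)%N by lia.
      by move: ll; move: ((d - d1) * (d - d2))%N 'C(_, _) 'C(_, _) 'C(_, _) 'C(_, _) => *; lia.
    have := bin_add2_exchange (j + m - d - d2) (d - d1) (d2 - d).
    have -> : (j + m - d - d2 + (d - d1) + (d2 - d) = j + m - d - d1)%N by lia.
    have -> : (j + m - d - d2 + (d - d1) = j)%N by lia.
    have -> : (j + m - d - d2 + (d2 - d) = j + m - d - d)%N by lia.
    by move: ((d - d1) * (d2 - d))%N 'C(_, _) 'C(_, _) 'C(_, _) 'C(_, _) => *; lia.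
  - by lia.
  - by lia.
have u0 : codim_le sec_ideal 0 0 -> sec_ideal 1.
  move=> c00; have [c [[i ci] cI]] := c00 (fun=> 1) (fun=> dhomog1 _ _).
  rewrite big_ord1 in cI; rewrite ord1 in ci.
  have -> : 1 = (c ord0)^-1 *: (c ord0 *: 1) :> S by rewrite scalerA mulVf // scale1r.
  by apply: idealZ cI; apply: sec_ideal_ideal.
have [le2|gt2] := leqP d d2.
  by apply/u0/cod; rewrite (_ : d - d2 = 0)%N ?muln0 //; apply/eqP.
(* In this degree the ideal is 0 by [sec_ideal_low]. With [p = d - d1] and [q = d - d2] one has
   [j.+1 = p + q], and the $(p+q)(p+q+1)/2$ monomials of degree [j] are more than [p * q]. *)
exfalso; pose j := (d + d - m).-1.
have := cod _ (leqnn _) j.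
have [b [bh ib _]] := hasdim_homog F 2 j.
have lt : ((d - d1) * (d - d2) < 'C(j + 2, j))%N.
  have := bin_add2 j; have : (j.+1 = (d - d1) + (d - d2))%N by rewrite /j; lia.
  move: 'C(_, _) (d - d1)%N (d - d2)%N => x y z; nia.
move=> /(_ (fun i => b (widen_ord lt i)) (fun i => bh _))[c [[i ci] cI]].
have z : \sum_i c i *: b (widen_ord lt i) = 0.
  apply: (@sec_ideal_low j); rewrite ?/j //; first by lia.
  by apply: rpred_sum => i' _; apply: rpredZ; apply: bh.
by rewrite (indep_widen ib z) eqxx in ci.
Qed.

(* For [d < d1] the colength of the ideal would be [(d1 - d) * (d2 - d) > 0]. *)
Lemma sec_ideal_degree d1 d2 k0 : (d1 + d2 = m)%N -> (d1 <= d2)%N ->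
  (forall k, (k0 <= k)%N ->
    hasdim (DDh f0 m.+1 k) ('C(k - d1 + 2, k - d1) + 'C(k - d2 + 2, k - d2))) ->
  sec_ideal 1 -> (d1 <= d)%N.
Proof.
move=> d12 le12 hdim I1; rewrite leqNgt; apply/negP => lt.
pose j := (k0 + m)%N; pose k := (j + m - d)%N.
have dk : (d <= k)%N by rewrite /k /j; lia.
have kd : (k + d = j + m)%N by rewrite /k /j; lia.
have hk : (k0 <= k)%N by rewrite /k /j; lia.
have [e he De] := sec_ideal_dim dk kd (hdim k hk).
have eE : e = 'C(j + 2, j).
  apply: hasdim_uniq he (hasdim_eq _ (hasdim_homog F 2 j)) => p; split=> [hp|[]//].
  by split=> //; have [_ _ IM] := sec_ideal_ideal; rewrite -[p]mulr1; apply: IM.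
have := bin_add2_exchange j (d1 - d) (d2 - d).
have -> : (j + (d1 - d) + (d2 - d) = k - d)%N by rewrite /k; lia.
have -> : (j + (d1 - d) = k - d2)%N by rewrite /k; lia.
have -> : (j + (d2 - d) = k - d1)%N by rewrite /k; lia.
have : (0 < (d1 - d) * (d2 - d))%N by rewrite muln_gt0 !subn_gt0 lt (leq_trans lt le12).
move: De; rewrite eE -/k.
move: ((d1 - d) * (d2 - d))%N 'C(_, _) 'C(_, _) 'C(_, _) 'C(_, _) => *; lia.
Qed.

End Theta.
End SectionIdeal.

(** * Freeness and the ideal of determinants *)

Definition i1 : 'I_3 := lift ord0 ord0.
Definition i2 : 'I_3 := lift ord0 (lift ord0 ord0).

Lemma scale_rowE (K : pzRingType) n (c : K) (v : 'rV[K]_n) k : (c *: v) 0 k = c * v 0 k.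
Proof. by rewrite mxE. Qed.

Lemma add_rowE (K : nmodType) n (v w : 'rV[K]_n) k : (v + w) 0 k = v 0 k + w 0 k.
Proof. by rewrite mxE. Qed.

Lemma sum3 (V : nmodType) (G : 'I_3 -> V) : \sum_i G i = G ord0 + G i1 + G i2.
Proof. by rewrite !big_ord_recl big_ord0 addr0 addrA. Qed.

Lemma ord3P (P : 'I_3 -> Prop) : P ord0 -> P i1 -> P i2 -> forall i, P i.
Proof.
by move=> h0 h1 h2 [[|[|[|//]]] lt]; [move: h0|move: h1|move: h2];
  congr (P _); apply: val_inj.
Qed.

Lemma det3 (R : comPzRingType) (M : 'M[R]_3) : \det M =
  M ord0 ord0 * (M i1 i1 * M i2 i2 - M i1 i2 * M i2 i1)
  - M ord0 i1 * (M i1 ord0 * M i2 i2 - M i1 i2 * M i2 ord0)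
  + M ord0 i2 * (M i1 ord0 * M i2 i1 - M i1 i1 * M i2 ord0).
Proof.
pose f (i : nat) (j : nat) := M (inord i) (inord j).
have ME i j : M i j = f i j by rewrite /f !inord_val.
rewrite (expand_det_row _ ord0) !big_ord_recl big_ord0 /cofactor.
rewrite !(expand_det_row _ ord0) !big_ord_recl !big_ord0 /cofactor !det_mx11 !mxE !ME /=.
by rewrite /bump /= !addn0 !add0n !addn1; ring.
Qed.

Lemma prime_prod_unit (R : idomainType) (I : eqType) (l : seq I) (G : I -> R) (b s : R) :
  (forall i, i \in l -> prime_elt (G i) /\ ~ divs (G i) b) ->
  b * s = \prod_(i <- l) G i -> b \is a GRing.unit.
Proof.
elim: l s => [|i l IH] s h; first by rewrite big_nil => E; apply/unitrPr; exists s.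
have [[g0 _ pg] nb] := h i (mem_head _ _).
rewrite big_cons => E.
have /pg[//|[s' sE]] : divs (G i) (b * s) by rewrite E; apply/divsMr/divs_refl.
apply: (IH s') => [j jl|]; first by apply: h; rewrite inE jl orbT.
by apply: (mulfI g0); rewrite -E sE; ring.
Qed.

Lemma mpoly_const0 (F : comNzRingType) n (p : {mpoly F[n]}) : p@_0%MM = 0 ->
  exists r : 'I_n -> {mpoly F[n]}, p = \sum_i 'X_i * r i.
Proof.
move=> p0.
pose Q (q : {mpoly F[n]}) := exists r : 'I_n -> {mpoly F[n]}, q = \sum_i 'X_i * r i.
have QD q1 q2 : Q q1 -> Q q2 -> Q (q1 + q2).
  move=> [r1 ->] [r2 ->]; exists (fun i => r1 i + r2 i); rewrite -big_split.
  by apply: eq_bigr => i _; rewrite mulrDr.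
rewrite [p]mpolyE; rewrite big_seq.
apply: (big_ind Q) => //; first by exists (fun=> 0); rewrite big1 // => i _; rewrite mulr0.
move=> mu mup.
have mu0 : mu != 0%MM by apply: contraTneq mup => ->; rewrite mcoeff_msupp p0 eqxx.
have [i mi] : exists i, (0 < mu i)%N.
  apply/existsP; apply: contraNT mu0 => /existsPn h; apply/eqP/mnmP => i.
  by rewrite mnmE; apply/eqP; rewrite -leqn0 leqNgt h.
exists (fun j => if j == i then p@_mu *: 'X_[(mu - U_(i))%MM] else 0).
rewrite (bigD1 i) //= eqxx big1 ?addr0 => [|j ji]; last by rewrite (negbTE ji) mulr0.
rewrite -scalerAr -mpolyXD addmC submK //.
by apply/mnm_lepP => j; rewrite mnm1E; case: eqP => // <-.
Qed.

Section Freeness.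
Variables (R : realType) (m : nat).
Local Notation F := (R[i]).
Local Notation S := {mpoly F[3]}.
Variable A : 'M[F]_(m.+1, 3).
Local Notation al j := (row j A).
Hypothesis nz : forall i, al i != 0.
Hypothesis dist : forall i j, i != j -> ~ exists c, al i = c *: al j.
Variable f0 : frame (al ord0).
Local Notation DM := (DD f0 m.+1).

Lemma alphaE j : alpha A j = lin (al j).
Proof. by apply: eq_bigr => k _; rewrite mxE. Qed.

Definition app j (de : 'rV[S]_3) : S := \sum_(k < 3) de 0 k * (A j k)%:MP.

Lemma der_applyE j de : der_apply de (alpha A j) = app j de.
Proof.
apply: eq_bigr => k _; congr (_ * _); rewrite /alpha linear_sum /=.
rewrite (bigD1 k) //= big1 ?addr0 => [|i ik].
  by rewrite linearZ /= mderivX mnm1E eqxx -[X in (X - _)%MM]add0m addmK mpolyX0 scale1r -mul_mpolyC mulr1.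
by rewrite linearZ /= mderivX mnm1E (negbTE ik) scale0r scaler0.
Qed.

Lemma in_DAP de : in_DA A de <-> forall j, divs (lin (al j)) (app j de).
Proof. by split=> h j; have := h j; rewrite der_applyE alphaE. Qed.

(* The rows are the Euler derivation and the two derivations [d_P], [d_N] of [frame]. *)
Definition eulerG : 'M[S]_3 := \matrix_(i, k)
  if i == ord0 then 'X_k else if i == i1 then (fP f0 0 k)%:MP else (fN f0 0 k)%:MP.

Lemma app_eulerG j (r : 'rV[S]_3) :
  app j (r *m eulerG) = r 0 ord0 * lin (al j) + form f0 j (r 0 i1, r 0 i2).
Proof.
rewrite /app /lin /form /uA /vA /dot /= !sum3 !mxE !sum3 !mxE /=.
rewrite -!mul_mpolyC !mpolyCD !mpolyCM; ring.
Qed.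

Definition DMr (r : 'rV[S]_3) := DM (r 0 i1, r 0 i2).

Lemma form0 x : form f0 ord0 x = 0.
Proof. by rewrite /form /uA /vA faP faN !scale0r addr0. Qed.

Lemma in_DA_eulerG r : in_DA A (r *m eulerG) <-> DMr r.
Proof.
rewrite in_DAP /DMr; rewrite (DMP f0); split=> [h j j0|h j].
  have := h j; rewrite app_eulerG => hj.
  by rewrite -[form _ _ _](addKr (r 0 ord0 * lin (al j))) addrC; apply: divsB => //;
    apply/divsMl/divs_refl.
rewrite app_eulerG; apply: divsD; first exact/divsMl/divs_refl.
by have [->|/h//] := eqVneq j ord0; rewrite form0; apply: divs0.
Qed.

(** Subtracting [q] times the Euler derivation makes [de] kill [al ord0]; the remainder is expanded
    by the dual covectors [fs], [ft]. *)
Lemma eulerG_coord de : in_DA A de -> exists r, de = r *m eulerG.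
Proof.
move=> /in_DAP/(_ ord0)[q qE].
pose c (v : 'rV[F]_3) : S := \sum_k (de 0 k - q * 'X_k) * (v 0 k)%:MP.
exists (\row_k if k == ord0 then q else if k == i1 then c (fs f0) else c (ft f0)).
have c0 : c (al ord0) = 0.
  rewrite /c; under eq_bigr => k _ do rewrite mulrBl.
  rewrite sumrB; apply/eqP; rewrite subr_eq0; apply/eqP.
  transitivity (app ord0 de); first by apply: eq_bigr => k _; rewrite mxE.
  rewrite qE /lin mulr_sumr; apply: eq_bigr => k _.
  by rewrite -mul_mpolyC mulrA mulrAC.
apply/rowP => i; rewrite !mxE sum3 !mxE /=.
have : de 0 i - q * 'X_i = c (fs f0) * (fP f0 0 i)%:MP + c (ft f0) * (fN f0 0 i)%:MP
    + c (al ord0) * (fR f0 0 i)%:MP.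
  rewrite /c !mulr_suml -!big_split /= (bigD1 i) //= big1 ?addr0 => [|k ki].
    have := congr1 (@mpolyC 3 F) (fres f0 i i); rewrite !mpolyCD !mpolyCM eqxx mpolyC1 => E.
    by rewrite -[LHS]mulr1 -E; ring.
  have := congr1 (@mpolyC 3 F) (fres f0 i k); rewrite !mpolyCD !mpolyCM eq_sym (negbTE ki) mpolyC0.
  move=> E; transitivity ((de 0 k - q * 'X_k) * 0); last by rewrite mulr0.
  by rewrite -E; ring.
rewrite c0 mul0r addr0 => /eqP; rewrite subr_eq => /eqP ->; ring.
Qed.

Lemma eulerG_inj (r : 'rV[S]_3) : r *m eulerG = 0 -> r = 0.
Proof.
move=> E; have r0 : r 0 ord0 = 0.
  have := app_eulerG ord0 r; rewrite E form0 addr0 /app big1 => [/esym/eqP|k _].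
    by rewrite mulf_eq0 lin_eq0 (negbTE (nz _)) orbF => /eqP.
  by rewrite mxE mul0r.
have ev (v : 'rV[F]_3) : r 0 i1 * (dot v (fP f0))%:MP + r 0 i2 * (dot v (fN f0))%:MP = 0.
  transitivity (\sum_k (r *m eulerG) 0 k * (v 0 k)%:MP); last first.
    by rewrite E big1 // => k _; rewrite mxE mul0r.
  rewrite /dot !sum3 !mxE !sum3 !mxE /= r0 !mpolyCD !mpolyCM; ring.
apply/rowP; rewrite /=; apply: ord3P; rewrite mxE //.
  by have := ev (fs f0); rewrite fsP fsN mpolyC1 mpolyC0 mulr1 mulr0 addr0.
by have := ev (ft f0); rewrite ftP ftN mpolyC1 mpolyC0 mulr1 mulr0 add0r.
Qed.

Section Theta.
Variables (d : nat) (th : S * S).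
Hypothesis hth : DDh f0 m.+1 d th.
Hypothesis th0 : th != 0.
Hypothesis thmin : forall k x, (k < d)%N -> DDh f0 m.+1 k x -> x = 0.

(** Saito's criterion: a [de] with determinant [Q0] gives the basis Euler, [th], [de]. Coefficients
    come from [wedge_cramer], whose determinants are divisible by [Q0]. *)
Lemma free_of_sec_ideal : sec_ideal f0 th 1 -> arr_free A.
Proof.
have [hD _] := hth.
case=> de hde; rewrite mul1r => wE.
pose b (i : 'I_3) : 'rV[S]_3 := \row_k
  if i == ord0 then (k == ord0)%:R else if i == i1 then (if k == ord0 then 0 else if k == i1 then th.1 else th.2)
  else (if k == ord0 then 0 else if k == i1 then de.1 else de.2).
have sumb (c : 'I_3 -> S) : \sum_i c i *: b i = \row_k
    if k == ord0 then c ord0 else if k == i1 then c i1 * th.1 + c i2 * de.1 else c i1 * th.2 + c i2 * de.2.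
  apply/rowP => k; rewrite sum3. rewrite [LHS]add_rowE [X in X + _]add_rowE.
  rewrite [X in _ + X]scale_rowE. rewrite [X in X + _ + _]scale_rowE.
  rewrite [X in _ + X + _]scale_rowE.
  rewrite [b ord0 0 k]mxE. rewrite [b i1 0 k]mxE. rewrite [b i2 0 k]mxE. rewrite [RHS]mxE.
  by move: k; apply: ord3P; rewrite /= ?mulr0 ?mulr1 ?addr0 ?add0r.
have sumG (c : 'I_3 -> S) : \sum_i c i *: (b i *m eulerG) = (\sum_i c i *: b i) *m eulerG.
  by rewrite mulmx_suml; apply: eq_bigr => i _; rewrite scalemxAl.
exists 3, (fun i => b i *m eulerG); split.
- apply: ord3P; apply/in_DA_eulerG; rewrite /DMr !mxE /= -?surjective_pairing //.
  by case: (DD_subspace f0 m.+1).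
- move=> c; rewrite sumG => /eulerG_inj; rewrite sumb => /rowP E.
  have c0 : c ord0 = 0 by have := E ord0; rewrite !mxE.
  have E1 : c i1 * th.1 + c i2 * de.1 = 0 by have := E i1; rewrite !mxE.
  have E2 : c i1 * th.2 + c i2 * de.2 = 0 by have := E i2; rewrite !mxE.
  have cQ (x : S) : x * Q0 A = 0 -> x = 0.
    by move/eqP; rewrite mulf_eq0 (negbTE (Q0_neq0 nz)) orbF => /eqP.
  apply: ord3P => //; apply: cQ; rewrite -wE /wedge.
    transitivity ((c i1 * th.1 + c i2 * de.1) * de.2 - (c i1 * th.2 + c i2 * de.2) * de.1); first ring.
    by rewrite E1 E2 !mul0r subr0.
  transitivity ((c i1 * th.2 + c i2 * de.2) * th.1 - (c i1 * th.1 + c i2 * de.1) * th.2); first ring.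
  by rewrite E1 E2 !mul0r subr0.
- move=> delta hdelta; have [r rE] := eulerG_coord hdelta.
  rewrite rE in hdelta *; move/in_DA_eulerG: hdelta => hx.
  set x := (r 0 i1, r 0 i2) in hx.
  have [a aE] := wedge_divs nz dist hx hde.
  have [e eE] := wedge_divs nz dist hD hx.
  have xE := wedge_cramer th de x; rewrite wE aE eE in xE.
  have x1 : r 0 i1 = a * th.1 + e * de.1.
    by apply: (mulfI (Q0_neq0 nz)); rewrite [LHS](congr1 fst xE) /=; ring.
  have x2 : r 0 i2 = a * th.2 + e * de.2.
    by apply: (mulfI (Q0_neq0 nz)); rewrite [LHS](congr1 snd xE) /=; ring.
  exists (fun i => if i == ord0 then r 0 ord0 else if i == i1 then a else e).
  rewrite sumG sumb; congr (_ *m _); apply/rowP => k; rewrite [RHS]mxE.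
  by move: k; apply: ord3P; [| exact: x1 | exact: x2].
Qed.

Lemma DMr_comb n (c : 'rV[S]_n) (M : 'M[S]_(n, 3)) : (forall i, DMr (row i M)) -> DMr (c *m M).
Proof.
move=> h; apply/DMP => j j0.
have -> : form f0 j ((c *m M) 0 i1, (c *m M) 0 i2) = \sum_i c 0 i * form f0 j (M i i1, M i i2).
  rewrite /form ![(c *m M) 0 _]mxE !scaler_sumr -big_split; apply: eq_bigr => i _.
  by rewrite mulrDr !scalerAr.
by apply: divs_sum => i _; apply: divsMl; have /DMP/(_ j j0) := h i; rewrite ![row i M 0 _]mxE.
Qed.

Lemma DMr_diag (r : 'rV[S]_3) (P : S) (x y : F) : r 0 i1 = P * x%:MP -> r 0 i2 = P * y%:MP ->
  (forall j, j != ord0 -> uA f0 j * x + vA f0 j * y = 0 \/ divs (lin (al j)) P) -> DMr r.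
Proof.
move=> r1 r2 h; apply/DMP => j j0; rewrite r1 r2 (formM f0 j _ (x%:MP, y%:MP)).
case: (h j j0) => [E|dP]; last exact: divsMr.
apply: divsMl; rewrite /form /= -!mul_mpolyC -!mpolyCM -mpolyCD E mpolyC0; exact: divs0.
Qed.

Lemma X_homog i : ('X_i : S) \is 1.-homog.
Proof. by rewrite dhomogX /= mdeg1. Qed.

Lemma pihomog0_const (p : S) : pihomog mdeg 0 p = (p@_0%MM)%:MP.
Proof.
have [|r rE] := @mpoly_const0 _ _ (p - (p@_0%MM)%:MP).
  by rewrite mcoeffB mcoeffC eqxx mulr1 subrr.
rewrite -{1}[p](subrK (p@_0%MM)%:MP) rE linearD linear_sum /= big1 ?add0r => [|i _].
  by rewrite pihomog_dE // -[X in X \is _]mulr1 mul_mpolyC; apply: rpredZ; apply: dhomog1.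
by rewrite mulrC (pihomogMr _ _ (X_homog i)).
Qed.

Section FreeBasis.
Variable M : 'M[S]_3.
Hypothesis DMM : forall i, DMr (row i M).
Hypothesis spanM : forall r, DMr r -> exists c, r = c *m M.

Lemma DMM_pair i : DM (M i i1, M i i2).
Proof. by have := DMM i; rewrite /DMr ![row i M 0 _]mxE. Qed.

Lemma span_mx (E : 'M[S]_3) : (forall i, DMr (row i E)) -> exists W, E = W *m M.
Proof.
move=> h; have /choice[c cE] i := spanM (h i).
exists (\matrix_(i, j) c i 0 j); apply/row_matrixP => i; rewrite row_mul cE; congr (_ *m _).
by apply/rowP => j; rewrite !mxE.
Qed.

(** Test derivations are expanded in the basis. Those built from [Q0] twice show that [b] divides
    [Q0]; omitting [al j] from one of them shows that [b] divides [Q0] without that factor. Hence no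
    [al j] divides [b], and [b] is a unit. *)
Lemma basis_det : exists2 b : S, b@_0%MM != 0 & \det M = b * Q0 A.
Proof.
have [b bE] : divs (Q0 A) (\det M).
  have wd i j : divs (Q0 A) (wedge (M i i1, M i i2) (M j i1, M j i2)).
    exact: (wedge_divs nz dist (DMM_pair i) (DMM_pair j)).
  have -> : \det M = M ord0 ord0 * wedge (M i1 i1, M i1 i2) (M i2 i1, M i2 i2)
     - M i1 ord0 * wedge (M ord0 i1, M ord0 i2) (M i2 i1, M i2 i2)
     + M i2 ord0 * wedge (M ord0 i1, M ord0 i2) (M i1 i1, M i1 i2).
    by rewrite det3 /wedge /=; ring.
  by apply: divsD; [apply: divsB|]; apply: divsMl.
exists b => //.
pose T (x1 y1 x2 y2 : S) : 'M[S]_3 := \matrix_(i, k)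
  if i == ord0 then (k == ord0)%:R else if i == i1 then (if k == ord0 then 0 else if k == i1 then x1 else y1)
  else (if k == ord0 then 0 else if k == i1 then x2 else y2).
have detT x1 y1 x2 y2 : \det (T x1 y1 x2 y2) = x1 * y2 - y1 * x2.
  by rewrite det3 ![T _ _ _ _ _ _]mxE /=; ring.
have testT P1 (x1 y1 : F) P2 (x2 y2 : F) :
    (forall j, j != ord0 -> uA f0 j * x1 + vA f0 j * y1 = 0 \/ divs (lin (al j)) P1) ->
    (forall j, j != ord0 -> uA f0 j * x2 + vA f0 j * y2 = 0 \/ divs (lin (al j)) P2) ->
    exists w, P1 * P2 * (x1 * y2 - y1 * x2)%:MP = w * b * Q0 A.
  move=> h1 h2.
  have [|W WE] := @span_mx (T (P1 * x1%:MP) (P1 * y1%:MP) (P2 * x2%:MP) (P2 * y2%:MP)).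
    have rT i k (X : 'M[S]_3) : row i X 0 k = X i k by rewrite mxE.
    apply: ord3P.
    - apply: (@DMr_diag _ 0 0 0); rewrite ?rT ?[T _ _ _ _ _ _]mxE /= ?mul0r //.
      by move=> j _; left; rewrite !mulr0 addr0.
    - by apply: (DMr_diag _ _ h1); rewrite rT [T _ _ _ _ _ _]mxE.
    - by apply: (DMr_diag _ _ h2); rewrite rT [T _ _ _ _ _ _]mxE.
  exists (\det W); have := congr1 determinant WE; rewrite detT det_mulmx bE => E.
  by rewrite -[RHS]mulrA -E mpolyCB !mpolyCM; ring.
have [w wE] : exists w, b * w = Q0 A.
  have [||w wE] := testT (Q0 A) 1 0 (Q0 A) 0 1; try by move=> j /divs_Q0; right.
  exists w; apply: (mulIf (Q0_neq0 nz)).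
  by move: wE; rewrite mulr1 mul0r subr0 mpolyC1 mulr1 (mulrC w).
have ub : b \is a GRing.unit.
  apply: (prime_prod_unit _ wE) => j; rewrite mem_others => j0; split; first exact/prime_lin/nz.
  move=> jb; pose Pj := \prod_(i <- [seq i <- others m | i != j]) lin (al i).
  have QE : Q0 A = lin (al j) * Pj by rewrite /Q0 (bigD1_seq j) ?uniq_others ?mem_others // /Pj big_filter.
  have [c1 [c2 cE]] : exists c1 c2, uA f0 j * c1 + vA f0 j * c2 = 1.
    case: (uv_neq0 dist f0 j0) => n; first by exists (uA f0 j)^-1, 0; rewrite mulr0 addr0 mulfV.
    by exists 0, (vA f0 j)^-1; rewrite mulr0 add0r mulfV.
  have [||w' w'E] := testT Pj (- vA f0 j) (uA f0 j) (Q0 A) c1 c2.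
  - move=> i i0; have [->|ij] := eqVneq i j; first by left; ring.
    right; apply: (divs_prod_mem (fun i => lin (al i))).
    by rewrite mem_filter ij mem_others.
  - by move=> i /divs_Q0; right.
  have PE : Pj = - w' * b.
    apply: (mulIf (Q0_neq0 nz)); rewrite mulNr mulNr -w'E.
    have -> : - vA f0 j * c2 - uA f0 j * c1 = -1 by rewrite -cE; ring.
    by rewrite mpolyCN mpolyC1; ring.
  have : divs (lin (al j)) Pj by rewrite PE; apply: divsMl.
  rewrite /Pj big_filter => /(prime_divs_prod (prime_lin (nz j)))[i ij].
  by move/(divs_lin_lin (nz j)); apply: dist.
apply/eqP => b0; move/unitrPr: ub => [b' bb'].
have := congr1 (mcoeff 0%MM) bb'; rewrite rmorphM /= b0 mul0r mcoeff1 eqxx => /esym/eqP.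
by rewrite oner_eq0.
Qed.

(** The basis is not assumed homogeneous, so only constant terms of coordinates are compared. Those
    of the Euler derivation and of [th] are independent, hence some row of [M] completes them to a
    determinant with nonzero constant term. The degree [m] part of the resulting [wedge] is a
    nonzero constant times [Q0]. *)
Lemma sec_ideal_of_basis : sec_ideal f0 th 1.
Proof.
have [hD [hh1 hh2]] := hth.
have [b b0 bE] := basis_det.
pose e : 'rV[S]_3 := \row_k (k == ord0)%:R.
pose t : 'rV[S]_3 := \row_k if k == ord0 then 0 else if k == i1 then th.1 else th.2.
have eE0 : e 0 ord0 = 1 by rewrite mxE.
have eE1 : e 0 i1 = 0 by rewrite mxE.
have eE2 : e 0 i2 = 0 by rewrite mxE.
have tE0 : t 0 ord0 = 0 by rewrite mxE.
have tE1 : t 0 i1 = th.1 by rewrite mxE.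
have tE2 : t 0 i2 = th.2 by rewrite mxE.
have [u uE] : exists u, e = u *m M.
  by apply: spanM; rewrite /DMr eE1 eE2; case: (DD_subspace f0 m.+1).
have [v vE] : exists v, t = v *m M.
  by apply: spanM; rewrite /DMr tE1 tE2 -surjective_pairing.
pose u0 i : F := (u 0 i)@_0%MM; pose v0 i : F := (v 0 i)@_0%MM.
(* If the constant terms of [c] vanish, [c *m M] is a sum of variables times elements [eta l] of the
   module. Its Euler coordinate then has no constant term, so [x = 0]; its degree [d] part vanishes
   because the tangent pairs of the [eta l] have none in degree [d - 1], so [y = 0]. *)
have ind (x y : F) : (forall i, x * u0 i + y * v0 i = 0) -> x = 0 /\ y = 0.
  move=> h; pose c : 'rV[S]_3 := x%:MP *: u + y%:MP *: v.
  have cE k : (c *m M) 0 k = x%:MP * e 0 k + y%:MP * t 0 k.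
    by rewrite /c mulmxDl -!scalemxAl -uE -vE add_rowE [X in X + _]scale_rowE [X in _ + X]scale_rowE.
  have /choice[r rE] i : exists r : 'I_3 -> S, c 0 i = \sum_l 'X_l * r l.
    apply: mpoly_const0; rewrite /c add_rowE [X in X + _]scale_rowE [X in _ + X]scale_rowE.
    rewrite mcoeffD !mul_mpolyC !mcoeffZ.
    exact: h.
  pose eta l : 'rV[S]_3 := (\row_i r i l) *m M.
  have etaE k : (c *m M) 0 k = \sum_l 'X_l * eta l 0 k.
    rewrite [LHS]mxE; under eq_bigr => i _ do rewrite rE mulr_suml.
    rewrite exchange_big; apply: eq_bigr => l _; rewrite [eta l 0 k]mxE mulr_sumr.
    by apply: eq_bigr => i _; rewrite [(\row_i0 _) 0 i]mxE mulrA.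
  have Deta l : DMr (eta l) by apply: DMr_comb.
  clearbody eta c.
  have x0 : x = 0.
    have c0E : (c *m M) 0 ord0 = x%:MP by rewrite cE eE0 tE0 mulr1 mulr0 addr0.
    have <- : (x%:MP : S)@_0%MM = x by rewrite mcoeffC eqxx mulr1.
    rewrite -c0E etaE raddf_sum; apply: big1 => l _; rewrite [LHS]rmorphM [X in X * _]mcoeffX.
    rewrite (_ : _ == _ = false) ?mul0r //; apply/negbTE/eqP => /(congr1 (@mdeg 3)).
    by rewrite mdeg1 mdeg0.
  split=> //; apply/eqP/negP => /negP y0.
  have zero k : k != ord0 -> pihomog mdeg d ((c *m M) 0 k) = 0.
    move=> k0; rewrite etaE linear_sum; apply: big1 => l _ /=.
    rewrite mulrC (pihomogMr _ _ (X_homog l)); case: ifP => // d0.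
    have hl : DDh f0 m.+1 (d - 1) (pihomog mdeg (d - 1) (eta l 0 i1), pihomog mdeg (d - 1) (eta l 0 i2)).
      split; last by split; apply: pihomogP.
      by apply: (DM_pihomog _ (x := (eta l 0 i1, eta l 0 i2))); apply: Deta.
    have lt : (d - 1 < d)%N by lia.
    have E := thmin lt hl.
    have e1 : pihomog mdeg (d - 1) (eta l 0 i1) = 0 := congr1 fst E.
    have e2 : pihomog mdeg (d - 1) (eta l 0 i2) = 0 := congr1 snd E.
    by move: k k0; apply: ord3P => // _; rewrite ?e1 ?e2 mul0r.
  have zt k : k != ord0 -> t 0 k = 0.
    move=> k0; have := zero k k0; rewrite cE x0 mpolyC0 mul0r add0r mul_mpolyC linearZ /=.
    rewrite pihomog_dE => [/eqP|]; first by rewrite scaler_eq0 (negbTE y0) => /eqP.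
    by move: k k0; apply: ord3P => //; rewrite ?tE1 ?tE2.
  case/eqP: th0; rewrite [th]surjective_pairing.
  by rewrite -tE1 -tE2 !zt.
pose U i : 'M[S]_3 := \matrix_(a, k) if a == ord0 then u 0 k else if a == i1 then v 0 k else (i == k)%:R.
(* The rows of [U i *m M] are the Euler derivation, [th] and the [i]-th basis element. *)
have wU i : wedge th (M i i1, M i i2) = \det (U i) * b * Q0 A.
  rewrite -mulrA -bE -det_mulmx.
  have -> : U i *m M = \matrix_(a, k) if a == ord0 then e 0 k else if a == i1 then t 0 k else M i k.
    apply/matrixP => a k; rewrite [RHS]mxE uE vE [LHS]mxE.
    case: ifP => a0; first by rewrite [RHS]mxE; apply: eq_bigr => l _; rewrite [U i _ _]mxE a0.
    case: ifP => a1; first by rewrite [RHS]mxE; apply: eq_bigr => l _; rewrite [U i _ _]mxE a0 a1.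
    rewrite (bigD1 i) //= big1 ?addr0 => [|l li]; rewrite [U i _ _]mxE a0 a1 ?eqxx ?mul1r //.
    by rewrite eq_sym (negbTE li) mul0r.
  rewrite det3; set Z := \matrix_(_, _) _.
  have Z0 k : Z ord0 k = e 0 k by rewrite mxE.
  have Z1 k : Z i1 k = t 0 k by rewrite mxE.
  have Z2 k : Z i2 k = M i k by rewrite mxE.
  rewrite !Z0 !Z1 !Z2 eE0 eE1 eE2 tE0 tE1 tE2 {Z Z0 Z1 Z2}.
  by move: (M i i1) (M i i2) (M i ord0) => x y z; rewrite /wedge /=; ring.
have [i ni] : exists i, (\det (U i))@_0%MM != 0.
  have [//|/forallNP h] := EM (exists i, (\det (U i))@_0%MM != 0).
  have minor i : (\det (U i))@_0%MM = 0 by apply/eqP/negP => /negP; apply: h.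
  exfalso.
  have coefE (p q r s : S) :
      p@_0%MM * q@_0%MM - r@_0%MM * s@_0%MM = (p * q - r * s)@_0%MM.
    by rewrite mcoeffB !rmorphM.
  have U0 a k : U a ord0 k = u 0 k by rewrite mxE.
  have U1 a k : U a i1 k = v 0 k by rewrite mxE.
  have U2t a : U a i2 a = 1 by rewrite [LHS]mxE /= eqxx.
  have U2f a k : a != k -> U a i2 k = 0 by move=> ak; rewrite [LHS]mxE /= (negbTE ak).
  have m0 : u0 i1 * v0 i2 - u0 i2 * v0 i1 = 0.
    rewrite -[RHS](minor ord0) coefE det3 !U0 !U1 U2t 2?U2f //; congr (_@_ _); ring.
  have m1 : u0 i2 * v0 ord0 - u0 ord0 * v0 i2 = 0.
    rewrite -[RHS](minor i1) coefE det3 !U0 !U1 U2t 2?U2f //; congr (_@_ _); ring.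
  have m2 : u0 ord0 * v0 i1 - u0 i1 * v0 ord0 = 0.
    rewrite -[RHS](minor i2) coefE det3 !U0 !U1 U2t 2?U2f //; congr (_@_ _); ring.
  (* If all minors vanish, so does the vector [v0 k * u0 - u0 k * v0], and independence gives
     [u0 k = 0]. *)
  have all0 k : u0 k = 0.
    have [|_ /eqP] := ind (v0 k) (- u0 k); last by rewrite oppr_eq0 => /eqP.
    move: m0 m1 m2 => m0 m1 m2; move: k; apply: ord3P; apply: ord3P.
    - ring.
    - by rewrite -[RHS]oppr0 -m2; ring.
    - by rewrite -m1; ring.
    - by rewrite -m2; ring.
    - ring.
    - by rewrite -[RHS]oppr0 -m0; ring.
    - by rewrite -[RHS]oppr0 -m1; ring.
    - by rewrite -m0; ring.
    - ring.
  have [|/eqP] := ind 1 0; last by rewrite oner_eq0.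
  by move=> k; rewrite all0 mulr0 mul0r addr0.
have p0 : (\det (U i) * b)@_0%MM != 0 by rewrite rmorphM mulf_neq0.
have I0 : sec_ideal f0 th ((\det (U i) * b)@_0%MM)%:MP.
  exists (pihomog mdeg (m - d) (M i i1), pihomog mdeg (m - d) (M i i2)).
    exact: (DM_pihomog _ (DMM_pair i)).
  rewrite (wedge_pihomog hth (m - d) (M i i1, M i i2)) subnK ?(DD_degree_le nz thmin) // wU.
  by rewrite (pihomogMr _ _ (Q0_homog A)) leqnn subnn pihomog0_const.
have iI : ideal (sec_ideal f0 th) by apply: sec_ideal_ideal.
have := idealZ ((\det (U i) * b)@_0%MM)^-1 iI I0.
by rewrite -mul_mpolyC -mpolyCM mulVf.
Qed.

End FreeBasis.
End Theta.
End Freeness.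

(** Compare ranks over the fraction field: the factorization of [E] gives [n <= k], that of [Q%:M]
    gives [k <= n]. *)
Lemma square_of_factor (K : idomainType) k n (Q : K) (N M : 'M[K]_(k, n))
    (W : 'M[K]_(n, k)) (E : 'M[K]_n) : Q != 0 -> \det E != 0 ->
  E = W *m M -> Q%:M = N *m W -> k = n.
Proof.
move=> Q0 E0 EE QE; pose f := @tofrac K.
have rE : \rank (map_mx f E) = n.
  apply: mxrank_unit; rewrite unitmxE det_map_mx unitfE tofrac_eq0 //.
have rQ : \rank (map_mx f (Q%:M : 'M_k)) = k.
  apply: mxrank_unit; rewrite unitmxE det_map_mx unitfE tofrac_eq0 det_scalar.
  exact: expf_neq0.
apply/eqP; rewrite eqn_leq; apply/andP; split.
  rewrite -{1}rQ QE map_mxM; apply: leq_trans (mxrankM_maxl _ _) (rank_leq_col _).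
rewrite -{1}rE EE map_mxM; apply: leq_trans (mxrankM_maxl _ _) (rank_leq_col _).
Qed.

Section FreeToUnit.
Variables (R : realType) (m : nat).
Local Notation F := (R[i]).
Local Notation S := {mpoly F[3]}.
Variable A : 'M[F]_(m.+1, 3).
Local Notation al j := (row j A).
Hypothesis nz : forall i, al i != 0.
Hypothesis dist : forall i j, i != j -> ~ exists c, al i = c *: al j.
Variable f0 : frame (al ord0).
Variables (d : nat) (th : S * S).
Hypothesis hth : DDh f0 m.+1 d th.
Hypothesis th0 : th != 0.
Hypothesis thmin : forall k x, (k < d)%N -> DDh f0 m.+1 k x -> x = 0.

(** Freeness leaves the number [k] of basis elements open. Since the diagonal matrix [E] has its
    rows in the module and [Q0] times the module lies in their span, [k] is 3 and
    [sec_ideal_of_basis] applies. *)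
Lemma sec_ideal_of_free : arr_free A -> sec_ideal f0 th 1.
Proof.
move=> [k [b [bD ib gb]]].
have /choice[r rE] i := eulerG_coord f0 (bD i).
have Dr i : DMr f0 (r i) by apply/(in_DA_eulerG f0); rewrite -rE.
pose M : 'M[S]_(k, 3) := \matrix_i r i.
have combE (c : 'I_k -> S) : \sum_i c i *: b i = ((\row_i c i) *m M) *m eulerG f0.
  rewrite [(\row_i c i) *m M]mulmx_sum_row mulmx_suml; apply: eq_bigr => i _.
  by rewrite rowK [(\row_i0 _) 0 i]mxE -scalemxAl -rE.
have indM (c : 'rV[S]_k) : c *m M = 0 -> c = 0.
  move=> c0; apply/rowP => i; rewrite [RHS]mxE; apply: (ib (fun i => c 0 i)).
  rewrite combE (_ : \row_i _ = c) ?c0 ?mul0mx //.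
  by apply/rowP => j; rewrite [LHS]mxE.
have spanM (x : 'rV[S]_3) : DMr f0 x -> exists c, x = c *m M.
  move=> /(in_DA_eulerG f0)/gb[c cE]; exists (\row_i c i).
  apply/eqP; rewrite -subr_eq0; apply/eqP/(eulerG_inj nz (f0 := f0)).
  by rewrite mulmxBl -combE -cE subrr.
pose D : 'rV[S]_3 := \row_j if j == ord0 then 1 else Q0 A.
pose E : 'M[S]_3 := diag_mx D.
have DE0 : D 0 ord0 = 1 by rewrite [LHS]mxE.
have DE1 : D 0 i1 = Q0 A by rewrite [LHS]mxE.
have DE2 : D 0 i2 = Q0 A by rewrite [LHS]mxE.
have rowE i j : row i E 0 j = D 0 i *+ (i == j).
  by rewrite [LHS]mxE [LHS]mxE.
have DMrE i : DMr f0 (row i E).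
  move: i; apply: ord3P.
  - apply: (@DMr_diag _ _ _ f0 _ 0 0 0); rewrite ?rowE ?mul0r //.
    by move=> j _; left; rewrite !mulr0 addr0.
  - apply: (@DMr_diag _ _ _ f0 _ (Q0 A) 1 0); rewrite ?rowE ?DE1 ?mpolyC1 ?mpolyC0 ?mulr1 ?mulr0 //.
    by move=> j /(divs_Q0 A); right.
  - apply: (@DMr_diag _ _ _ f0 _ (Q0 A) 0 1); rewrite ?rowE ?DE2 ?mpolyC1 ?mpolyC0 ?mulr1 ?mulr0 //.
    by move=> j /(divs_Q0 A); right.
have [W WE] : exists W, E = W *m M.
  have /choice[c cE] i := spanM _ (DMrE i).
  exists (\matrix_(i, j) c i 0 j); apply/row_matrixP => i; rewrite row_mul cE; congr (_ *m _).
  by apply/rowP => j; rewrite [RHS]mxE [RHS]mxE.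
pose N : 'M[S]_(k, 3) := \matrix_(i, j) if j == ord0 then Q0 A * M i j else M i j.
have NE : N *m E = Q0 A *: M.
  rewrite mul_mx_diag; apply/matrixP => i j; rewrite [LHS]mxE [RHS]mxE [N i j]mxE.
  by move: j; apply: ord3P; rewrite /= ?DE0 ?DE1 ?DE2 ?mulr1 // mulrC.
have QE : (Q0 A)%:M = N *m W.
  apply/row_matrixP => i; apply/eqP; rewrite -subr_eq0 -linearB /=; apply/eqP/indM.
  by rewrite -row_mul mulmxBl -mulmxA -WE NE mul_scalar_mx subrr row0.
have dE : \det E != 0.
  rewrite det_diag; apply/prodf_neq0 => i _; move: i.
  by apply: ord3P; rewrite ?DE0 ?DE1 ?DE2 ?oner_neq0 ?(Q0_neq0 nz).
have k3 : k = 3 := square_of_factor (Q0_neq0 nz) dE WE QE.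
subst k; apply: (sec_ideal_of_basis nz dist hth th0 thmin (M := M)) => //.
by move=> i; rewrite rowK.
Qed.

End FreeToUnit.

(** * Rank conditions *)

Section Dimension.
Variable F : numFieldType.
Local Notation S := {mpoly F[3]}.
Variables (m : nat) (A : 'M[F]_(m.+1, 3)).
Local Notation al j := (row j A).
Hypothesis nz : forall i, al i != 0.
Hypothesis dist : forall i j, i != j -> ~ exists c, al i = c *: al j.
Variable f0 : frame (al ord0).

(** Starting from two copies of the forms of degree [k], plane [i] lowers the dimension by
    [(k.+1 - i) + npts A i]; [m <= k.+1] makes [DD_step_hasdim] available for every plane. *)
Lemma DDh_total k : (m <= k.+1)%N -> exists2 d, hasdim (DDh f0 m.+1 k) d &
  (d + \sum_(1 <= i < m.+1) (k.+1 - i) + \sum_h npts A h = 2 * 'C(k + 2, k))%N.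
Proof.
move=> mk.
have npts0 : npts A ord0 = 0%N.
  rewrite /npts (_ : [seq j : 'I_m.+1 <- _ | _] = [::]) //.
  by rewrite -(filter_pred0 (enum 'I_m.+1)); apply: eq_filter.
suff main h : (h < m.+1)%N -> exists2 d, hasdim (DDh f0 h.+1 k) d &
    (d + \sum_(1 <= i < h.+1) (k.+1 - i) + \sum_(j < m.+1 | j < h.+1) npts A j
     = 2 * 'C(k + 2, k))%N.
  have [d hd E] := main m (ltnSn m); exists d => //; rewrite -E; congr (_ + _)%N.
  by apply: eq_bigl => j; rewrite ltn_ord.
elim: h => [|h IH] hm.
  exists ('C(k + 2, k) + 'C(k + 2, k))%N.
    have := hasdim_pair (subspace_homog F 3 k) (subspace_homog F 3 k) (hasdim_homog F 2 k)
      (hasdim_homog F 2 k).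
    apply: hasdim_eq => x; split=> [hx|[]//]; split=> // j.
    by rewrite ltnS leqn0 lt0n => /andP[/negP].
  rewrite big_geq // addn0 (big_pred1 ord0) ?npts0 ?addn0 ?addnn ?mul2n // => j.
  by rewrite ltnS leqn0.
have [d hd E] := IH (ltnW hm).
pose H : 'I_m.+1 := Ordinal hm.
have [f gf] : exists f : frame (al H), forall b, b \in [seq al j | j <- enum 'I_m.+1 & j != H] ->
    dot b (fN f) != 0.
  apply: frame_generic (nz H) _ => b /mapP[j]; rewrite mem_filter => /andP[jH _] ->.
  exact: dist.
have generic j : j != H -> dot (al j) (fN f) != 0.
  by move=> jH; apply/gf/map_f; rewrite mem_filter jH mem_enum.
have Hk : (H <= k.+1)%N by rewrite /=; lia.
have [d' hd' dE] := DD_step_hasdim nz dist (f0 := f0) (f := f) isT generic Hk hd.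
exists d' => //; rewrite -E big_nat_recr //= (bigD1 H) //=.
rewrite (eq_bigl (fun j : 'I_m.+1 => (j < h.+1)%N)); last first.
  by move=> j; rewrite -val_eqE /=; lia.
have nE := npts_new_roots (f := f) generic isT.
move: dE; rewrite nE /=.
move: (new_roots f) (\sum_(1 <= i < h.+1) _)%N (\sum_(j < m.+1 | _) _)%N => x y z; lia.
Qed.

Lemma exists_theta : exists d th, [/\ DDh f0 m.+1 d th, th != 0
  & forall k x, (k < d)%N -> DDh f0 m.+1 k x -> x = 0].
Proof.
pose P d := `[< exists2 th, DDh f0 m.+1 d th & th != 0 >].
have exP : exists d, P d.
  by exists m; apply/asboolP; exists (Q0 A, 0); [exact: Q0_DDh | exact: Q0_pair_neq0].
have [d /asboolP[th hth th0] dmin] := ex_minnP exP.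
exists d, th; split=> // k x kd hx; apply/eqP/negP => /negP x0.
have /dmin : P k by apply/asboolP; exists x.
by rewrite leqNgt kd.
Qed.

End Dimension.

(** * Tangency as a linear system and its maximal minors *)

Section Minors.
Variables (F : numFieldType) (m e : nat).
Local Notation S := {mpoly F[3]}.
Local Notation T := {mpoly F[m.+1 * 3]}.
Local Notation col_t := (('I_3 + 'I_m) * 'X_{1..3 < e})%type.
Local Notation row_t := ('I_m.+1 * 'X_{1..3 < e.+1})%type.

(* Coefficient of [A j k] in the coefficient of ['X_[mu]] in
   [\sum_k A j k *: de k - q i * lin (row j A)] (second term only if [j = lift ord0 i])
   as a function of the coefficients of [de] and [q]. *)
Definition ecoef (r : row_t) (c : col_t) (k : 'I_3) : F :=
  match c.1 with
  | inl k' => ((k == k') && (val r.2 == val c.2))%:R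
  | inr i => - ((r.1 == lift ord0 i) && (val r.2 == (val c.2 + U_(k))%MM))%:R
  end.

Definition epoly (r : row_t) (c : col_t) : T :=
  \sum_k ecoef r c k *: 'X_(mxvec_index r.1 k).

(** Rows stand for the unknowns and columns for the equations, so solutions are row vectors in the
    left kernel. *)
Definition emx : 'M[T]_(#|{: col_t}|, #|{: row_t}|) :=
  \matrix_(a, b) epoly (enum_val b) (enum_val a).

Definition minor_poly (f : 'I_#|{: col_t}| -> 'I_#|{: row_t}|) : T := \det (colsub f emx).

Definition hom_at (d : 'I_m.+1 -> nat) (p : T) := forall mu, mu \in msupp p ->
  forall i, (\sum_(j < 3) mu (mxvec_index i j))%N = d i.

Lemma hom_at_sum (I : Type) (r : seq I) (P : pred I) (G : I -> T) d :
  (forall i, P i -> hom_at d (G i)) -> hom_at d (\sum_(i <- r | P i) G i).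
Proof.
move=> h; apply: big_ind => //; first by move=> mu; rewrite msupp0.
by move=> p q hp hq mu /msuppD_le; rewrite mem_cat => /orP[/hp|/hq].
Qed.

Lemma hom_atM d1 d2 p q : hom_at d1 p -> hom_at d2 q -> hom_at (fun i => d1 i + d2 i)%N (p * q).
Proof.
move=> hp hq mu /msuppM_le/allpairsP[[m1 m2] [/= m1p m2q ->]] i.
rewrite -(hp _ m1p i) -(hq _ m2q i) -big_split; apply: eq_bigr => j _.
by rewrite mnmDE.
Qed.

Lemma hom_at_prod (I : Type) (r : seq I) (G : I -> T) (d : I -> 'I_m.+1 -> nat) :
  (forall i, hom_at (d i) (G i)) ->
  hom_at (fun j => \sum_(i <- r) d i j)%N (\prod_(i <- r) G i).
Proof.
move=> h; elim: r => [|i r IH].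
  rewrite big_nil => mu; rewrite msupp1 inE => /eqP-> j; rewrite big_nil.
  by rewrite big1 // => k _; rewrite mnm0E.
rewrite big_cons => mu /(hom_atM (h i) IH) E j; rewrite E big_cons //.
Qed.

Lemma mxvec_index_eq n1 n2 (i i' : 'I_n1) (j j' : 'I_n2) :
  (mxvec_index i j == mxvec_index i' j') = (i == i') && (j == j').
Proof.
rewrite /mxvec_index (inj_eq (@cast_ord_inj _ _ _)) (inj_eq enum_rank_inj).
by rewrite xpair_eqE.
Qed.

Lemma hom_at_epoly r c : hom_at (fun i => i == r.1) (epoly r c).
Proof.
apply: hom_at_sum => k _ mu /msuppZ_le; rewrite msuppX inE => /eqP-> i.
under eq_bigr => j _ do rewrite mnm1E mxvec_index_eq.
rewrite eq_sym; case: eqP => _ /=; last by rewrite big1.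
by rewrite (bigD1 k) //= eqxx big1 // => j jk; rewrite eq_sym (negbTE jk).
Qed.

(** A column belonging to plane [i] is linear in row [i] of the matrix and free of the other rows.
    Each term of the determinant thus has as degree in row [i] the number of chosen equations of
    plane [i]. *)
Lemma hom_at_minor f :
  hom_at (fun i => \sum_b (i == (enum_val (f b)).1))%N (minor_poly f).
Proof.
rewrite /minor_poly /determinant; apply: hom_at_sum => s _.
have h := @hom_at_prod _ (index_enum _) _ _
  (fun a : 'I_#|{: col_t}| => @hom_at_epoly (enum_val (f (s a))) (enum_val a)).
move=> mu mup i; rewrite (reindex_inj (@perm_inj _ s)) /=; apply: h.
have <- : \prod_a colsub f emx a (s a) =
    \prod_(a : 'I_#|{: col_t}|) epoly (enum_val (f (s a))) (enum_val a).
  by apply: eq_bigr => a _; rewrite mxE mxE.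
by move: mup; case: (odd_perm s); rewrite ?expr0 ?expr1 ?mul1r ?mulN1r ?(perm_mem (msuppN _)).
Qed.

Section Kernel.
Variable A : 'M[F]_(m.+1, 3).
Local Notation al j := (row j A).
Local Notation ev := (meval (fun k => mxvec A 0 k)).

Definition residue (de : 'I_3 -> S) (q : 'I_m -> S) (j : 'I_m.+1) : S :=
  \sum_k A j k *: de k - \sum_(i | j == lift ord0 i) q i * lin (al j).

(* The derivation [de] has coefficients of degree below [e], kills the form [row ord0 A],
   and [q i] is the quotient witnessing tangency to the plane [lift ord0 i]. *)
Definition no_kernel := forall de q, (forall k, (msize (de k) <= e)%N) ->
  (forall i, (msize (q i) <= e)%N) -> (forall j, residue de q j = 0) ->
  (forall k, de k = 0) /\ forall i, q i = 0.

Definition poly_of (c : 'X_{1..3 < e} -> F) : S := \sum_nu c nu *: 'X_[val nu].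

Lemma poly_of_coef c nu : (poly_of c)@_(val nu) = c nu.
Proof.
rewrite /poly_of raddf_sum (bigD1 nu) //= mcoeffZ mcoeffX eqxx mulr1 big1 ?addr0 // => x xn.
by rewrite mcoeffZ mcoeffX (inj_eq val_inj) (negbTE xn) mulr0.
Qed.

Lemma msize_poly_of c : (msize (poly_of c) <= e)%N.
Proof.
apply: (leq_trans (msize_sum _ _ _)); apply/bigmax_leqP => nu _.
apply: leq_trans (mmeasureZ_le _ _ _) _; rewrite msizeX; exact: bmdeg.
Qed.

Lemma poly_ofK p : (msize p <= e)%N -> poly_of (fun nu => p@_(val nu)) = p.
Proof. by move=> sp; rewrite [RHS](mpolywE sp). Qed.

Definition edot r c : F := \sum_k ecoef r c k * A r.1 k.

Lemma ev_epoly r c : ev (epoly r c) = edot r c.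
Proof.
rewrite /epoly raddf_sum; apply: eq_bigr => k _ /=.
by rewrite mevalZ mevalXU mxvecE.
Qed.

Lemma residue_coef (de : 'X_{1..3 < e} -> 'I_3 -> F) (q : 'X_{1..3 < e} -> 'I_m -> F) (r : row_t) :
  (residue (fun k => poly_of (de^~ k)) (fun i => poly_of (q^~ i)) r.1)@_(val r.2) =
  \sum_(c : col_t) edot r c * (match c.1 with inl k => de c.2 k | inr i => q c.2 i end).
Proof.
case: r => j mu; pose G (c : col_t) : F := edot (j, mu) c *
  (match c.1 with inl k => de c.2 k | inr i => q c.2 i end).
rewrite -[RHS]/(\sum_c G c) (eq_bigr (fun c => G (c.1, c.2))) => [|[] //].
rewrite -(pair_bigA _ (fun x y => G (x, y))) big_sumType /= /residue mcoeffB.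
congr (_ + _).
  rewrite raddf_sum; apply: eq_bigr => k _ /=; rewrite mcoeffZ /poly_of raddf_sum mulr_sumr.
  apply: eq_bigr => nu _; rewrite /= mcoeffZ mcoeffX /G /edot /= (bigD1 k) //= /ecoef /= eqxx.
  rewrite big1 ?addr0 => [|l lk]; last by rewrite (negbTE lk) mul0r.
  by rewrite eq_sym /=; ring.
rewrite raddf_sum -sumrN big_mkcond; apply: eq_bigr => i _.
rewrite /G /edot /ecoef /=; case: eqP => ji /=; last first.
  rewrite big1 // => nu _; rewrite big1 ?mul0r // => k _; by rewrite oppr0 mul0r.
rewrite /poly_of mulr_suml raddf_sum -sumrN; apply: eq_bigr => nu _ /=.
rewrite -scalerAl mcoeffZ -[RHS]mulrC -mulrN; congr (_ * _).
rewrite /lin mulr_sumr raddf_sum -sumrN; apply: eq_bigr => k _ /=.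
by rewrite -scalerAr mcoeffZ -mpolyXD mcoeffX mxE eq_sym mulNr mulrC.
Qed.

Lemma msize_residue de q j : (forall k, (msize (de k) <= e)%N) ->
  (forall i, (msize (q i) <= e)%N) -> (msize (residue de q j) <= e.+1)%N.
Proof.
move=> hd hq; apply: leq_trans (msizeD_le _ _) _; rewrite geq_max msizeN.
apply/andP; split; apply: (leq_trans (msize_sum _ _ _)); apply/bigmax_leqP => i _.
  by apply: leq_trans (mmeasureZ_le _ _ _) _; apply: leq_trans (hd i) _.
have [->|q0] := eqVneq (q i) 0; first by rewrite mul0r msize0.
have [->|l0] := eqVneq (lin (al j)) 0; first by rewrite mulr0 msize0.
have := dhomog_uniq l0 (dhomog_msize (lin_homog (al j))) (lin_homog (al j)).
rewrite msizeM // (mpolySpred _ l0) /= => ->.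
by rewrite addnS addn1 /= ltnS; apply: hq.
Qed.

(** The vector [v *m M] lists the coefficients of the residues, so a trivial kernel is full row
    rank, and [fullrankfun] then selects the columns of a nonzero minor. *)
Lemma no_kernelP : no_kernel <-> exists f, ev (minor_poly f) != 0.
Proof.
pose M := map_mx ev emx.
have ME a b : M a b = edot (enum_val b) (enum_val a) by rewrite !mxE ev_epoly.
have evM f : ev (minor_poly f) = \det (colsub f M).
  by rewrite /minor_poly -det_map_mx; congr (\det _); apply/matrixP => a b; rewrite !mxE.
pose dev (v : 'rV[F]_#|{: col_t}|) nu k := v 0 (enum_rank (inl k, nu)).
pose qv (v : 'rV[F]_#|{: col_t}|) nu i := v 0 (enum_rank (inr i, nu)).
have vM v r : (v *m M) 0 (enum_rank r) = (residue (fun k => poly_of ((dev v)^~ k))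
    (fun i => poly_of ((qv v)^~ i)) r.1)@_(val r.2).
  rewrite residue_coef mxE (reindex _ (onW_bij _ (enum_rank_bij _))) /=; apply: eq_bigr => c _.
  by rewrite ME !enum_rankK mulrC; congr (_ * _); case: c => -[].
split=> [nk|[f fn] de q sde sq res].
  have free : row_free M.
    rewrite -kermx_eq0; apply/rowV0P => v /sub_kermxP vM0.
    have [||j|d0 q0] := nk (fun k => poly_of ((dev v)^~ k)) (fun i => poly_of ((qv v)^~ i)).
    - by move=> k; apply: msize_poly_of.
    - by move=> i; apply: msize_poly_of.
    - apply/mpolyP => mu; rewrite mcoeff0.
      have [lt|ge] := ltnP (mdeg mu) e.+1.
        by rewrite -[mu]/(val (BMultinom lt)) -(vM v (j, BMultinom lt)) vM0 mxE.
      apply/memN_msupp_eq0; apply: contraL ge => /msize_mdeg_lt lt.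
      rewrite -ltnNge; apply: leq_trans lt _.
      by apply: msize_residue => ?; apply: msize_poly_of.
    apply/rowP => a; rewrite [RHS]mxE -[a]enum_valK; case: (enum_val a) => -[k|i] nu.
      by rewrite -[LHS](poly_of_coef ((dev v)^~ k)) d0 mcoeff0.
    by rewrite -[LHS](poly_of_coef ((qv v)^~ i)) q0 mcoeff0.
  have full : row_full M^T by rewrite /row_full mxrank_tr.
  exists (fullrankfun full); rewrite evM -det_tr trmx_mxsub.
  by have := fullrowsub_unit full; rewrite unitmxE unitfE.
pose v : 'rV[F]_#|{: col_t}| := \row_a match enum_val a with
  (inl k, nu) => (de k)@_(val nu) | (inr i, nu) => (q i)@_(val nu) end.
have dE k : poly_of ((dev v)^~ k) = de k.
  rewrite -[RHS](poly_ofK (sde k)); congr poly_of; apply/funext => nu.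
  by rewrite /dev mxE enum_rankK.
have qE i : poly_of ((qv v)^~ i) = q i.
  rewrite -[RHS](poly_ofK (sq i)); congr poly_of; apply/funext => nu.
  by rewrite /qv mxE enum_rankK.
have vM0 : v *m M = 0.
  apply/rowP => b; rewrite -[b]enum_valK vM [RHS]mxE.
  have -> : (fun k => poly_of ((dev v)^~ k)) = de by apply/funext.
  have -> : (fun i => poly_of ((qv v)^~ i)) = q by apply/funext.
  by rewrite res mcoeff0.
have v0 : v = 0.
  have u : colsub f M \in unitmx by rewrite unitmxE unitfE -evM.
  have z : v *m colsub f M = 0.
    apply/rowP => b; rewrite [RHS]mxE.
    have E : (v *m M) 0 (f b) = 0 by rewrite vM0 mxE.
    apply: etrans E; rewrite [LHS]mxE [RHS]mxE; apply: eq_bigr => a _; congr (_ * _).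
    by rewrite mxE.
  by rewrite -[v](mulmxK u) z mul0mx.
have P0 (c : 'X_{1..3 < e} -> F) : (forall nu, c nu = 0) -> poly_of c = 0.
  by move=> c0; rewrite /poly_of big1 // => nu _; rewrite c0 scale0r.
by split=> [k|i]; rewrite -?dE -?qE; apply: P0 => nu; rewrite /dev /qv v0 mxE.
Qed.

End Kernel.
End Minors.

Section NoKernel.
Variables (F : numFieldType) (m e : nat).
Local Notation S := {mpoly F[3]}.
Variable A : 'M[F]_(m.+1, 3).
Local Notation al j := (row j A).
Hypothesis nz : forall i, al i != 0.
Hypothesis dist : forall i j, i != j -> ~ exists c, al i = c *: al j.
Variable f0 : frame (al ord0).

Lemma msize_homog k (p : S) : p \is k.-homog -> (msize p <= k.+1)%N.
Proof.
by move=> hp; rewrite msizeE; apply/bigmax_leqP_seq => mu /(dhomog_mf hp) /= ->.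
Qed.

Lemma residue0 de (q : 'I_m -> S) : residue A de q ord0 = \sum_k A ord0 k *: de k.
Proof. by rewrite /residue [X in _ - X]big_pred0 ?subr0 // => i; apply/negbTE/neq_lift. Qed.

Lemma residue_lift de (q : 'I_m -> S) i : residue A de q (lift ord0 i) =
  \sum_k A (lift ord0 i) k *: de k - q i * lin (al (lift ord0 i)).
Proof.
by rewrite /residue [X in _ - X](big_pred1 i).
Qed.

Lemma sum_form j (x : S * S) :
  \sum_k A j k *: (fP f0 0 k *: x.1 + fN f0 0 k *: x.2) = form f0 j x.
Proof.
rewrite /form /uA /vA /dot !scaler_suml -big_split; apply: eq_bigr => k _.
by rewrite scalerDr !scalerA mxE.
Qed.

Lemma pair_of_kills_first (de : 'I_3 -> S) : \sum_k A ord0 k *: de k = 0 -> forall i,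
  de i = fP f0 0 i *: (\sum_k fs f0 0 k *: de k) + fN f0 0 i *: (\sum_k ft f0 0 k *: de k).
Proof.
move=> E i.
have E' : \sum_k fR f0 0 i *: (A ord0 k *: de k) = 0 by rewrite -scaler_sumr E scaler0.
transitivity (\sum_k (fP f0 0 i *: (fs f0 0 k *: de k) + fN f0 0 i *: (ft f0 0 k *: de k)
    + fR f0 0 i *: (A ord0 k *: de k))); last first.
  by rewrite !big_split /= E' addr0 !scaler_sumr.
rewrite (bigD1 i) //= big1 ?addr0 => [|k ki]; rewrite !scalerA -!scalerDl.
  have := fres f0 i i; rewrite !mxE eqxx => ->; by rewrite scale1r.
by have := fres f0 i k; rewrite !mxE eq_sym (negbTE ki) => ->; rewrite scale0r.
Qed.

(** Passage from standard coordinates to pairs. Solutions of the system may be inhomogeneous;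
    [DM_msize] reduces them to homogeneous ones. *)
Lemma no_kernel_DD : no_kernel e A <->
  forall k x, (k < e)%N -> DDh f0 m.+1 k x -> x = 0.
Proof.
split=> [nk k x ke [hx [h1 h2]]|hmin de q sde sq res].
  have sx1 : (msize x.1 <= e)%N by apply: leq_trans (msize_homog h1) ke.
  have sx2 : (msize x.2 <= e)%N by apply: leq_trans (msize_homog h2) ke.
  have l0 (j : 'I_m.+1) : lin (al j) != 0 by rewrite lin_eq0 nz.
  have /choice[q qE] (i : 'I_m) : exists g, form f0 (lift ord0 i) x = g * lin (al (lift ord0 i)).
    by apply: hx; rewrite lift0 /= ltnS.
  have [||j|d0 _] := nk (fun l => fP f0 0 l *: x.1 + fN f0 0 l *: x.2) q.
  - move=> l; apply: leq_trans (msizeD_le _ _) _; rewrite geq_max.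
    by rewrite !(leq_trans (mmeasureZ_le _ _ _)).
  - move=> i; have [->|q0] := eqVneq (q i) 0; first by rewrite msize0.
    have := msize_homog (form_homog f0 (lift ord0 i) (conj h1 h2)); rewrite qE msizeM //.
    have := dhomog_uniq (l0 (lift ord0 i)) (dhomog_msize (lin_homog _)) (lin_homog _).
    rewrite (mpolySpred _ (l0 (lift ord0 i))) /= => -> ; rewrite addnS addn1 /= ltnS => h.
    exact: leq_trans h (ltnW ke).
  - case: (unliftP ord0 j) => [i ->|->]; last first.
      by rewrite residue0 sum_form /form /uA /vA faP faN !scale0r addr0.
    by rewrite residue_lift sum_form qE subrr.
  have c (v : 'rV[F]_3) : dot v (fP f0) *: x.1 + dot v (fN f0) *: x.2 = 0.
    transitivity (\sum_k v 0 k *: (fP f0 0 k *: x.1 + fN f0 0 k *: x.2)); last first.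
      by rewrite big1 // => k' _; rewrite d0 scaler0.
    rewrite /dot !scaler_suml -big_split; apply: eq_bigr => k' _.
    by rewrite scalerDr !scalerA.
  have := c (fs f0); rewrite fsP fsN scale1r scale0r addr0 => x1.
  have := c (ft f0); rewrite ftP ftN scale1r scale0r add0r => x2.
  by rewrite [x]surjective_pairing x1 x2.
have k0 := res ord0; rewrite residue0 in k0.
pose x : S * S := (\sum_k fs f0 0 k *: de k, \sum_k ft f0 0 k *: de k).
have deE i : de i = fP f0 0 i *: x.1 + fN f0 0 i *: x.2 by apply: pair_of_kills_first.
have qE i : form f0 (lift ord0 i) x = q i * lin (al (lift ord0 i)).
  apply/eqP; rewrite -subr_eq0 -(res (lift ord0 i)) residue_lift -sum_form.
  by apply/eqP; congr (_ - _); apply: eq_bigr => k _; rewrite -deE.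
have sz (v : 'rV[F]_3) : (msize (\sum_k v 0 k *: de k) <= e)%N.
  apply: (leq_trans (msize_sum _ _ _)); apply/bigmax_leqP => k _.
  exact: leq_trans (mmeasureZ_le _ _ _) (sde k).
have x0 : x = 0.
  apply/eqP/negP => /negP x0.
  have hx : DD f0 m.+1 x.
    apply/DMP => j j0; case: (unliftP ord0 j) j0 => [i -> _|->]; last by rewrite eqxx.
    by exists (q i).
  by case: (DM_msize hmin hx x0); rewrite ltnNge /= sz.
have de0 k : de k = 0 by rewrite deE x0 !scaler0 addr0.
split=> // i; apply/eqP; have := qE i; rewrite x0 /form !scaler0 addr0 => /esym/eqP.
by rewrite mulf_eq0 lin_eq0 (negbTE (nz _)) orbF.
Qed.

End NoKernel.

(** * Comparison with a free arrangement of the same characteristic polynomial *)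

Section Kernel.
Variables (F : numFieldType) (m : nat).
Implicit Types A B : 'M[F]_(m.+1, 3).
Let nzr A := forall i, row i A != 0.
Let dst A := forall i j, i != j -> ~ exists c, row i A = c *: row j A.

Lemma DDh_char_poly A B (fA : frame (row ord0 A)) (fB : frame (row ord0 B)) k d :
  nzr A -> dst A -> nzr B -> dst B ->
  char_poly_gen A = char_poly_gen B -> (m <= k)%N ->
  hasdim (DDh fA m.+1 k) d -> hasdim (DDh fB m.+1 k) d.
Proof.
move=> nA dA nB dB cAB mk hA.
have mk1 : (m <= k.+1)%N by apply: leqW.
have [a ha aE] := DDh_total nA dA fA mk1.
have [b hb bE] := DDh_total nB dB fB mk1.
have sE : (\sum_h npts A h = \sum_h npts B h)%N.
  by apply/eqP; rewrite -eqz_nat (sum_npts nA dA) (sum_npts nB dB) cAB.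
have ab : a = b.
  apply/eqP; rewrite -(eqn_add2r (\sum_(1 <= i < m.+1) (k.+1 - i) + \sum_h npts B h)).
  by rewrite -{1}sE !addnA aE bE.
by rewrite (hasdim_uniq hA ha) ab.
Qed.

(** The exponents [d1] and [m - d1] of [B] give the dimensions for [A] too in high degrees. Both
    sides then amount to [d1 <= d], through [sec_ideal_degree] and [sec_ideal_unit]. *)
Lemma sec_ideal_no_kernel A B (fA : frame (row ord0 A)) (fB : frame (row ord0 B)) d th d1 th1 :
  nzr A -> dst A -> nzr B -> dst B ->
  char_poly_gen A = char_poly_gen B ->
  DDh fA m.+1 d th -> th != 0 -> (forall k x, (k < d)%N -> DDh fA m.+1 k x -> x = 0) ->
  DDh fB m.+1 d1 th1 -> th1 != 0 -> (forall k x, (k < d1)%N -> DDh fB m.+1 k x -> x = 0) ->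
  sec_ideal fB th1 1 -> sec_ideal fA th 1 <-> no_kernel d1 A.
Proof.
move=> nA dA nB dB cAB hth th0 thmin hth1 th10 th1min I1.
have d1m : (d1 <= m)%N := DD_degree_le nB th1min.
pose d2 := (m - d1)%N.
have d12 : (d1 + d2 = m)%N by rewrite subnKC.
(* Since 1 lies in the ideal of [B], some derivation of degree [d2] has determinant [Q0] with [th1];
   below degree [d1] it would be 0. *)
have le12 : (d1 <= d2)%N.
  rewrite leqNgt; apply/negP => lt.
  have [|x hx xE] := @sec_ideal_realize _ _ _ fB d1 th1 hth1 d2 0 1 _ (dhomog1 _ _) I1.
    by rewrite addnC d12 add0n.
  have x0 := th1min _ _ lt hx.
  move/eqP: xE; rewrite x0 /wedge !mulr0 subr0 mul1r eq_sym.
  by apply/negP/(Q0_neq0 nB).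
have hdim k : (m + m <= k)%N ->
    hasdim (DDh fA m.+1 k) ('C(k - d1 + 2, k - d1) + 'C(k - d2 + 2, k - d2)).
  move=> mk.
  have [D hD _] := DDh_total nB dB fB (leq_trans (leq_addr m m) (leqW mk)).
  have dk : (d1 <= k)%N by lia.
  have kd : (k + d1 = (k - d2) + m)%N by rewrite /d2; lia.
  have [e he DE] := sec_ideal_dim nB dB hth1 th10 th1min dk kd hD.
  have eE : e = 'C(k - d2 + 2, k - d2).
    apply: hasdim_uniq he (hasdim_eq _ (hasdim_homog F 2 (k - d2))) => p; split=> [hp|[]//].
    split; first exact: hp.
    have [_ _ IM] := sec_ideal_ideal fB th1.
    by rewrite -[p]mulr1; apply: IM.
  apply: (DDh_char_poly fA nB dB nA dA (esym cAB)); first by lia.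
  rewrite -eE -DE; exact: hD.
rewrite (no_kernel_DD _ nA fA).
split=> [IA k x kd1 hx|nk].
  have led := sec_ideal_degree nA dA hth th0 thmin d12 le12 hdim IA.
  exact: thmin (leq_trans kd1 led) hx.
apply: (sec_ideal_unit nA dA hth th0 thmin d12 le12 _ hdim).
rewrite leqNgt; apply/negP => lt.
by move/eqP: th0; apply; apply: nk lt hth.
Qed.

End Kernel.

Lemma free_sec_ideal (R : realType) m (A : 'M[R[i]]_(m.+1, 3)) (f0 : frame (row ord0 A)) d th :
  nonzero_rows A -> distinct_planes A ->
  DDh f0 m.+1 d th -> th != 0 -> (forall k x, (k < d)%N -> DDh f0 m.+1 k x -> x = 0) ->
  arr_free A <-> sec_ideal f0 th 1.
Proof.
move=> nA dA hth th0 thmin; split; first exact: (sec_ideal_of_free nA dA hth th0 thmin).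
exact: (free_of_sec_ideal nA dA hth).
Qed.

Lemma char_poly_genE (R : realType) m (A : 'M[R[i]]_(m.+1, 3)) :
  char_poly_arr A = char_poly_gen A.
Proof. by []. Qed.

Theorem theorem1p41 (R : realType) (n : nat) (hn : (1 <= n)%N) (f : {poly int}) :
  zariski_open_in (in_C3n (R := R) (n := n) f)
    (fun A => in_C3n f A /\ arr_free A).
Proof.
case: n hn => // m _.
have [[B [[nB dB cB] freeB]]|none] :=
  EM (exists B : 'M[R[i]]_(m.+1, 3), in_C3n f B /\ arr_free B); last first.
  (* If no arrangement with this characteristic polynomial is free, the empty family of polynomials
     describes the empty open set. *)
  exists (fun=> False); split=> // A nA CA; split=> [FA|[p []//]].
  by case: none; exists A.
have [fB _] := frame_exists (nB ord0).
have [d1 [th1 [hth1 th10 th1min]]] := exists_theta nB fB.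
have IB := (free_sec_ideal nB dB hth1 th10 th1min).1 freeB.
(* The minors of the system for degrees below [d1], the smaller exponent of the fixed free
   arrangement [B]. *)
exists (fun p => exists g, p = @minor_poly R[i] m d1 g); split.
  by move=> _ [g ->]; eexists; exact: (@hom_at_minor _ m d1 g).
move=> A nA CA; have [_ dA cA] := CA.
have [fA _] := frame_exists (nA ord0).
have [d [th [hth th0 thmin]]] := exists_theta nA fA.
have E := free_sec_ideal nA dA hth th0 thmin.
have cAB : char_poly_gen A = char_poly_gen B by rewrite -!char_poly_genE cA cB.
have K := sec_ideal_no_kernel nA dA nB dB cAB hth th0 thmin hth1 th10 th1min IB.
have M := no_kernelP d1 A.
split=> [[_ /E/K/M[g gn]]|[_ [[g ->] gn]]].
  exists (@minor_poly R[i] m d1 g); split; first by exists g.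
  exact: gn.
split; first exact: CA.
by apply/E/K/M; exists g; exact: gn.
Qed.
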